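(* Let $T>0$, $0<\delta<1$, $m>4$. Let $\mathbf a=(-a(r)\sin\phi,a(r)\cos\phi)$ and $b=b(r,\phi)$ belong to $H^m(\Omega)$ and let the forcing $\mathbf F=(-f_1\sin\phi,f_1\cos\phi,f_2)$, $f_1=f_1(t,r)$, $f_2=f_2(t,r,\phi)$, belong to $C^\infty([0,T]\times\Omega)$, where $\Omega=\{(r,\phi):\delta\le r\le1,\ \phi\in[0,2\pi]\}$; the data are independent of the viscosities. Assume that for $R\in\{\delta,1\}$ and all $\phi$ the compatibility conditions $$a(R)=0,\qquad b(R,\phi)=0,$$ $$\nu_1\bigl(a''(R)+\tfrac1R a'(R)\bigr)-\tfrac{\nu_2}{R^2}a(R)+f_1(0,R)=0,\qquad \nu_1\bigl(\partial_{rr}b(R,\phi)+\tfrac1R\partial_r b(R,\phi)\bigr)+f_2(0,R,\phi)=0$$ hold for the viscosities under consideration. Let $\mathbf u^\nu$, $\mathbf u^0$ be the viscous and inviscid solutions defined in the context. Then there exists a constant $c$ independent of $\nu_1,\nu_2$ such that for all $\nu_1,\nu_2\in(0,1]$ $$\|\mathbf u^\nu-\mathbf u^0\|_{L^\infty(0,T;L^2(\Omega))}\le c\,(\nu_1^{1/4}+\nu_2).$$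
   Context: Pipe-parallel flow with anisotropic viscosity. $\delta$ is a fixed small parameter, independent of viscosity. Cylindrical coordinates $(x,r,\phi)$ with unit vectors $\mathbf e_r,\mathbf e_\phi,\mathbf e_x$ are used; fields are independent of $x$ and $2\pi$-periodic in $\phi$; $\Omega$ carries the measure $r\,dr\,d\phi$. Viscous problem: $\mathbf u^\nu=u_\phi^\nu(t,r)\mathbf e_\phi+u_x^\nu(t,r,\phi)\mathbf e_x$, $\nu=(\nu_1,\nu_2)$ (radial and angular viscosities), solves in $\Omega\times[0,T]$ $$\partial_tu_\phi^\nu-\nu_1\tfrac1r\partial_r(r\partial_ru_\phi^\nu)+\nu_2\tfrac1{r^2}u_\phi^\nu=f_1,$$ $$\partial_tu_x^\nu+\tfrac1r u_\phi^\nu\partial_\phi u_x^\nu-\nu_1\tfrac1r\partial_r(r\partial_ru_x^\nu)-\nu_2\tfrac1{r^2}\partial_{\phi\phi}u_x^\nu=f_2,$$ with $u_\phi^\nu|_{t=0}=a(r)$, $u_x^\nu|_{t=0}=b(r,\phi)$ and $u_\phi^\nu=u_x^\nu=0$ at $r=1$ and $r=\delta$. Inviscid (Euler) problem: $\mathbf u^0=u_\phi^0(t,r)\mathbf e_\phi+u_x^0(t,r,\phi)\mathbf e_x$ solves $\partial_tu_\phi^0=f_1$, $\partial_tu_x^0+\frac{u_\phi^0}{r}\partial_\phi u_x^0=f_2$ with the same initial data. *)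

(* Defs.v *)
From HB Require Import structures.
From mathcomp Require Import all_boot all_order all_algebra.
From mathcomp Require Import all_classical all_reals all_analysis.
From mathcomp Require Import ess_sup_inf.

Set Implicit Arguments.
Unset Strict Implicit.
Unset Printing Implicit Defensive.

Import Order.TTheory GRing.Theory Num.Theory.
Import numFieldNormedType.Exports.

Local Open Scope classical_set_scope.
Local Open Scope ring_scope.

Section Smoothness.
Context {R : realType}.

(* Derivative at x in the direction v relative to A: only increments h with
   h *: v + x in A are used, so it is one-sided at a boundary point.  When v
   points out of A on both sides (e.g. at a corner) it holds of every l. *)
Definition is_derive_in (V : normedModType R) (A : set V) (f : V -> R)
    (v x : V) (l : R) : Prop :=
  (fun h : R => h^-1 * (f (h *: v + x) - f x))
    @ within [set h | A (h *: v + x)] 0^' --> l.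

(* C^k up to the boundary of A. *)
Fixpoint Ck_on (V : normedModType R) (k : nat) (A : set V) (f : V -> R) : Prop :=
  {within A, continuous f} /\
  match k with
  | 0%N => True
  | k'.+1 => forall v : V, exists2 g : V -> R,
      (forall x, A x -> is_derive_in A f v x (g x)) & Ck_on k' A g
  end.

Definition smooth_on (V : normedModType R) (A : set V) (f : V -> R) : Prop :=
  forall k, Ck_on k A f.

(* One-variable derivative relative to I, one-sided at the ends of I. *)
Definition derive1_in (I : set R) (f : R -> R) (x : R) : R :=
  lim ((fun h : R => h^-1 * (f (h + x) - f x))
         @ within [set h | I (h + x)] 0^').

Definition periodic2pi (g : R -> R) : Prop := forall phi, g (phi + 2 * pi) = g phi.

End Smoothness.

Section Domain.
Context {R : realType}.
Variable delta : R.

(* Points of Omega are pairs (r, phi). *)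
Definition Omega : set (R * R) := `[delta, 1] `*` `[0, 2 * pi].

Definition dr_dphi :
    {measure set (measurableTypeR R * measurableTypeR R) -> \bar R} :=
  (lebesgue_measure \x lebesgue_measure)%E.

(* Norm of L^2(Omega) for the measure r dr dphi. *)
Definition L2norm (g : R * R -> R) : \bar R :=
  ((\int[dr_dphi]_(z in Omega) (g z ^+ 2 * z.1)%:E) `^ (2^-1))%E.

Definition in_L2 (g : R * R -> R) : Prop :=
  measurable_fun (Omega : set (measurableTypeR R * measurableTypeR R)) g
  /\ (L2norm g < +oo)%E.

(* Test functions for the annulus: no boundary in phi, compact support in r. *)
Record test_function (psi : R * R -> R) : Prop := {
  test_smooth : smooth_on setT psi ;
  test_periodic : forall r, periodic2pi (fun phi => psi (r, phi)) ;
  test_support : exists2 e : R, 0 < e &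
    forall r phi, ~ (delta + e <= r <= 1 - e) -> psi (r, phi) = 0 }.

(* g' is the weak derivative of g in the coordinate direction v, i.e.
   (1, 0) for d/dr and (0, 1) for d/dphi.  As a derivative with respect to the
   coordinates it is tested against dr dphi, without the weight r. *)
Definition weak_derive (v : R * R) (g g' : R * R -> R) : Prop :=
  forall psi, test_function psi ->
    \int[dr_dphi]_(z in Omega) (g z * 'D_v psi z) =
    - \int[dr_dphi]_(z in Omega) (g' z * psi z).

(* Sobolev space H^m(Omega): weak derivatives of order at most m are in L^2.
   Since Omega stays away from r = 0, using d/dphi or (1/r) d/dphi is
   immaterial. *)
Fixpoint in_Hm (m : nat) (g : R * R -> R) : Prop :=
  in_L2 g /\
  match m with
  | 0%N => True
  | m'.+1 => exists gr gphi : R * R -> R,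
      [/\ weak_derive (1, 0) g gr, weak_derive (0, 1) g gphi,
          in_Hm m' gr & in_Hm m' gphi]
  end.

End Domain.

Section Flow.
Context {R : realType}.
Variables (T delta : R).

Definition cyl2 : set (R * R) := `[0, T] `*` `[delta, 1].
Definition cyl3 : set (R * R * R) := cyl2 `*` setT.

Definition twice_derivable (D : set R) (g : R -> R) : Prop :=
  forall s, D s -> derivable g s 1 /\ derivable (derive1 g) s 1.

(* Classical solutions: continuous on the closed cylinder, with the derivatives
   occurring in the equations existing in the open cylinder.  Continuity at
   t = 0 makes a and b the continuous representatives of their H^m classes,
   so that their boundary values and derivatives are classical. *)
Record viscous_solution (nu1 nu2 : R) (a : R -> R) (b : R -> R -> R)
    (f1 : R -> R -> R) (f2 : R -> R -> R -> R)
    (uphi : R -> R -> R) (ux : R -> R -> R -> R) : Prop := {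
  visc_phi_cont : {within cyl2, continuous (fun z => uphi z.1 z.2)} ;
  visc_x_cont : {within cyl3, continuous (fun z => ux z.1.1 z.1.2 z.2)} ;
  visc_x_periodic : forall t r : R, 0 <= t <= T -> delta <= r <= 1 ->
    periodic2pi (ux t r) ;
  visc_phi_dt : forall t r : R, 0 < t < T -> delta < r < 1 ->
    derivable (uphi^~ r) t 1 ;
  visc_phi_dr : forall t : R, 0 < t < T -> twice_derivable `]delta, 1[ (uphi t) ;
  visc_x_dt : forall t r phi : R, 0 < t < T -> delta < r < 1 ->
    derivable (fun s => ux s r phi) t 1 ;
  visc_x_dr : forall t phi : R, 0 < t < T ->
    twice_derivable `]delta, 1[ (fun s => ux t s phi) ;
  visc_x_dphi : forall t r : R, 0 < t < T -> delta < r < 1 ->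
    twice_derivable setT (ux t r) ;
  visc_phi_eq : forall t r : R, 0 < t < T -> delta < r < 1 ->
    derive1 (uphi^~ r) t
    - nu1 * (r^-1 * derive1 (fun s => s * derive1 (uphi t) s) r)
    + nu2 * (r ^- 2 * uphi t r) = f1 t r ;
  visc_x_eq : forall t r phi : R, 0 < t < T -> delta < r < 1 ->
    derive1 (fun s => ux s r phi) t
    + r^-1 * uphi t r * derive1 (ux t r) phi
    - nu1 * (r^-1 * derive1 (fun s => s * derive1 (fun s' => ux t s' phi) s) r)
    - nu2 * (r ^- 2 * derive1 (derive1 (ux t r)) phi) = f2 t r phi ;
  visc_phi_init : forall r, delta <= r <= 1 -> uphi 0 r = a r ;
  visc_x_init : forall r phi, delta <= r <= 1 -> ux 0 r phi = b r phi ;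
  visc_phi_bdry : forall t : R, 0 <= t <= T -> uphi t delta = 0 /\ uphi t 1 = 0 ;
  visc_x_bdry : forall t phi : R, 0 <= t <= T ->
    ux t delta phi = 0 /\ ux t 1 phi = 0 }.

Record euler_solution (a : R -> R) (b : R -> R -> R)
    (f1 : R -> R -> R) (f2 : R -> R -> R -> R)
    (uphi : R -> R -> R) (ux : R -> R -> R -> R) : Prop := {
  euler_phi_cont : {within cyl2, continuous (fun z => uphi z.1 z.2)} ;
  euler_x_cont : {within cyl3, continuous (fun z => ux z.1.1 z.1.2 z.2)} ;
  euler_x_periodic : forall t r : R, 0 <= t <= T -> delta <= r <= 1 ->
    periodic2pi (ux t r) ;
  euler_phi_dt : forall t r : R, 0 < t < T -> delta < r < 1 ->
    derivable (uphi^~ r) t 1 ;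
  euler_x_dt : forall t r phi : R, 0 < t < T -> delta < r < 1 ->
    derivable (fun s => ux s r phi) t 1 ;
  euler_x_dphi : forall t r phi : R, 0 < t < T -> delta < r < 1 ->
    derivable (ux t r) phi 1 ;
  euler_phi_eq : forall t r : R, 0 < t < T -> delta < r < 1 ->
    derive1 (uphi^~ r) t = f1 t r ;
  euler_x_eq : forall t r phi : R, 0 < t < T -> delta < r < 1 ->
    derive1 (fun s => ux s r phi) t + uphi t r / r * derive1 (ux t r) phi
    = f2 t r phi ;
  euler_phi_init : forall r, delta <= r <= 1 -> uphi 0 r = a r ;
  euler_x_init : forall r phi, delta <= r <= 1 -> ux 0 r phi = b r phi }.

(* First-order compatibility at r = rho.  The angular term nu2 / rho^2 *
   d^2 b / dphi^2 is absent since b vanishes at r = rho. *)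
Definition compatible_at (nu1 nu2 : R) (a : R -> R) (b : R -> R -> R)
    (f1 : R -> R -> R) (f2 : R -> R -> R -> R) (rho : R) : Prop :=
  let d := derive1_in `[delta, 1] in
  nu1 * (d (d a) rho + rho^-1 * d a rho) - nu2 / rho ^+ 2 * a rho
    + f1 0 rho = 0
  /\ forall phi, nu1 * (d (d (b^~ phi)) rho + rho^-1 * d (b^~ phi) rho)
    + f2 0 rho phi = 0.

(* Norm of L^oo(0, T; L^2(Omega)) of vphi e_phi + vx e_x; the unit vectors
   e_phi and e_x are orthogonal. *)
Definition LooL2norm (vphi : R -> R -> R) (vx : R -> R -> R -> R) : \bar R :=
  ess_sup (mrestr lebesgue_measure (measurable_itv `[0, T]))
    (fun t => L2norm delta
       (fun z => Num.sqrt (vphi t z.1 ^+ 2 + vx t z.1 z.2 ^+ 2))).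

End Flow.

(* Main.v *)
(* Write q = nu1 ^ (1/4) and freeze a radius s.  The viscous flow at (t, r, phi) is
   compared with the inviscid flow at (t, s, phi), so that no radial derivative
   of the inviscid flow is needed.  The difference, multiplied by either sign, is
   bounded through the maximum principle by a constant times the barrier
     exp (-(r - delta) / q^2) + exp (-(1 - r) / q^2) + q + nu2 + (r - s)^2 / q^3,
   first for the angular and then for the axial component.  The equation is used
   only at a maximum in phi of the axial difference: there both angular
   derivatives coincide, and nu2 times the second angular derivative of the
   viscous flow is bounded above by nu2 times a semiconcavity constant of the
   inviscid flow, itself propagated by the transport equation.  The data only need
   to be Hoelder 1/2 in r and to have second angular differences O(h^2), which
   follows from the H^m hypothesis by duality with products of bump functions.
   At r = s the barrier is the boundary layer + q + nu2, and the L^2 norm of the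
   layer is O(q). *)
Require Import Defs.
From mathcomp Require Import all_boot all_order all_algebra.
From mathcomp Require Import all_classical all_reals all_analysis.
From mathcomp Require Import measurable_realfun ess_sup_inf.
From mathcomp Require Import ring lra.
Import Order.TTheory GRing.Theory Num.Theory.
Import numFieldNormedType.Exports.
Local Open Scope classical_set_scope.
Local Open Scope ring_scope.
Set Implicit Arguments.
Unset Strict Implicit.
Unset Printing Implicit Defensive.

(** * Smooth functions of one variable and test functions *)

Section smooth1d.
Context {R : realType}.
Implicit Types (f g df dg : R -> R) (x y : R).

(** The solution records give derivatives only pointwise in the open cylinder, and the inviscid one
    gives neither a radial nor a second angular derivative. This favours the maximum principle over
    an energy estimate: it looks at a single interior point and differentiates there only what is
    known to be differentiable. The powers of [q] are forced. A layer of width [q^2 = sqrt nu1] is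
    one on which diffusion acts with a factor of order one, and its L^2 norm is the root of its
    width. Freezing the radius costs the modulus [sqrt |r - s|]; a quadratic penalty that absorbs it
    together with [q] needs the coefficient [q^-3], and diffusion turns this into [q^4 * q^-3 = q].
    The angular component comes before the axial one because its equation is autonomous, while the
    axial transport speed contains it. On the data side, a pairing bounded by the mass of a
    nonnegative test function is a pointwise bound; primitives of the test factors enter because
    their supremum is controlled by that mass. *)

Lemma is_derive_add f g x a b : is_derive x 1 f a -> is_derive x 1 g b ->
  is_derive x 1 (fun y => f y + g y) (a + b).
Proof. by move=> h k; apply: is_deriveD. Qed.

Lemma is_derive_opp f x a : is_derive x 1 f a -> is_derive x 1 (fun y => - f y) (- a).
Proof. by move=> h; apply: is_deriveN. Qed.

Lemma is_derive_mul f g x a b : is_derive x 1 f a -> is_derive x 1 g b ->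
  is_derive x 1 (fun y => f y * g y) (a * g x + f x * b).
Proof. by move=> h k; apply: is_derive_eq; rewrite /GRing.scale /= addrC mulrC. Qed.

Lemma is_derive_chain f g x a b : is_derive (g x) 1 f a -> is_derive x 1 g b ->
  is_derive x 1 (fun y => f (g y)) (a * b).
Proof. by move=> h k; exact: (is_derive1_comp h k). Qed.

Lemma is_derive_affine (c d : R) x : is_derive x 1 (fun y => c * y + d) c.
Proof.
by have := is_derive_add (is_derive_mul (is_derive_cst c x 1) (is_derive_id x 1))
  (is_derive_cst d x 1); rewrite mul0r mulr1 add0r addr0.
Qed.

Lemma is_derive_continuous f x a : is_derive x 1 f a -> {for x, continuous f}.
Proof.
by move=> h; apply/differentiable_continuous/derivable1_diffP; exact: ex_derive.
Qed.

Lemma is_derive_to f x a b : is_derive x 1 f a -> a = b -> is_derive x 1 f b.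
Proof. by move=> h <-. Qed.

(** The derivative is carried as a witness, so that closure under products and composition is a
    plain induction on [k]. *)
Fixpoint Ck (k : nat) (f : R -> R) : Prop :=
  if k is k'.+1 then exists2 df, (forall x, is_derive x 1 f (df x)) & Ck k' df
  else continuous f.

Definition smooth f := forall k, Ck k f.

Lemma Ck_continuous k f : Ck k f -> continuous f.
Proof. by case: k => // k [df h _] x; exact: is_derive_continuous (h x). Qed.

Lemma CkW k f : Ck k.+1 f -> Ck k f.
Proof.
elim: k f => [|k ih] f; first exact: Ck_continuous.
by case=> df h hk; exists df => //; exact: ih.
Qed.

Lemma Ck_cst k (c : R) : Ck k (fun=> c).
Proof.
elim: k c => [|k ih] c /=; first exact: cst_continuous.
by exists (fun=> 0) => // x; exact: is_derive_cst.
Qed.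

Lemma Ck_affine k (c d : R) : Ck k (fun y => c * y + d).
Proof.
case: k => [|k]; last by exists (fun=> c); [move=> x; exact: is_derive_affine|exact: Ck_cst].
by move=> x; exact: is_derive_continuous (is_derive_affine c d x).
Qed.

Lemma Ck_add k f g : Ck k f -> Ck k g -> Ck k (fun y => f y + g y).
Proof.
elim: k f g => [|k ih] f g /=; first by move=> cf cg x; apply: continuousD; [exact: cf|exact: cg].
case=> df hf cf [dg hg cg]; exists (fun y => df y + dg y); last exact: ih.
by move=> x; exact: is_derive_add.
Qed.

Lemma Ck_mul k f g : Ck k f -> Ck k g -> Ck k (fun y => f y * g y).
Proof.
elim: k f g => [|k ih] f g; first by move=> cf cg x; apply: continuousM; [exact: cf|exact: cg].
move=> Cf Cg; have := Cf; have := Cg; case=> dg hg cg [df hf cf].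
exists (fun y => df y * g y + f y * dg y); first by move=> x; exact: is_derive_mul.
by apply: Ck_add; apply: ih => //; exact: CkW.
Qed.

Lemma Ck_comp k f g : Ck k f -> Ck k g -> Ck k (fun y => f (g y)).
Proof.
elim: k f g => [|k ih] f g.
  by move=> cf cg x; apply: continuous_comp; [exact: cg|exact: cf].
move=> Cf Cg; have := Cf; have := Cg; case=> dg hg cg [df hf cf].
exists (fun y => df (g y) * dg y); first by move=> x; exact: is_derive_chain.
by apply: Ck_mul => //; apply: ih => //; exact: CkW.
Qed.

Lemma smooth_cst (c : R) : smooth (fun=> c). Proof. by move=> k; exact: Ck_cst. Qed.

Lemma smooth_affine (c d : R) : smooth (fun y => c * y + d).
Proof. by move=> k; exact: Ck_affine. Qed.

Lemma smooth_add f g : smooth f -> smooth g -> smooth (fun y => f y + g y).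
Proof. by move=> hf hg k; exact: Ck_add. Qed.

Lemma smooth_mul f g : smooth f -> smooth g -> smooth (fun y => f y * g y).
Proof. by move=> hf hg k; exact: Ck_mul. Qed.

Lemma smooth_comp f g : smooth f -> smooth g -> smooth (fun y => f (g y)).
Proof. by move=> hf hg k; exact: Ck_comp. Qed.

Lemma smooth_opp f : smooth f -> smooth (fun y => - f y).
Proof.
move=> hf; rewrite (_ : (fun y => _) = (fun y => -1 * f y + 0)).
  exact: (@smooth_comp (fun y => -1 * y + 0) f (smooth_affine _ _) hf).
by apply/funext => y; rewrite mulN1r addr0.
Qed.

Lemma smooth_shift f c : smooth f -> smooth (fun y => f (y + c)).
Proof.
move=> hf; apply: smooth_comp => //.
rewrite (_ : (fun y => _) = (fun y => 1 * y + c)); first exact: smooth_affine.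
by apply/funext => y; rewrite mul1r.
Qed.

Lemma smooth_primitive f df :
  (forall x, is_derive x 1 f (df x)) -> smooth df -> smooth f.
Proof. by move=> h hd [|k]; [apply: (@CkW 0)|]; exists df => //; exact: hd. Qed.

Lemma smooth_derive f df :
  (forall x, is_derive x 1 f (df x)) -> smooth f -> smooth df.
Proof.
move=> h hf k; have [dg hg cg] := hf k.+1.
suff -> : df = dg by [].
by apply/funext => x; rewrite -(@derive_val _ _ _ _ _ _ _ (h x)); apply: derive_val.
Qed.

Lemma smooth_continuous f : smooth f -> continuous f.
Proof. by move/(_ 0%N). Qed.

Lemma smooth_derivable f : smooth f -> forall x, is_derive x 1 f (derive1 f x).
Proof.
move=> hf x; have [df h _] := hf 1%N.
by apply: DeriveDef; [exact: (@ex_derive _ _ _ _ _ _ _ (h x))|rewrite derive1E].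
Qed.

Lemma smooth_derive1 f : smooth f -> smooth (derive1 f).
Proof. by move=> hf; apply: (smooth_derive (smooth_derivable hf)). Qed.

Lemma smooth_sin_cos : smooth (@sin R) /\ smooth (@cos R).
Proof.
suff H k : Ck k (@sin R) /\ Ck k (@cos R) by split=> k; have [] := H k.
elim: k => [|k [ihs ihc]].
  by split; [exact: continuous_sin|exact: continuous_cos].
split; first by exists cos => // x; exact: is_derive_sin.
exists (fun y => -1 * sin y + 0).
  by move=> x; rewrite mulN1r addr0; exact: is_derive_cos.
exact: (@Ck_comp k (fun y => -1 * y + 0) (@sin R) (Ck_affine _ _ _) ihs).
Qed.

End smooth1d.

(** * The flat function [exp (-1/x)] and its derivatives *)

Section bump.
Context {R : realType}.
Implicit Types (p : {poly R}) (x y : R).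

(* [p(1/x) exp(-1/x)], extended by 0: a class closed under differentiation. *)
Definition flat p (x : R) : R := if 0 < x then p.[x^-1] * expR (- x^-1) else 0.

(** Monomial by monomial, from [y^i <= i! * expR y]. At [y = x^-1] this says that [exp (-1/x)] beats
    every pole at 0. *)
Lemma horner_le_expR p : exists2 C : R, 0 <= C & forall y, 0 <= y -> `|p.[y]| <= C * expR y.
Proof.
exists (\sum_(i < size p) `|p`_i| * i`!%:R).
  by apply: sumr_ge0 => i _; rewrite mulr_ge0.
move=> y y0; rewrite horner_coef (le_trans (ler_norm_sum _ _ _))// mulr_suml ler_sum// => i _.
rewrite normrM -mulrA ler_wpM2l// normrX ger0_norm//.
case: (i : nat) => [|n]; first by rewrite expr0 fact0 mul1r -(expR0 R) ler_expR.
have := expR_ge1Dxn n y0; rewrite -lerBrDl => h.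
rewrite -ler_pdivrMl ?ltr0n ?fact_gt0// mulrC (le_trans h)//.
by rewrite gerBl.
Qed.

(** The growth bound is applied to [p * 'X^2], whose extra factor [x^-2] becomes the [x^2] on the
    right. A quadratic bound makes the difference quotient at 0 vanish. *)
Lemma flat_quadratic p : exists2 C : R, 0 <= C & forall x, `|flat p x| <= C * x ^+ 2.
Proof.
have [C C0 h] := horner_le_expR (p * 'X^2).
exists C => // x; rewrite /flat; case: ifPn => [x0|_]; last by rewrite normr0 mulr_ge0 ?sqr_ge0.
have xi : 0 <= x^-1 by rewrite invr_ge0 ltW.
have := h _ xi; rewrite hornerM hornerXn normrM => H.
rewrite normrM (ger0_norm (expR_ge0 _)) expRN.
rewrite ler_pdivrMr ?expR_gt0// -mulrA (mulrC (x ^+ 2)) mulrA -ler_pdivrMr ?exprn_gt0//.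
by move: H; rewrite exprVn (ger0_norm (x := _^-1)) // invr_ge0 sqr_ge0.
Qed.

Lemma is_derive_inv x : x != 0 -> is_derive x 1 (fun y : R => y^-1) (- x^-1 ^+ 2).
Proof.
move=> x0; apply: DeriveDef; first exact: derivableV.
by rewrite (@deriveV _ _ id)// derive_id /GRing.scale /= mulr1 exprVn.
Qed.

Lemma is_derive_horner p x : is_derive x 1 (fun y => p.[y]) (deriv p).[x].
Proof.
elim/poly_ind: p => [|p c ih].
  rewrite linear0 horner0 (_ : (fun y => _) = (fun=> 0)); first exact: is_derive_cst.
  by apply/funext => y; rewrite horner0.
rewrite derivD derivM derivX derivC (_ : (fun y => _) = (fun y => p.[y] * y + c)).
  have := is_derive_add (is_derive_mul ih (is_derive_id x 1)) (is_derive_cst c x 1).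
  by move/is_derive_to; apply; rewrite addr0 mulr1 !hornerE.
by apply/funext => y; rewrite !hornerE.
Qed.

(** Differentiating in [1/x] brings out [- x^-2], that is [- 'X^2] evaluated at [x^-1]; it
    multiplies [deriv p - p], the second term coming from the exponential. *)
Lemma is_derive_flat p x : is_derive x 1 (flat p) (flat ('X^2 * (p - deriv p)) x).
Proof.
case: (ltrgt0P x) => [x0|x0|->].
- apply: (@near_eq_is_derive _ _ _ (fun y => p.[y^-1] * expR (- y^-1))).
    near=> y; rewrite /flat ifT//; near: y; exact: lt_nbhsr.
  rewrite /flat x0; have xn0 : x != 0 by rewrite gt_eqF.
  have dV := is_derive_inv xn0.
  have dE := is_derive_chain (is_derive_expR _) (is_derive_opp dV).
  apply: (is_derive_to (is_derive_mul (is_derive_chain (is_derive_horner p _) dV) dE)).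
  rewrite hornerM hornerXn hornerD hornerN; ring.
- apply: (@near_eq_is_derive _ _ _ (cst 0)).
    near=> y; rewrite /flat ifF//; apply/negbTE; rewrite -leNgt ltW//; near: y; exact: lt_nbhsl.
  by rewrite /flat ifF; [exact: is_derive_cst|apply/negbTE; rewrite -leNgt ltW].
- have [C C0 h] := flat_quadratic p.
  have f0 q : flat q 0 = 0 by rewrite /flat ltxx.
  rewrite f0.
  suff H : (fun h : R => h^-1 *: ((flat p \o shift 0) (h *: 1) - flat p 0)) @ 0^' --> (0 : R).
    by apply: DeriveDef; [apply/cvg_ex; exists 0|exact: cvg_lim H].
  apply/cvgr0Pnorm_lt => e e0.
  near=> z; rewrite /= addr0 f0 subr0 normrZ.
  rewrite [z *: 1]mulr1 (le_lt_trans (y := C * `|z|))//.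
    have z0 : z != 0 by near: z; exact: nbhs_dnbhs_neq.
    rewrite normrV ?unitfE// ler_pdivrMl ?normr_gt0//.
    by rewrite mulrCA -expr2 real_normK ?num_real.
  rewrite (@le_lt_trans _ _ ((C + 1) * `|z|))//.
    by rewrite ler_wpM2r// lerDl.
  rewrite mulrC -ltr_pdivlMr; last by rewrite ltr_wpDl.
  near: z; apply: dnbhs0_lt; by rewrite divr_gt0// ltr_wpDl.
Unshelve. all: by end_near. Qed.

Lemma smooth_flat p : smooth (flat p).
Proof.
move=> k; elim: k p => [|k ih] p /=.
  by move=> x; exact: is_derive_continuous (is_derive_flat p x).
by exists (flat ('X^2 * (p - deriv p))) => // x; exact: is_derive_flat.
Qed.

Definition bump0 : R -> R := flat 1.

Lemma bump0E x : bump0 x = if 0 < x then expR (- x^-1) else 0.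
Proof. by rewrite /bump0 /flat hornerC mul1r. Qed.

Lemma bump0_ge0 x : 0 <= bump0 x.
Proof. by rewrite bump0E; case: ifP => // _; exact: expR_ge0. Qed.

Lemma bump0_gt0 x : 0 < x -> 0 < bump0 x.
Proof. by move=> x0; rewrite bump0E x0 expR_gt0. Qed.

Lemma bump0_eq0 x : x <= 0 -> bump0 x = 0.
Proof. by move=> x0; rewrite bump0E ltNge x0. Qed.

End bump.

(** * Test functions that are products of a radial and an angular factor *)

Section product_tests.
Context {R : realType}.
Implicit Types (X eta dX deta : R -> R) (v z : R * R).

Lemma is_derive_is_derive_in (V : normedModType R) (A : set V) (f : V -> R) (v x : V) (l : R) :
  is_derive x v f l -> is_derive_in A f v x l.
Proof.
move=> df; have /cvg_ex[l' h] := @ex_derive _ _ _ _ _ _ _ df.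
have -> : l = l' by rewrite -(@derive_val _ _ _ _ _ _ _ df); exact: cvg_lim h.
by apply: cvg_trans h; apply: cvg_app; exact: cvg_within.
Qed.

(** Only a directional derivative is asked for, so the one-variable product rule along the line
    through [z] in the direction [v] is enough. *)
Lemma is_derive_prod X eta a b v z :
  is_derive z.1 1 X a -> is_derive z.2 1 eta b ->
  is_derive z v (fun z => X z.1 * eta z.2) (v.1 * (a * eta z.2) + v.2 * (X z.1 * b)).
Proof.
move=> hX heta; set l := (X in is_derive _ _ _ X).
have hk : is_derive (0 : R) 1 (fun h => X (v.1 * h + z.1) * eta (v.2 * h + z.2)) l.
  apply: is_derive_to.
    apply: is_derive_mul.
      by apply: (is_derive_chain _ (is_derive_affine v.1 z.1 0)); rewrite mulr0 add0r; exact: hX.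
    by apply: (is_derive_chain _ (is_derive_affine v.2 z.2 0)); rewrite mulr0 add0r; exact: heta.
  by rewrite /l !mulr0 !add0r; ring.
have /cvg_ex[l' h] := @ex_derive _ _ _ _ _ _ _ hk.
have El : l = l' by rewrite -(@derive_val _ _ _ _ _ _ _ hk); exact: cvg_lim h.
have H : (fun h => h^-1 *: (((fun z => X z.1 * eta z.2) \o shift z) (h *: v) - X z.1 * eta z.2)) @ 0^' --> l.
  rewrite El; apply: cvg_trans h; apply: near_eq_cvg; near=> h.
  by rewrite /= addr0 [h *: 1]mulr1 !mulr0 !add0r ![_ * h]mulrC.
by apply: DeriveDef; [apply/cvg_ex; exists l|exact: cvg_lim H].
Unshelve. all: by end_near. Qed.

Lemma continuous_prod X eta : continuous X -> continuous eta ->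
  continuous (fun z : R * R => X z.1 * eta z.2).
Proof.
move=> cX ce z; apply: continuousM.
  by apply: continuous_comp; [exact: cvg_fst|exact: cX].
by apply: continuous_comp; [exact: cvg_snd|exact: ce].
Qed.

Lemma within_lin (V : topologicalType) (A : set V) (f g : V -> R) (c d : R) :
  {within A, continuous f} -> {within A, continuous g} ->
  {within A, continuous (fun z : V => c * f z + d * g z)}.
Proof.
move=> cf cg z; apply: cvgD; apply: cvgM; [exact: cvg_cst|exact: cf|exact: cvg_cst|exact: cg].
Qed.

Lemma Ck_on_lin (V : normedModType R) k (A : set V) (f g : V -> R) (c d : R) :
  Ck_on k A f -> Ck_on k A g -> Ck_on k A (fun z : V => c * f z + d * g z).
Proof.
elim: k f g => [|k ih] f g /= [cf hf] [cg hg]; split.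
- exact: within_lin.
- by [].
- exact: within_lin.
- move=> v; have [df hdf kf] := hf v; have [dg hdg kg] := hg v.
  exists (fun z : V => c * df z + d * dg z); last exact: ih.
  move=> x Ax; rewrite /is_derive_in; have FF : Filter (within [set h : R | A (h *: v + x)] 0^') by exact: within_filter.
  rewrite [X in X @ _ --> _](_ : _ =
    (fun h => c * (h^-1 * (f (h *: v + x) - f x)) + d * (h^-1 * (g (h *: v + x) - g x)))).
    by apply: cvgD; apply: cvgM; [exact: cvg_cst|exact: hdf|exact: cvg_cst|exact: hdg].
  by apply/funext => h; ring.
Qed.

Lemma Ck_on_prod k X eta : smooth X -> smooth eta ->
  Ck_on k setT (fun z : R * R => X z.1 * eta z.2).
Proof.
elim: k X eta => [|k ih] X eta sX se /=; split => //.
- by apply: continuous_subspaceT; apply: continuous_prod; exact: smooth_continuous.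
- by apply: continuous_subspaceT; apply: continuous_prod; exact: smooth_continuous.
move=> v; exists (fun z => v.1 * (derive1 X z.1 * eta z.2) + v.2 * (X z.1 * derive1 eta z.2)).
  by move=> z _; apply: is_derive_is_derive_in; apply: is_derive_prod; exact: smooth_derivable.
by apply: (@Ck_on_lin _ k setT (fun z => derive1 X z.1 * eta z.2)
  (fun z => X z.1 * derive1 eta z.2) v.1 v.2); apply: ih => //; exact: smooth_derive1.
Qed.

Definition radial_test (delta : R) X := smooth X /\
  exists2 e : R, 0 < e & forall r, ~ (delta + e <= r <= 1 - e) -> X r = 0.

Definition angular_test eta := smooth eta /\ periodic2pi eta.

Lemma test_function_prod delta X eta : radial_test delta X -> angular_test eta ->
  test_function delta (fun z : R * R => X z.1 * eta z.2).
Proof.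
move=> [sX [e e0 hX]] [se pe]; split.
- by move=> k; exact: Ck_on_prod.
- by move=> r phi /=; rewrite pe.
- by exists e => // r phi /hX /= ->; rewrite mul0r.
Qed.

Lemma weak_derive_radial delta (g gr : R * R -> R) X dX eta :
  weak_derive delta (1, 0) g gr -> radial_test delta X -> angular_test eta ->
  (forall r : R, is_derive r 1 X (dX r)) ->
  \int[@dr_dphi R]_(z in Omega delta) (g z * (dX z.1 * eta z.2)) =
  - \int[@dr_dphi R]_(z in Omega delta) (gr z * (X z.1 * eta z.2)).
Proof.
move=> wg tX te hX; rewrite -(wg _ (test_function_prod tX te)).
congr (Rintegral _ _); apply/funext => z; congr (_ * _).
have := @is_derive_prod X eta (dX z.1) (derive1 eta z.2) (1, 0) z (hX _) (smooth_derivable te.1 z.2).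
by move/(@derive_val _ _ _ _ _ _ _) => ->; rewrite mul1r mul0r addr0.
Qed.

Lemma weak_derive_angular delta (g gphi : R * R -> R) X eta deta :
  weak_derive delta (0, 1) g gphi -> radial_test delta X -> angular_test eta ->
  (forall r : R, is_derive r 1 eta (deta r)) ->
  \int[@dr_dphi R]_(z in Omega delta) (g z * (X z.1 * deta z.2)) =
  - \int[@dr_dphi R]_(z in Omega delta) (gphi z * (X z.1 * eta z.2)).
Proof.
move=> wg tX te he; rewrite -(wg _ (test_function_prod tX te)).
congr (Rintegral _ _); apply/funext => z; congr (_ * _).
have := @is_derive_prod X eta (derive1 X z.1) (deta z.2) (0, 1) z (smooth_derivable tX.1 z.1) (he _).
by move/(@derive_val _ _ _ _ _ _ _) => ->; rewrite mul1r mul0r add0r.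
Qed.

End product_tests.

(** * Integration on the annulus *)

Lemma continuous_pair {T U V : topologicalType} (f : T -> U) (g : T -> V) (x : T) :
  {for x, continuous f} -> {for x, continuous g} -> {for x, continuous (fun y => (f y, g y))}.
Proof. by move=> cf cg; exact: (cvg_pair cf cg). Qed.

Section planar_integral.
Context {R : realType}.
Implicit Types (F G : R * R -> R) (delta : R).
Local Notation mR := (measurableTypeR R).
Local Notation leb := (@lebesgue_measure R).

(** The product sigma-algebra is generated by rectangles; countably many boxes with rational centres
    and radii [1 / (n + 1)] exhaust any open set. *)
Lemma open_measurable_prod (U : set (R * R)) : open U -> measurable (U : set (mR * mR)).
Proof.
move=> oU.
pose box (i : rat * rat * nat) : set (R * R) :=
  ball (ratr i.1.1 : R) i.2.+1%:R^-1 `*` ball (ratr i.1.2 : R) i.2.+1%:R^-1.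
have -> : U = \bigcup_(i in [set i | box i `<=` U]) box i.
  apply/seteqP; split=> [z Uz|z [i /= biU]]; last exact: biU.
  have /nbhs_ballP[e /= e0 eU] := open_nbhs_nbhs (conj oU Uz).
  have e2 : 0 < e / 2 by rewrite divr_gt0.
  have [n n0] : exists n, n.+1%:R^-1 < e / 2 :> R.
    near \oo => n; exists n; near: n; apply: (near_infty_natSinv_lt (PosNum e2)).
  have rt (x : R) : exists q : rat, `|x - ratr q| < n.+1%:R^-1.
    have ltx : x - n.+1%:R^-1 < x by rewrite gtrBl invr_gt0.
    have [q] := rat_in_itvoo ltx; rewrite in_itv /= => /andP[q1 q2].
    by exists q; rewrite ger0_norm ?subr_ge0 ?(ltW q2)// ltrBlDl -ltrBlDr.
  have [q1 h1] := rt z.1; have [q2 h2] := rt z.2.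
  exists (q1, q2, n); last by split; rewrite /ball/= distrC.
  move=> w [/= w1 w2]; apply: eU; split; rewrite /ball /=.
    rewrite (le_lt_trans (ler_distD (ratr q1) _ _))// [e]splitr ltrD// ?(lt_trans h1)//.
    by rewrite (lt_trans _ n0).
  rewrite (le_lt_trans (ler_distD (ratr q2) _ _))// [e]splitr ltrD// ?(lt_trans h2)//.
  by rewrite (lt_trans _ n0).
rewrite bigcup_mkcond; apply: countable_bigcupT_measurable => // i; case: ifP => _ //.
by apply: measurableX; apply: open_measurable; apply: ball_open; rewrite invr_gt0.
Unshelve. all: by end_near. Qed.

Lemma continuous_measurable_prod F : continuous F ->
  measurable_fun (setT : set (mR * mR)) (F : mR * mR -> mR).
Proof.
move=> cF; apply: (measurability _ (RGenOpens.measurableE R)).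
move=> _ [_ [a [b ->] <-]]; rewrite setTI; apply: open_measurable_prod.
by move/continuousP : cF; apply; exact: interval_open.
Qed.

Lemma measurable_Omega delta : measurable (Omega delta : set (mR * mR)).
Proof. exact: measurableX. Qed.

Lemma compact_Omega delta : compact (Omega delta).
Proof. by apply: compact_setX; exact: segment_compact. Qed.

Lemma dr_dphi_Omega delta : delta <= 1 ->
  dr_dphi (Omega delta) = ((1 - delta) * (2 * pi))%:E :> \bar R.
Proof.
move=> d1; rewrite (_ : dr_dphi _ = (leb `[delta, 1%R]%classic * leb `[0%R, (2 * pi)%R]%classic)%E); last exact: product_measure1E.
rewrite !lebesgue_measure_itv/= !lte_fin.
have p0 : 0 < 2 * pi :> R by rewrite mulr_gt0// pi_gt0.
rewrite p0 oppr0 adde0.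
move: d1; rewrite le_eqVlt => /predU1P[->|->]; first by rewrite ltxx subrr mul0r mul0e.
by rewrite -EFinB -EFinM.
Qed.

Lemma integrable_Omega delta F : delta <= 1 ->
  measurable_fun (Omega delta : set (mR * mR)) F ->
  (exists C : R, forall z, Omega delta z -> `|F z| <= C) ->
  dr_dphi.-integrable (Omega delta) (EFin \o F).
Proof.
move=> d1 mF [C hC]; apply: (@le_integrable _ _ _ _ _ _ _ (EFin \o cst C)).
- exact: measurable_Omega.
- exact/measurable_EFinP.
- move=> z Oz /=; by rewrite lee_fin (le_trans (hC z Oz))// ler_norm.
- apply/integrableP; split; first exact/measurable_EFinP/measurable_cst.
  under eq_integral do rewrite /=.
  rewrite integral_cst//; first by rewrite (dr_dphi_Omega d1)// ltry.
  exact: measurable_Omega.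
Qed.

Lemma continuous_bounded_Omega delta F : continuous F ->
  exists2 C : R, 0 <= C & forall z, Omega delta z -> `|F z| <= C.
Proof.
move=> cF; have : compact (F @` Omega delta).
  by apply: continuous_compact; [exact: continuous_subspaceT|exact: compact_Omega].
move/compact_bounded => [M [Mr hM]]; exists (`|M| + 1); first by rewrite addr_ge0.
move=> z Oz; apply: hM; last by exists z.
by rewrite (le_lt_trans (ler_norm _))// ltrDl.
Qed.

Lemma continuous_integrable_Omega delta F : delta <= 1 -> continuous F ->
  dr_dphi.-integrable (Omega delta) (EFin \o F).
Proof.
move=> d1 cF; apply: integrable_Omega => //.
  by apply: measurable_funTS; exact: continuous_measurable_prod.
by have [C _ hC] := continuous_bounded_Omega delta cF; exists C.
Qed.

Lemma continuous_integrable_itv (f : R -> R) (a b : R) : continuous f ->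
  leb.-integrable `[a, b] (EFin \o f).
Proof.
by move=> cf; apply: continuous_compact_integrable; [exact: segment_compact|exact: continuous_subspaceT].
Qed.

Lemma continuous_angular F r : continuous F -> continuous (fun phi => F (r, phi)).
Proof.
move=> cF phi; apply: (continuous_comp (f := fun phi => (r, phi)) (g := F)); last exact: cF.
by apply: continuous_pair; [exact: cvg_cst|exact: cvg_id].
Qed.

Lemma continuous_radial F phi : continuous F -> continuous (fun r => F (r, phi)).
Proof.
move=> cF r; apply: (continuous_comp (f := fun r => (r, phi)) (g := F)); last exact: cF.
by apply: continuous_pair; [exact: cvg_id|exact: cvg_cst].
Qed.

(** Both orders of integration are provided because a translation is carried out in the inner
    variable: [phi] here, [r] in [Fubini_Omega2]. *)
Lemma Fubini_Omega1 delta F : delta <= 1 -> continuous F ->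
  \int[@dr_dphi R]_(z in Omega delta) F z =
  \int[leb]_(r in `[delta, 1]) \int[leb]_(phi in `[0, 2 * pi]) F (r, phi).
Proof.
move=> d1 cF.
have iF := continuous_integrable_Omega d1 cF.
rewrite /Rintegral; congr fine.
rewrite integral_mkcond /dr_dphi -integral12_prod_meas1; last first.
  apply/(integrable_restrict _ (measurable_Omega delta) measurableT _).1.
  by rewrite setTI.
rewrite [RHS]integral_mkcond; apply: eq_integral => r _.
rewrite /fubini_F patchE; case: ifPn => [|] rI.
  rewrite fineK.
    rewrite [RHS]integral_mkcond; apply: eq_integral => phi _.
    rewrite !patchE; congr (if _ then _ else _).
    by apply/idP/idP; rewrite !inE /Omega /=; [case|move: rI; rewrite inE].
  apply: integrable_fin_num => //; apply: (continuous_integrable_itv (f := fun phi => F (r, phi))).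
  exact: continuous_angular.
apply: integral0_eq => phi _; rewrite patchE ifF//; apply/negbTE.
by apply: contra rI; rewrite !inE => -[].
Qed.

Lemma Fubini_Omega2 delta F : delta <= 1 -> continuous F ->
  \int[@dr_dphi R]_(z in Omega delta) F z =
  \int[leb]_(phi in `[0, 2 * pi]) \int[leb]_(r in `[delta, 1]) F (r, phi).
Proof.
move=> d1 cF.
have iF := continuous_integrable_Omega d1 cF.
rewrite /Rintegral; congr fine.
rewrite integral_mkcond /dr_dphi -integral21_prod_meas1; last first.
  apply/(integrable_restrict _ (measurable_Omega delta) measurableT _).1.
  by rewrite setTI.
rewrite [RHS]integral_mkcond; apply: eq_integral => phi _.
rewrite /fubini_G patchE; case: ifPn => [|] rI.
  rewrite fineK.
    rewrite [RHS]integral_mkcond; apply: eq_integral => r _.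
    rewrite !patchE; congr (if _ then _ else _).
    by apply/idP/idP; rewrite !inE /Omega /=; [case|move: rI; rewrite inE].
  apply: integrable_fin_num => //; apply: (continuous_integrable_itv (f := fun r => F (r, phi))).
  exact: continuous_radial.
apply: integral0_eq => r _; rewrite patchE ifF//; apply/negbTE.
by apply: contra rI; rewrite !inE => -[].
Qed.

End planar_integral.

(** * Mean value bounds, primitives and translation of integrals on the line *)

Section integral1d.
Context {R : realType}.
Implicit Types (f g F G : R -> R) (a b c x y : R).
Local Notation leb := (@lebesgue_measure R).

Lemma is_derive_within f df (A : set R) : (forall x, is_derive x 1 f (df x)) ->
  {within A, continuous f}.
Proof. by move=> h; apply: continuous_subspaceT => x; exact: is_derive_continuous (h x). Qed.

Lemma is_derive_translate f x k d : is_derive (x + k) 1 f d ->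
  is_derive x 1 (fun y => f (y + k)) d.
Proof.
move=> h; have H : is_derive x 1 (fun y => y + k) (1 : R).
  by apply: is_derive_to (is_derive_add (is_derive_id x 1) (is_derive_cst k x 1)) _; rewrite addr0.
by apply: is_derive_to (is_derive_chain (g := fun y => y + k) h H) _; rewrite mulr1.
Qed.

Lemma MVT_bound f df (M a b : R) : a <= b ->
  (forall x, a < x < b -> is_derive x 1 f (df x)) -> {within `[a, b], continuous f} ->
  (forall x, a < x < b -> `|df x| <= M) -> `|f b - f a| <= M * (b - a).
Proof.
rewrite le_eqVlt => /predU1P[-> _ _ _|ab h cf hM]; first by rewrite !subrr mulr0 normr0.
have [c cab ->] := @MVT R f df a b ab (fun x xab => h x xab) cf.
by rewrite normrM (gtr0_norm (x := b - a)) ?subr_gt0// ler_wpM2r ?subr_ge0 ?(ltW ab)// hM.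
Qed.

Lemma lipschitz_bound f df (M : R) : (forall x, is_derive x 1 f (df x)) ->
  (forall x, `|df x| <= M) -> forall x y, `|f x - f y| <= M * `|x - y|.
Proof.
move=> h hM x y; wlog xy : x y / y <= x => [H|].
  by case/orP: (le_total x y) => ?; [rewrite distrC (distrC x)|]; exact: H.
rewrite (ger0_norm (x := x - y)) ?subr_ge0//.
by apply: (MVT_bound (df := df)) => //; exact: is_derive_within h.
Qed.

Lemma Rintegral_FTC F f a b : a <= b -> continuous f ->
  (forall x, is_derive x 1 F (f x)) -> \int[leb]_(x in `[a, b]) f x = F b - F a.
Proof.
rewrite le_eqVlt => /predU1P[-> cf hF|ab cf hF].
  by rewrite set_itv1 Rintegral_set1 subrr.
rewrite /Rintegral (@continuous_FTC2 R f F a b ab) //.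
- exact: continuous_subspaceT.
- split; first by move=> x _; exact: (@ex_derive _ _ _ _ _ _ _ (hF x)).
  + by apply: cvg_at_right_filter; exact: is_derive_continuous (hF a).
  + by apply: cvg_at_left_filter; exact: is_derive_continuous (hF b).
- by move=> x _; rewrite derive1E; exact: (@derive_val _ _ _ _ _ _ _ (hF x)).
Qed.

(** The fundamental theorem gives a primitive only to the right of a base point. The primitives
    based at [- n.+1], normalised to vanish at 0, agree wherever two of them are defined, because
    their difference has zero derivative, and so glue to one on the whole line. *)
Lemma primitive_exists f : continuous f -> exists F, forall x, is_derive x 1 F (f x).
Proof.
move=> cf.
have loc (n : nat) : exists F : R -> R, F 0 = 0 /\ forall x, - n.+1%:R < x -> is_derive x 1 F (f x).
  pose P x : R := \int[leb]_(t in `[- n.+1%:R, x]) f t.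
  exists (fun x => P x - P 0); split; first by rewrite subrr.
  move=> x nx.
  have hx : x < x + 1 by rewrite ltrDl.
  have [dP vP] := continuous_FTC1_closed hx (continuous_integrable_itv _ _ cf) nx (cf x).
  have := is_derive_add (DeriveDef dP (etrans (esym (derive1E _ _)) vP)) (is_derive_cst (- P 0) x 1).
  by rewrite addr0.
pose F n := projT1 (cid (loc n)).
have F0 n : F n 0 = 0 by rewrite /F; case: cid => ? [].
have dF n x : - n.+1%:R < x -> is_derive x 1 (F n) (f x).
  by rewrite /F; case: cid => ? [_] /= h; exact: h.
have agree n k x : - n.+1%:R < x -> - k.+1%:R < x -> F n x = F k x.
  move=> nx kx; apply/eqP; rewrite -subr_eq0; apply/eqP.
  have dD y : - n.+1%:R < y -> - k.+1%:R < y -> is_derive y 1 (fun y => F n y - F k y) 0.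
    move=> ny ky; have := is_derive_add (dF n y ny) (is_derive_opp (dF k y ky)).
    by rewrite subrr.
  have n0 (j : nat) : - j.+1%:R < 0 :> R by rewrite oppr_lt0.
  have D0 : F n 0 - F k 0 = 0 by rewrite !F0 subrr.
  have within u v : (forall y, u <= y <= v -> - n.+1%:R < y /\ - k.+1%:R < y) ->
      {within `[u, v], continuous (fun y => F n y - F k y)}.
    move=> H; apply: derivable_within_continuous => y /H[? ?].
    exact: (@ex_derive _ _ _ _ _ _ _ (dD y _ _)).
  have key u v : u <= v -> (forall y, u <= y <= v -> - n.+1%:R < y /\ - k.+1%:R < y) ->
      F n v - F k v = F n u - F k u.
    move=> uv H; apply/eqP; rewrite -subr_eq0 -normr_le0.
    rewrite -(mul0r (v - u)); apply: (MVT_bound (f := fun y => F n y - F k y) (df := fun=> 0)) => //.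
    - move=> y /andP[uy yv]; have [|? ?] := H y; first by rewrite !ltW.
      exact: dD.
    - exact: within.
    - by move=> y _; rewrite normr0.
  case/orP: (le_total 0 x) => x0.
    rewrite (key 0 x) // => y /andP[y0 _].
    by split; apply: lt_le_trans y0.
  rewrite -(key x 0) // => y /andP[xy _].
  by split; apply: lt_le_trans xy.
(* Any index [n] with [- n.+1 < x] would do; the truncation of the absolute value is one. *)
exists (fun x => F (Num.truncn `|x|) x) => x.
set N := (Num.truncn `|x|).+1.
have trn (y : R) : - (Num.truncn `|y|).+1%:R < y.
  rewrite ltrNl (le_lt_trans (ler_norm _))// normrN.
  by have /andP[] := truncn_itv (normr_ge0 y).
have Nx : - N.+1%:R < x.
  apply: le_lt_trans (trn x); rewrite lerN2 ler_nat //.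
apply: (@near_eq_is_derive _ _ _ (F N)); last exact: dF.
near=> y; apply: agree; last exact: trn.
by near: y; exact: lt_nbhsr.
Unshelve. all: by end_near. Qed.

Lemma smooth_primitive_exists f : smooth f ->
  exists2 F, smooth F & forall x, is_derive x 1 F (f x).
Proof.
move=> sf; have [F hF] := primitive_exists (smooth_continuous sf).
by exists F => //; exact: smooth_primitive hF sf.
Qed.

(** The translation exchanges [[a, a + c]] for [[b, b + c]]. Equality of [p] on these two pieces
    covers both uses: integrands periodic in the angle, and integrands that vanish on both
    pieces. *)
Lemma Rintegral_shift (p : R -> R) a b c : continuous p -> a <= b -> 0 <= c ->
  (forall y, 0 <= y <= c -> p (a + y) = p (b + y)) ->
  \int[leb]_(x in `[a, b]) p (x + c) = \int[leb]_(x in `[a, b]) p x.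
Proof.
move=> cp ab c0 hp; have [P hP] := primitive_exists cp.
have dsh k x : is_derive x 1 (fun x => P (x + k)) (p (x + k)).
  exact: is_derive_translate.
rewrite (@Rintegral_FTC (fun x => P (x + c)) (fun x => p (x + c)))//; last first.
  by move=> x; apply: (continuous_comp (f := fun x => x + c) (g := p)); [apply: cvgD; [exact: cvg_id|exact: cvg_cst]|exact: cp].
rewrite (Rintegral_FTC ab cp hP).
have hQ y : is_derive y 1 (fun y => P (y + b) - P (y + a)) (p (y + b) - p (y + a)).
  exact: is_derive_add (dsh b y) (is_derive_opp (dsh a y)).
have : `|(P (c + b) - P (c + a)) - (P (0 + b) - P (0 + a))| <= 0 * (c - 0).
  apply: (MVT_bound c0 (fun y _ => hQ y)) => [|y /andP[y0 yc]].
    exact: is_derive_within hQ.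
  by rewrite ![y + _]addrC hp ?subrr ?normr0// !ltW.
rewrite mul0r normr_le0 subr_eq0 !add0r => /eqP.
by rewrite ![c + _]addrC.
Qed.

End integral1d.

(** * Monotone and periodic primitives, bounded by the mass of their derivative *)

Section primitives.
Context {R : realType}.
Implicit Types (f g F G X W eta N : R -> R) (a b c x y : R).
Local Notation leb := (@lebesgue_measure R).

Lemma pi2_gt0 : 0 < 2 * pi :> R. Proof. by rewrite mulr_gt0// pi_gt0. Qed.

Lemma nondecreasing_is_derive f df : (forall x, is_derive x 1 f (df x)) ->
  (forall x, 0 <= df x) -> forall x y, x <= y -> f x <= f y.
Proof.
move=> h h0 x y xy; have [c _ E] := MVT_segment xy (fun z _ => h z) (is_derive_within (A := `[x, y]%classic) h).
by rewrite -subr_ge0 E mulr_ge0// subr_ge0.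
Qed.

Lemma periodic_mulrz g (k : int) x : periodic2pi g -> g (x + k%:~R * (2 * pi)) = g x.
Proof.
move=> pg; have nat_ (n : nat) y : g (y + n%:R * (2 * pi)) = g y.
  elim: n y => [|n ih] y; first by rewrite mul0r addr0.
  by rewrite -natr1 mulrDl mul1r addrA pg ih.
case: k => n; first exact: nat_.
by rewrite NegzE -(nat_ n.+1 (x + _)) mulrNz mulNr subrK.
Qed.

(** One [y] serves every periodic function, so that several functions can be compared at the same
    representative. *)
Lemma periodic_representative x : exists2 y, 0 <= y <= 2 * pi &
  forall g, periodic2pi g -> g x = g y.
Proof.
have pi2 := pi2_gt0; pose k := Num.floor (x / (2 * pi)).
have /andP[k1 k2] := floor_itv (x / (2 * pi)); rewrite -/k in k1 k2.
exists (x + (- k)%:~R * (2 * pi)); last by move=> g pg; rewrite periodic_mulrz.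
move: k1 k2; rewrite ler_pdivlMr// ltr_pdivrMr// mulrNz intrD mulrDl.
by move=> ? ?; apply/andP; split; lra.
Qed.

(** [W] is the distribution function of the density [X]: it climbs from 0 to the total mass across
    the support. *)
Lemma cumulative X u v A B : smooth X -> (forall r, 0 <= X r) ->
  (forall r, ~ (u <= r <= v) -> X r = 0) -> A <= u -> u <= v -> v <= B ->
  exists W, [/\ forall r : R, is_derive r 1 W (X r),
    forall r, r <= u -> W r = 0,
    forall r, v <= r -> W r = \int[leb]_(r in `[A, B]) X r &
    forall r, 0 <= W r <= \int[leb]_(r in `[A, B]) X r].
Proof.
move=> sX X0 Xs Au uv vB; have [P sP hP] := smooth_primitive_exists sX.
have mono := nondecreasing_is_derive hP X0.
have lo r : r <= u -> P r = P u.
  move=> ru; apply/eqP; rewrite eq_sym -subr_eq0 -normr_le0 -(mul0r (u - r)).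
  apply: (MVT_bound ru (fun y _ => hP y)); first exact: is_derive_within hP.
  by move=> y /andP[_ yu]; rewrite Xs ?normr0// => /andP[]; rewrite leNgt yu.
have hi r : v <= r -> P r = P v.
  move=> vr; apply/eqP; rewrite -subr_eq0 -normr_le0 -(mul0r (r - v)).
  apply: (MVT_bound vr (fun y _ => hP y)); first exact: is_derive_within hP.
  by move=> y /andP[vy _]; rewrite Xs ?normr0// => /andP[_]; rewrite leNgt vy.
have -> : \int[leb]_(r in `[A, B]) X r = P v - P u.
  rewrite (Rintegral_FTC _ (smooth_continuous sX) hP); last by rewrite (le_trans Au)// (le_trans uv).
  by rewrite (hi B)// (lo A).
exists (fun r => P r - P u); split.
- by move=> r; apply: is_derive_to (is_derive_add (hP r) (is_derive_cst (- P u) r 1)) _; rewrite addr0.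
- by move=> r /lo ->; rewrite subrr.
- by move=> r /hi ->.
- move=> r; rewrite subr_ge0 lerD2r; apply/andP; split.
    by case/orP: (le_total r u) => [/lo ->//|]; exact: mono.
  by case/orP: (le_total v r) => [/hi ->//|]; exact: mono.
Qed.

(** Mean zero is what makes a primitive periodic. Subtracting the mean of the primitive restores the
    hypothesis, so the construction can be iterated. *)
Lemma angular_primitive eta : angular_test eta -> \int[leb]_(x in `[0, 2 * pi]) eta x = 0 ->
  exists N, [/\ angular_test N, \int[leb]_(x in `[0, 2 * pi]) N x = 0 &
    forall x, is_derive x 1 N (eta x)].
Proof.
move=> [se pe] m0; have [P sP hP] := smooth_primitive_exists se.
have pP : periodic2pi P.
  move=> x; apply/eqP; rewrite -subr_eq0; apply/eqP.
  have hD y : is_derive y 1 (fun y => P (y + 2 * pi) - P y) ((fun=> 0) y).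
    apply: is_derive_to (is_derive_add (is_derive_translate (hP _)) (is_derive_opp (hP y))) _.
    by rewrite pe subrr.
  have h0 (y : R) : `|(fun=> 0 : R) y| <= 0 :> R by rewrite normr0.
  have := lipschitz_bound hD h0 x 0; rewrite mul0r normr_le0 subr_eq0 => /eqP ->.
  by rewrite add0r -(Rintegral_FTC (ltW pi2_gt0) (smooth_continuous se) hP).
pose c := (\int[leb]_(x in `[0, 2 * pi]) P x) / (2 * pi).
exists (fun x => P x - c); split.
- split; last by move=> x; rewrite pP.
  by apply: smooth_add => //; exact: smooth_cst.
- rewrite RintegralB//; [|exact: continuous_integrable_itv (smooth_continuous sP)|].
    rewrite Rintegral_cst//= lebesgue_measure_itv/= lte_fin pi2_gt0 /= oppr0 addr0.
    by rewrite /c divfK ?subrr// gt_eqF// pi2_gt0.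
  by apply: continuous_integrable_itv; exact: cst_continuous.
- by move=> x; apply: is_derive_to (is_derive_add (hP x) (is_derive_cst (- c) x 1)) _; rewrite addr0.
Qed.

(** Since [N x + m / (2 * pi) * x] is nondecreasing, [N] falls by at most [m] over a period; by
    periodicity its oscillation is then at most [m], and a function of mean zero is bounded by its
    oscillation. *)
Lemma angular_primitive_bound eta N m : continuous eta -> (forall x, 0 <= eta x) ->
  periodic2pi N -> \int[leb]_(x in `[0, 2 * pi]) N x = 0 -> 0 <= m ->
  (forall x, is_derive x 1 N (eta x - m / (2 * pi))) ->
  forall x, `|N x| <= m.
Proof.
move=> ce e0 pN iN m0 hN.
have pi2 := pi2_gt0.
have mono : forall x y, x <= y -> N x <= N y + m / (2 * pi) * (y - x).
  move=> x y xy.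
  have h (z : R) : is_derive z 1 (fun z => N z + (m / (2 * pi) * z + 0)) (eta z).
    by apply: is_derive_to (is_derive_add (hN z) (is_derive_affine _ _ z)) _; rewrite subrK.
  have := nondecreasing_is_derive h e0 xy; lra.
have osc x y : `|x - y| <= 2 * pi -> N x <= N y + m.
  have mm z : z <= 2 * pi -> m / (2 * pi) * z <= m.
    move=> zp; rewrite mulrAC ler_pdivrMr// ler_wpM2l//.
  move=> /ler_normlP[h1 h2]; case/orP: (le_total y x) => yx.
    have := mono x (y + 2 * pi); rewrite pN => H.
    have {}H := H ltac:(lra); apply: (le_trans H); rewrite lerD2l mm//; lra.
  by have H := mono _ _ yx; apply: (le_trans H); rewrite lerD2l mm//; lra.
have cN : continuous N by move=> x; exact: is_derive_continuous (hN x).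
have iNN : leb.-integrable `[0, 2 * pi] (EFin \o N) by exact: continuous_integrable_itv.
have icst (k : R) : leb.-integrable `[0, 2 * pi] (EFin \o cst k).
  by apply: continuous_integrable_itv; exact: cst_continuous.
have vol (k : R) : \int[leb]_(x in `[0, 2 * pi]) cst k x = k * (2 * pi).
  by rewrite Rintegral_cst//= lebesgue_measure_itv/= lte_fin pi2_gt0 /= oppr0 addr0.
move=> x0; have [x /andP[x0' x2] ->] := periodic_representative x0; last by [].
rewrite ler_norml; apply/andP; split.
  rewrite leNgt; apply/negP => H.
  have : \int[leb]_(x in `[0, 2 * pi]) N x <= \int[leb]_(y in `[0, 2 * pi]) cst (N x + m) y.
    apply: le_Rintegral => // y /=; rewrite in_itv /= => /andP[y0 y2].
    by apply: osc; rewrite ler_norml; apply/andP; split; lra.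
  rewrite iN vol leNgt => /negP; apply; rewrite pmulr_llt0//; lra.
rewrite leNgt; apply/negP => H.
have : \int[leb]_(y in `[0, 2 * pi]) cst (N x - m) y <= \int[leb]_(x in `[0, 2 * pi]) N x.
  apply: le_Rintegral => // y /=; rewrite in_itv /= => /andP[y0 y2].
  by rewrite lerBlDr; apply: osc; rewrite ler_norml; apply/andP; split; lra.
by rewrite iN vol leNgt pmulr_lgt0// subr_gt0 H.
Qed.

End primitives.

(** * From averages against bumps to pointwise bounds *)

Section variational.
Context {R : realType}.
Implicit Types (X eta : R -> R) (F : R * R -> R) (z : R * R).
Local Notation leb := (@lebesgue_measure R).
Variables (delta : R) (d1 : delta < 1).
Local Notation II F := (\int[@dr_dphi R]_(z in Omega delta) F z).

Lemma Rintegral_prod X eta : continuous X -> continuous eta ->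
  II (fun z => X z.1 * eta z.2) =
  \int[leb]_(r in `[delta, 1]) X r * \int[leb]_(phi in `[0, 2 * pi]) eta phi.
Proof.
move=> cX ce; rewrite (Fubini_Omega1 (ltW d1) (continuous_prod cX ce)) /=.
transitivity (\int[leb]_(r in `[delta, 1]) (X r * \int[leb]_(phi in `[0, 2 * pi]) eta phi)).
  apply: eq_Rintegral => r _; rewrite RintegralZl//.
  exact: continuous_integrable_itv.
by rewrite RintegralZr//; exact: continuous_integrable_itv.
Qed.

Lemma Rintegral_itv_gt0 (f : R -> R) (a b c : R) : continuous f -> (forall x, 0 <= f x) ->
  a < c < b -> 0 < f c -> 0 < \int[leb]_(x in `[a, b]) f x.
Proof.
move=> cf f0 /andP[ac cb] fc.
have [P hP] := primitive_exists cf.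
rewrite (Rintegral_FTC (ltW (lt_trans ac cb)) cf hP) subr_gt0.
have mono := nondecreasing_is_derive hP f0.
rewrite lt_neqAle mono ?(ltW (lt_trans ac cb))// andbT; apply/eqP => E.
have cP x : a < x < b -> P x = P c.
  move=> /andP[ax xb].
  have L y : a < y -> y < b -> P y = P a.
    move=> ay yb; apply/eqP; rewrite eq_le; apply/andP; split; last by apply: mono; exact: ltW.
    by rewrite E; apply: mono; exact: ltW.
  by rewrite L// L.
have d0 : is_derive c 1 P 0.
  apply: near_eq_is_derive (is_derive_cst (P c) c (1 : R)).
  near=> x; rewrite [RHS]cP//; apply/andP; split; near: x; [exact: lt_nbhsr|exact: lt_nbhsl].
have := @derive_val _ _ _ _ _ _ _ (hP c); rewrite (@derive_val _ _ _ _ _ _ _ d0) => E0.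
by rewrite -E0 ltxx in fc.
Unshelve. all: by end_near. Qed.

Lemma radial_bump (r0 e : R) : 0 < e -> exists X, [/\ smooth X, forall r, 0 <= X r,
  0 < X r0 & forall r, X r != 0 -> `|r - r0| < e].
Proof.
move=> e0; exists (fun r => bump0 (e ^+ 2 - (r - r0) * (r - r0))); split.
- apply: smooth_comp; first exact: smooth_flat.
  apply: smooth_add; first exact: smooth_cst.
  apply: smooth_opp; have s : smooth (fun r => r - r0) by apply: (smooth_shift (f := id) (- r0)); move: (@smooth_affine R 1 0); under eq_fun do rewrite mul1r addr0.
  exact: smooth_mul.
- by move=> r; exact: bump0_ge0.
- by apply: bump0_gt0; rewrite subrr mulr0 subr0 exprn_gt0.
- move=> r; apply: contraNT; rewrite -leNgt => h; apply/eqP/bump0_eq0.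
  rewrite subr_le0 -expr2 -(real_normK (num_real (r - r0))) lerXn2r// nnegrE// ltW//.
Qed.

Lemma cos_lt_away (e x : R) : 0 < e -> e <= pi -> e <= `|x| -> `|x| <= 2 * pi - e -> cos x <= cos e.
Proof.
move=> e0 epi; have -> : cos x = cos `|x|.
  by case: (ger0P x) => _ //; rewrite cosN.
move: (`|x|) => y ey y2.
have I (z : R) : 0 <= z -> z <= pi -> z \in `[0, pi]%R by move=> *; rewrite in_itv /=; apply/andP.
case: (leP y pi) => ypi.
  by rewrite leNgt ltr_cos ?I// -?leNgt//; lra.
rewrite -(cosN y) -(cosD2pi (- y)).
have -> : - y + pi *+ 2 = 2 * pi - y by rewrite -mulr_natl; ring.
by rewrite leNgt ltr_cos ?I// -?leNgt//; lra.
Qed.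

(** Passing through the cosine makes the bump periodic by construction; the margin [e] at both ends
    of [[0, 2 * pi]] keeps the periodic copies of its peak away from that interval. *)
Lemma angular_bump (phi0 e : R) : 0 < e -> e <= phi0 -> phi0 <= 2 * pi - e -> e <= pi ->
  exists eta, [/\ angular_test eta, forall x, 0 <= eta x,
  0 < eta phi0 & forall x, 0 <= x <= 2 * pi -> eta x != 0 -> `|x - phi0| < e].
Proof.
move=> e0 ep pe epi.
exists (fun x => bump0 (cos (x + - phi0) - cos e)); split.
- split.
    apply: smooth_comp; first exact: smooth_flat.
    apply: smooth_add; last exact: smooth_cst.
    by apply: smooth_shift; exact: smooth_sin_cos.2.
  move=> x; congr (bump0 (_ - _)).
  by rewrite addrAC mulr_natl cosD2pi.
- by move=> r; exact: bump0_ge0.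
- apply: bump0_gt0; rewrite subrr subr_gt0 ltr_cos ?in_itv /= ?lexx ?pi_ge0//.
  by rewrite (ltW e0).
- move=> x /andP[x0 x2]; apply: contraNT; rewrite -leNgt => h; apply/eqP/bump0_eq0.
  rewrite subr_le0; apply: cos_lt_away => //.
  by rewrite ler_norml; apply/andP; split; lra.
Qed.

Lemma continuous_mul2 (f g : R * R -> R) : continuous f -> continuous g ->
  continuous (fun z => f z * g z).
Proof. by move=> cf cg z; apply: cvgM; [exact: cf|exact: cg]. Qed.

(** If [F] exceeded [K] at a point, a product bump concentrated there would violate the averaged
    bound. That bound involves the test function only through its mass, which dictates the form of
    the duality estimates below. The end [beta] may lie below 1 to leave room for an [F] containing
    a translate [r + h]. *)
Lemma variational_le F (beta K : R) : delta < beta -> beta <= 1 -> continuous F ->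
  (forall X eta e, smooth X -> (forall r, 0 <= X r) ->
     0 < e -> (forall r, ~ (delta + e <= r <= beta - e) -> X r = 0) ->
     angular_test eta -> (forall x, 0 <= eta x) ->
     0 < \int[leb]_(r in `[delta, 1]) X r -> 0 < \int[leb]_(phi in `[0, 2 * pi]) eta phi ->
     II (fun z => F z * (X z.1 * eta z.2)) <=
     K * (\int[leb]_(r in `[delta, 1]) X r * \int[leb]_(phi in `[0, 2 * pi]) eta phi)) ->
  forall r phi, delta <= r <= beta -> 0 <= phi <= 2 * pi -> F (r, phi) <= K.
Proof.
move=> db b1 cF H; have pi2 := pi2_gt0 (R := R).
suff int_ r phi : delta < r < beta -> 0 < phi < 2 * pi -> F (r, phi) <= K.
  move=> r phi /andP[r1 r2] /andP[p1 p2].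
  (* A boundary point is approached from the interior, along the segment towards the centre of the
     rectangle. *)
  pose s (t : R) := (r + t * ((delta + beta) / 2 - r), phi + t * (pi - phi)).
  have s0 : s 0 = (r, phi) by rewrite /s !mul0r !addr0.
  rewrite leNgt; apply/negP => FK.
  have cs : {for 0, continuous (F \o s)}.
    apply: (continuous_comp (f := s) (g := F)); last exact: cF.
    apply: continuous_pair; apply: cvgD; try exact: cvg_cst.
      by apply: cvgM; [exact: cvg_id|exact: cvg_cst].
    by apply: cvgM; [exact: cvg_id|exact: cvg_cst].
  rewrite -s0 in FK.
  have /cvg_at_right_filter/cvgr_gt/(_ _ FK) FK' := cs.
  near (0 : R)^'+ => t.
  have t0 : 0 < t by near: t; exact: nbhs_right_gt.
  have t1 : t < 1 by near: t; exact: nbhs_right_lt.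
  have : K < F (s t) by near: t; exact: FK'.
  by rewrite ltNge => /negP; apply; apply: int_; apply/andP; split; nra.
move=> /andP[r1 r2] /andP[p1 p2]; rewrite leNgt; apply/negP => FK.
(* The intermediate level keeps the inequality strict after integration, since the bump has positive
   mass. *)
pose K' := (K + F (r, phi)) / 2.
have KK' : K < K' by rewrite /K'; lra.
have K'F : K' < F (r, phi) by rewrite /K'; lra.
have /cvgr_gt/(_ _ K'F)/nbhs_ballP[e /= e0 he] := cF (r, phi).
have [e' [e'0 e'e e'r e'b]] : exists e', [/\ 0 < e', e' <= e, e' <= r - delta & e' <= beta - r].
  exists (Num.min e (Num.min (r - delta) (beta - r))).
  by rewrite !lt_min !ge_min !lexx !orbT e0 !subr_gt0 r1 r2.
have [e2 [e20 e2e e2p e2q]] : exists e2, [/\ 0 < e2, e2 <= e, e2 <= phi & e2 <= 2 * pi - phi].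
  exists (Num.min e (Num.min phi (2 * pi - phi))).
  by rewrite !lt_min !ge_min !lexx !orbT e0 !subr_gt0 p1 p2.
have e'20 : 0 < e' / 2 by rewrite divr_gt0.
have [X [sX X0 Xr Xs]] := radial_bump r e'20.
have [||eta [te eta0 etap etas]] := angular_bump e20 e2p; [lra|lra|].
have cX := smooth_continuous sX; have ce := smooth_continuous te.1.
have mX : 0 < \int[leb]_(r in `[delta, 1]) X r.
  by apply: (@Rintegral_itv_gt0 X delta 1 r) => //; rewrite r1 (lt_le_trans r2).
have me : 0 < \int[leb]_(phi in `[0, 2 * pi]) eta phi.
  by apply: (@Rintegral_itv_gt0 eta 0 (2 * pi) phi) => //; rewrite p1.
have Xsupp x : ~ (delta + e' / 2 <= x <= beta - e' / 2) -> X x = 0.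
  move=> h; apply: contra_notP h => /eqP /Xs; rewrite ltr_norml => /andP[? ?].
  by apply/andP; split; lra.
have := H X eta _ sX X0 e'20 Xsupp te eta0 mX me.
rewrite leNgt => /negP; apply.
rewrite -(Rintegral_prod cX ce) -RintegralZl//; [|exact: measurable_Omega|]; last first.
  by apply: continuous_integrable_Omega; [exact: ltW|exact: continuous_prod].
apply: (@lt_le_trans _ _ (II (fun z => K' * (X z.1 * eta z.2)))).
  rewrite !RintegralZl//; [|exact: measurable_Omega| |exact: measurable_Omega|];
    try by apply: continuous_integrable_Omega; [exact: ltW|exact: continuous_prod].
  by rewrite (Rintegral_prod cX ce) ltr_pM2r// mulr_gt0.
have cP := continuous_prod cX ce.
apply: le_Rintegral.
- exact: measurable_Omega.
- apply: continuous_integrable_Omega; first exact: ltW.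
  exact: (continuous_mul2 (f := fun=> K') (g := fun z => X z.1 * eta z.2) (@cst_continuous _ _ _) cP).
- apply: continuous_integrable_Omega; first exact: ltW.
  exact: (continuous_mul2 (f := F) (g := fun z => X z.1 * eta z.2) cF cP).
move=> [x y] [/= _]; rewrite in_itv /= => y02.
have [->|Xn0] := eqVneq (X x) 0; first by rewrite mul0r !mulr0.
have [->|en0] := eqVneq (eta y) 0; first by rewrite !mulr0.
rewrite ler_wpM2r ?mulr_ge0// ltW//; apply: he; split; rewrite /ball /= distrC.
  by rewrite (lt_le_trans (Xs _ Xn0))//; lra.
by rewrite (lt_le_trans (etas _ y02 en0)).
Unshelve. all: by end_near. Qed.

End variational.

(** * Pointwise regularity from weak derivatives *)

Section square_integrable.
Context {R : realType}.
Implicit Types (u v Z : R * R -> R).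
Local Notation leb := (@lebesgue_measure R).
Local Notation mR := (measurableTypeR R).
Variables (delta : R) (d0 : 0 < delta) (d1 : delta < 1).
Local Notation II F := (\int[@dr_dphi R]_(z in Omega delta) F z).
Local Notation integrableO F := ((@dr_dphi R).-integrable (Omega delta) (EFin \o F)).

(** The weight [r] is at least [delta] on [Omega], so removing it costs only a factor [delta^-1]. *)
Lemma in_L2_integrable_sqr u : in_L2 delta u -> integrableO (fun z : R * R => u z ^+ 2).
Proof.
move=> [mu nu].
have mu2 : measurable_fun (Omega delta : set (mR * mR)) (fun z => u z ^+ 2).
  exact: measurable_funX.
have mu2r : measurable_fun (Omega delta : set (mR * mR)) (fun z => u z ^+ 2 * z.1).
  apply: measurable_funM => //; apply: measurable_funTS; exact: measurable_fst.
have fin : (\int[@dr_dphi R]_(z in Omega delta) (u z ^+ 2 * z.1)%:E < +oo)%E.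
  by move: nu; apply: lty_poweRy; rewrite invr_eq0.
have I : integrableO (fun z : R * R => u z ^+ 2 * z.1).
  apply/integrableP; split; first exact/measurable_EFinP.
  rewrite (eq_integral (fun z : mR * mR => (u z ^+ 2 * z.1)%:E)) => [//|[r p]] /=.
  rewrite inE => -[/= + _]; rewrite in_itv /= => /andP[rd _].
  by rewrite ger0_norm// mulr_ge0 ?sqr_ge0// (le_trans (ltW d0)).
have iS := integrableZl (measurable_Omega delta) delta^-1 I.
apply: le_integrable iS.
- exact: measurable_Omega.
- exact/measurable_EFinP.
- move=> [r p] [/= + _]; rewrite in_itv /= => /andP[rd _].
  rewrite lee_fin !ger0_norm ?sqr_ge0//; last first.
    apply: mulr_ge0; first by rewrite invr_ge0 ltW.
    by apply: mulr_ge0; [exact: sqr_ge0|exact: le_trans (ltW d0) rd].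
  by rewrite mulrCA ler_peMr ?sqr_ge0// mulrC ler_pdivlMr// mul1r.
Qed.

Lemma in_L2_integrable_mul u Z : in_L2 delta u -> continuous Z ->
  integrableO (fun z : R * R => u z * Z z).
Proof.
move=> uL cZ; have i2 := in_L2_integrable_sqr uL.
have [C C0 hC] := continuous_bounded_Omega delta cZ.
have i1 : integrableO (fun=> 1 : R) by apply: continuous_integrable_Omega; [exact: ltW|exact: cst_continuous].
have iS := integrableZl (measurable_Omega delta) C (integrableD (measurable_Omega delta) i1 i2).
apply: le_integrable iS.
- exact: measurable_Omega.
- apply/measurable_EFinP; apply: measurable_funM; first exact: uL.1.
  by apply: measurable_funTS; exact: continuous_measurable_prod.
- move=> z Oz; rewrite /= lee_fin normrM.
  rewrite (@ger0_norm _ (C * _)); last by rewrite mulr_ge0// addr_ge0// sqr_ge0.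
  rewrite mulrC ler_pM// ?hC//.
  rewrite -(@real_normK _ (u z)) ?num_real//; have := normr_ge0 (u z); nra.
Qed.

Lemma Rintegral_mulD u Z1 Z2 (c1 c2 : R) : in_L2 delta u -> continuous Z1 -> continuous Z2 ->
  II (fun z => u z * (c1 * Z1 z + c2 * Z2 z)) =
  c1 * II (fun z => u z * Z1 z) + c2 * II (fun z => u z * Z2 z).
Proof.
move=> uL cZ1 cZ2; have mO := measurable_Omega delta.
have i1 := in_L2_integrable_mul uL cZ1; have i2 := in_L2_integrable_mul uL cZ2.
rewrite -!RintegralZl// -RintegralD//; last 2 first.
- exact: (integrableZl mO c1 i1).
- exact: (integrableZl mO c2 i2).
by apply: eq_Rintegral => z _; ring.
Qed.

Lemma Rintegral_mul_bound u Z (B : R) : in_L2 delta u -> continuous Z ->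
  (forall z, Omega delta z -> `|Z z| <= B) ->
  `|II (fun z => u z * Z z)| <= B * II (fun z => `|u z|).
Proof.
move=> uL cZ hB; have mO := measurable_Omega delta.
have iu : integrableO u.
  have := in_L2_integrable_mul uL (@cst_continuous _ _ (1 : R)).
  by congr (integrable _ _ _); apply/funext => z /=; rewrite mulr1.
have iuZ := in_L2_integrable_mul uL cZ.
have iau : integrableO (fun z => `|u z|) by exact: (integrable_norm iu).
apply: (le_trans (le_normr_Rintegral mO iuZ)).
rewrite -RintegralZl//; apply: le_Rintegral => //.
- exact: (integrable_norm iuZ).
- exact: (integrableZl mO B iau).
- by move=> z Oz; rewrite normrM mulrC ler_wpM2r// hB.
Qed.

(* AM-GM: [2 |u| Y <= sqrt h m u^2 + Y^2 / (sqrt h m)]. *)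
Lemma Rintegral_mul_narrow u (Y Z : R -> R) (m h B : R) : in_L2 delta u ->
  continuous Y -> continuous Z -> 0 < m -> 0 < h ->
  (forall r, 0 <= Y r <= m) -> \int[leb]_(r in `[delta, 1]) Y r <= h * m ->
  (forall x, `|Z x| <= B) ->
  `|II (fun z => u z * (Y z.1 * Z z.2))| <=
  B * (m * Num.sqrt h) * ((II (fun z => u z ^+ 2) + 2 * pi) / 2).
Proof.
move=> uL cY cZ m0 h0 hY iY hZ; have mO := measurable_Omega delta.
have B0 : 0 <= B by exact: le_trans (hZ 0).
set s := Num.sqrt h; have s0 : 0 < s by rewrite sqrtr_gt0.
have ss : s * s = h by rewrite -expr2 sqr_sqrtr// ltW.
have cYZ := continuous_prod cY cZ; have iuZ := in_L2_integrable_mul uL cYZ.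
have i2 := in_L2_integrable_sqr uL.
have cY1 : continuous (fun z : R * R => Y z.1 * (fun=> 1 : R) z.2).
  exact: (continuous_prod (eta := fun=> 1) cY (@cst_continuous _ _ _)).
have iY1 := continuous_integrable_Omega (ltW d1) cY1.
apply: (le_trans (le_normr_Rintegral mO iuZ)).
apply: (@le_trans _ _ (II (fun z => (B / 2 * (s * m)) * u z ^+ 2 + (B / 2 / s) * (Y z.1 * 1)))).
  apply: le_Rintegral => //.
  - exact: (integrable_norm iuZ).
  - exact: (integrableD mO (integrableZl mO (B / 2 * (s * m)) i2) (integrableZl mO (B / 2 / s) iY1)).
  move=> [r p] _ /=; have /andP[y0 ym] := hY r.
  rewrite !normrM (ger0_norm y0) mulr1 mulrA mulrC.
  apply: (@le_trans _ _ (B * (`|u (r, p)| * Y r))); first by rewrite ler_wpM2r ?mulr_ge0.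
  rewrite -[u (r, p) ^+ 2](real_normK (num_real _)).
  have := normr_ge0 (u (r, p)); move: (`|u _|) => w w0.
  (* Expand [(s * m * w - Y r)^2 >= 0] and use [Y r ^+ 2 <= m * Y r]: what remains is linear in [Y],
     whose integral is at most [h * m = s^2 * m]. *)
  have key : w * Y r <= 2^-1 * (s * m) * w ^+ 2 + 2^-1 / s * Y r.
    have Ys : Y r * Y r <= m * Y r by rewrite ler_wpM2r.
    rewrite -subr_ge0 -(pmulr_rge0 _ (mulr_gt0 s0 m0)) mulrBr mulrDr.
    have -> : s * m * (2^-1 / s * Y r) = 2^-1 * (m * Y r) by field; rewrite gt_eqF.
    have := sqr_ge0 (s * m * w - Y r); nra.
  by apply: (le_trans (ler_wpM2l B0 key)); rewrite le_eqVlt; apply/orP; left; apply/eqP; ring.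
rewrite RintegralD//; last 2 first.
- exact: (integrableZl mO (B / 2 * (s * m)) i2).
- exact: (integrableZl mO (B / 2 / s) iY1).
rewrite !RintegralZl// (Rintegral_prod d1 cY (@cst_continuous _ _ (1 : R))).
rewrite Rintegral_cst//= lebesgue_measure_itv/= lte_fin pi2_gt0 /= oppr0 addr0 mul1r.
have p0 := pi2_gt0 (R := R).
apply: (@le_trans _ _ (B / 2 * (s * m) * II (fun z => u z ^+ 2) + B / 2 / s * (h * m * (2 * pi)))).
  by rewrite lerD2l ler_wpM2l ?ler_pM2r// mulr_ge0 ?mulr_ge0 ?invr_ge0// ltW.
rewrite -ss le_eqVlt; apply/orP; left; apply/eqP; field.
by rewrite gt_eqF.
Qed.

End square_integrable.

(** * Radial Hoelder bound and second angular differences by duality *)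

Section sobolev.
Context {R : realType}.
Local Notation leb := (@lebesgue_measure R).
Variables (delta : R) (d0 : 0 < delta) (d1 : delta < 1).
Local Notation II F := (\int[@dr_dphi R]_(z in Omega delta) F z).
(** [g] carries the weak derivatives; [G] is a continuous, angularly periodic extension of it to the
    plane, which can be translated out of [Omega]. *)
Variables (g G : R * R -> R).
Hypotheses (cG : continuous G) (pG : forall r, periodic2pi (fun phi => G (r, phi)))
  (gG : forall z, Omega delta z -> g z = G z).

Lemma angular_test_cst (c : R) : angular_test (fun=> c).
Proof. by split => //; exact: smooth_cst. Qed.

Lemma angular_test_shift eta c : angular_test eta -> angular_test (fun x : R => eta (x + c)).
Proof. by move=> [se pe]; split; [exact: smooth_shift|move=> x; rewrite addrAC pe]. Qed.

Lemma angular_test_lin (e1 e2 : R -> R) c1 c2 : angular_test e1 -> angular_test e2 ->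
  angular_test (fun x : R => c1 * e1 x + c2 * e2 x).
Proof.
move=> [s1 p1] [s2 p2]; split; last by move=> x; rewrite p1 p2.
by apply: smooth_add; apply: smooth_mul => //; exact: smooth_cst.
Qed.

Lemma is_derive_lin (f1 f2 : R -> R) (c1 c2 x a1 a2 : R) :
  is_derive x 1 f1 a1 -> is_derive x 1 f2 a2 ->
  is_derive x 1 (fun y => c1 * f1 y + c2 * f2 y) (c1 * a1 + c2 * a2).
Proof.
move=> h1 h2; apply: is_derive_to (is_derive_add (is_derive_mul (is_derive_cst c1 x 1) h1)
  (is_derive_mul (is_derive_cst c2 x 1) h2)) _.
by rewrite !mul0r !add0r.
Qed.

Lemma angular_mean_zero (eta : R -> R) : continuous eta ->
  \int[leb]_(x in `[0, 2 * pi])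
    (eta x - (\int[leb]_(x in `[0, 2 * pi]) eta x) / (2 * pi)) = 0.
Proof.
move=> ce; rewrite RintegralB//; [|exact: continuous_integrable_itv|].
  rewrite Rintegral_cst//= lebesgue_measure_itv/= lte_fin pi2_gt0 /= oppr0 addr0.
  by rewrite divfK ?subrr// gt_eqF// pi2_gt0.
by apply: continuous_integrable_itv; exact: cst_continuous.
Qed.

Lemma angular_primitive_center (eta : R -> R) (m : R) : angular_test eta -> (forall x, 0 <= eta x) ->
  m = \int[leb]_(x in `[0, 2 * pi]) eta x ->
  exists N : R -> R, [/\ angular_test N, \int[leb]_(x in `[0, 2 * pi]) N x = 0,
    forall x : R, is_derive x 1 N (eta x - m / (2 * pi)) & forall x, `|N x| <= m].
Proof.
move=> te e0 mE; have ce := smooth_continuous te.1.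
have tc : angular_test (fun x => eta x - m / (2 * pi)).
  have := angular_test_lin 1 (- (m / (2 * pi))) te (angular_test_cst 1).
  by under eq_fun do rewrite mul1r mulr1.
have := angular_mean_zero ce; rewrite -mE => mz.
have [N [tN iN hN]] := angular_primitive tc mz.
exists N; split => //; apply: (angular_primitive_bound ce e0 tN.2 iN _ hN).
by rewrite mE; apply: Rintegral_ge0 => x _; exact: e0.
Qed.

Lemma Rintegral_G_continuous (Z : R * R -> R) :
  II (fun z => g z * Z z) = II (fun z => G z * Z z).
Proof. by apply: eq_Rintegral => z; rewrite inE => /gG ->. Qed.

Lemma continuous_shift1 (h : R) : continuous (fun z : R * R => G (z.1 + h, z.2)).
Proof.
move=> z; apply: (continuous_comp (f := fun z : R * R => (z.1 + h, z.2)) (g := G)); last exact: cG.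
apply: continuous_pair; last exact: cvg_snd.
by apply: cvgD; [exact: cvg_fst|exact: cvg_cst].
Qed.

Lemma continuous_shift2 (h : R) : continuous (fun z : R * R => G (z.1, z.2 + h)).
Proof.
move=> z; apply: (continuous_comp (f := fun z : R * R => (z.1, z.2 + h)) (g := G)); last exact: cG.
apply: continuous_pair; first exact: cvg_fst.
by apply: cvgD; [exact: cvg_snd|exact: cvg_cst].
Qed.

Lemma continuous_translate (f : R -> R) (c : R) : continuous f -> continuous (fun x => f (x + c)).
Proof.
move=> cf x; apply: (continuous_comp (f := fun x => x + c) (g := f)); last exact: cf.
by apply: cvgD; [exact: cvg_id|exact: cvg_cst].
Qed.

Lemma Rintegral_radial_shift (X eta : R -> R) (h : R) : continuous X -> continuous eta -> 0 <= h ->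
  (forall y, 0 <= y <= h -> X (delta + y - h) = 0 /\ X (1 + y - h) = 0) ->
  II (fun z => G (z.1 + h, z.2) * (X z.1 * eta z.2)) =
  II (fun z => G z * (X (z.1 - h) * eta z.2)).
Proof.
move=> cX ce h0 hX; have cXh := continuous_translate (c := - h) cX.
have c1 := continuous_mul2 (continuous_shift1 (h := h)) (continuous_prod cX ce).
have c2 := continuous_mul2 cG (continuous_prod cXh ce).
rewrite (Fubini_Omega2 (ltW d1) c1) (Fubini_Omega2 (ltW d1) c2); apply: eq_Rintegral => phi _.
rewrite -(@Rintegral_shift _ (fun r => G (r, phi) * (X (r - h) * eta phi)) delta 1 h)//=.
- by apply: eq_Rintegral => r _; rewrite addrK.
- have := continuous_radial (F := fun z : R * R => G z * (X (z.1 - h) * eta z.2)) (phi := phi) c2.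
  by apply.
- exact: ltW.
- by move=> y /hX[-> ->]; rewrite !mul0r !mulr0.
Qed.

Lemma Rintegral_angular_shift (X eta : R -> R) (h : R) : continuous X -> continuous eta -> 0 <= h ->
  periodic2pi eta ->
  II (fun z => G (z.1, z.2 + h) * (X z.1 * eta z.2)) =
  II (fun z => G z * (X z.1 * eta (z.2 - h))) /\
  II (fun z => G (z.1, z.2 - h) * (X z.1 * eta z.2)) =
  II (fun z => G z * (X z.1 * eta (z.2 + h))).
Proof.
move=> cX ce h0 pe; have cem := continuous_translate (c := - h) ce.
have cep := continuous_translate (c := h) ce.
have c1 := continuous_mul2 (continuous_shift2 (h := h)) (continuous_prod cX ce).
have c2 := continuous_mul2 cG (continuous_prod cX cem).
have c3 := continuous_mul2 (continuous_shift2 (h := - h)) (continuous_prod cX ce).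
have c4 := continuous_mul2 cG (continuous_prod cX cep).
split.
  rewrite (Fubini_Omega1 (ltW d1) c1) (Fubini_Omega1 (ltW d1) c2); apply: eq_Rintegral => r _.
  rewrite -(@Rintegral_shift _ (fun p => G (r, p) * (X r * eta (p - h))) 0 (2 * pi) h)//=.
  - by apply: eq_Rintegral => p _; rewrite addrK.
  - have := continuous_angular (F := fun z : R * R => G z * (X z.1 * eta (z.2 - h))) (r := r) c2.
  by apply.
  - exact: ltW (@pi2_gt0 R).
  - by move=> y _; rewrite add0r ![2 * pi + _]addrC pG [_ + 2 * pi - h]addrAC pe.
rewrite (Fubini_Omega1 (ltW d1) c3) (Fubini_Omega1 (ltW d1) c4); apply: eq_Rintegral => r _.
rewrite -(@Rintegral_shift _ (fun p => G (r, p - h) * (X r * eta p)) 0 (2 * pi) h)//=.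
- by apply: eq_Rintegral => p _; rewrite addrK.
- have := continuous_angular (F := fun z : R * R => G (z.1, z.2 - h) * (X z.1 * eta z.2)) (r := r) c3.
  by apply.
- exact: ltW (@pi2_gt0 R).
- by move=> y _; rewrite add0r ![2 * pi + _]addrC pe [_ + 2 * pi - h]addrAC pG.
Qed.

Lemma Rintegral_eq0 (f : R -> R) (a b : R) : (forall x, f x = 0) -> \int[leb]_(x in `[a, b]) f x = 0.
Proof.
move=> f0; rewrite (_ : f = cst 0); last exact/funext.
by rewrite Rintegral_cst// mul0r.
Qed.

Lemma supp_nonempty (X : R -> R) (u v : R) : (forall r, ~ (u <= r <= v) -> X r = 0) ->
  0 < \int[leb]_(r in `[delta, 1]) X r -> u <= v.
Proof.
move=> Xs; rewrite leNgt => m0; apply/negP => vu; move: m0.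
rewrite Rintegral_eq0 ?ltxx// => r; apply: Xs => /andP[ur rv].
by move: (le_trans ur rv); rewrite leNgt vu.
Qed.

Lemma variational_norm_le (F : R * R -> R) (beta K : R) : delta < beta -> beta <= 1 -> continuous F ->
  (forall X eta e, smooth X -> (forall r, 0 <= X r) ->
     0 < e -> (forall r, ~ (delta + e <= r <= beta - e) -> X r = 0) ->
     angular_test eta -> (forall x, 0 <= eta x) ->
     0 < \int[leb]_(r in `[delta, 1]) X r -> 0 < \int[leb]_(phi in `[0, 2 * pi]) eta phi ->
     `|II (fun z => F z * (X z.1 * eta z.2))| <=
     K * (\int[leb]_(r in `[delta, 1]) X r * \int[leb]_(phi in `[0, 2 * pi]) eta phi)) ->
  forall r phi, delta <= r <= beta -> 0 <= phi <= 2 * pi -> `|F (r, phi)| <= K.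
Proof.
move=> db b1 cF H r phi hr hp; apply/ler_normlP; split.
  apply: (variational_le (F := fun z => - F z) d1 db b1) => //; first by move=> z; apply: cvgN; exact: cF.
  move=> X eta e sX X0 e0 Xs te eta0 mX me; apply: le_trans (H X eta e sX X0 e0 Xs te eta0 mX me).
  have iF := continuous_integrable_Omega (ltW d1) (continuous_mul2 cF (continuous_prod (smooth_continuous sX) (smooth_continuous te.1))).
  rewrite -normrN; apply: le_trans (ler_norm _); rewrite le_eqVlt; apply/orP; left; apply/eqP.
  rewrite -[RHS]mulN1r -RintegralZl//; last exact: measurable_Omega.
  by apply: eq_Rintegral => z _; ring.
apply: (variational_le d1 db b1) => // X eta e sX X0 e0 Xs te eta0 mX me.
by apply: le_trans (H X eta e sX X0 e0 Xs te eta0 mX me); exact: ler_norm.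
Qed.

(* Testing [G (r + h, phi) - G (r, phi)] moves the difference onto [X]; its
   antiderivative [Y] lies between 0 and the mass of [X] and has integral at
   most [h] times that mass, so Cauchy-Schwarz costs only a factor [sqrt h]. *)
Lemma radial_holder_weak (gr grp : R * R -> R) :
  weak_derive delta (1, 0) g gr -> weak_derive delta (0, 1) gr grp ->
  in_L2 delta gr -> in_L2 delta grp ->
  exists K : R, forall (h : R) (X eta : R -> R) e, 0 < h -> smooth X -> (forall r, 0 <= X r) ->
     0 < e -> (forall r, ~ (delta + e <= r <= 1 - h - e) -> X r = 0) ->
     angular_test eta -> (forall x, 0 <= eta x) ->
     0 < \int[leb]_(r in `[delta, 1]) X r -> 0 < \int[leb]_(phi in `[0, 2 * pi]) eta phi ->
  `|II (fun z => (G (z.1 + h, z.2) - G z) * (X z.1 * eta z.2))| <=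
  K * Num.sqrt h * (\int[leb]_(r in `[delta, 1]) X r * \int[leb]_(phi in `[0, 2 * pi]) eta phi).
Proof.
move=> wr wrp Lr Lrp; have pi2 := @pi2_gt0 R.
pose Kr := (II (fun z => gr z ^+ 2) + 2 * pi) / 2.
pose Krp := (II (fun z => grp z ^+ 2) + 2 * pi) / 2.
exists (Krp + Kr / (2 * pi)) => h X eta e h0 sX X0 e0 Xs te eta0 m0 me0.
set m := \int[leb]_(r in `[delta, 1]) X r; set me := \int[leb]_(phi in `[0, 2 * pi]) eta phi.
have uv := supp_nonempty Xs m0.
have [||W [hW Wl Wr Wb]] := cumulative (A := delta) (B := 1) sX X0 Xs _ uv; [lra|lra|].
rewrite -/m in Wr Wb.
have sW := smooth_primitive hW sX; have cX := smooth_continuous sX; have ce := smooth_continuous te.1.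
have monoW := nondecreasing_is_derive hW X0.
pose Y r := W r - W (r - h).
have hY (r : R) : is_derive r 1 Y (X r - X (r - h)).
  exact: is_derive_add (hW r) (is_derive_opp (is_derive_translate (hW _))).
have tY : radial_test delta Y.
  split; first by apply: (smooth_add sW); apply: smooth_opp; exact: smooth_shift.
  exists e => // r hr; rewrite /Y; case: (leP (delta + e) r) => [h1|/ltW h1]; last first.
    by rewrite !Wl ?subrr//; lra.
  case: (leP r (1 - e)) => [h2|/ltW h2]; first by case: hr; rewrite h1 h2.
  by rewrite !Wr ?subrr//; lra.
have Yb r : 0 <= Y r <= m.
  have := Wb r; have := Wb (r - h); have := monoW (r - h) r ltac:(lra).
  by rewrite /Y => h1 /andP[? ?] /andP[? ?]; apply/andP; split; lra.
(* With [V] a primitive of [W], the integral is the increment of [V] over [[1 - h, 1]] minus that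
   over [[delta - h, delta]]; the first is at most [m * h] and the second is nonnegative, as
   [0 <= W <= m]. *)
have iY : \int[leb]_(r in `[delta, 1]) Y r <= h * m.
  have [V hV] := primitive_exists (smooth_continuous sW).
  have hVY (r : R) : is_derive r 1 (fun r => V r - V (r - h)) (Y r).
    exact: is_derive_add (hV r) (is_derive_opp (is_derive_translate (hV _))).
  rewrite (Rintegral_FTC (ltW d1) (smooth_continuous tY.1) hVY).
  have h1 : V 1 - V (1 - h) <= m * h.
    have [c _ ->] := MVT_segment (f := V) (df := W) (a := 1 - h) (b := 1) ltac:(lra) (fun z _ => hV z) (is_derive_within hV).
    by rewrite opprB addrC subrK ler_wpM2r// ?(ltW h0)//; have /andP[] := Wb c.
  have h2 : V (delta - h) <= V delta.
    apply: (nondecreasing_is_derive hV); last by lra.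
    by move=> r; have /andP[] := Wb r.
  by move: h1 h2; lra.
(* Only the mass [me] of [eta] may appear in the bound, not its supremum. So [eta] is written as
   [N' + me / (2 * pi)] with [|N| <= me], and the derivative of [N] is moved onto [gr]; this is
   where the mixed derivative [grp] comes in. *)
have [N [tN _ hN Nb]] := angular_primitive_center te eta0 (erefl me).
have cY := smooth_continuous tY.1; have cN := smooth_continuous tN.1.
have cXh := continuous_translate (c := - h) cX.
have E1 : II (fun z => (G (z.1 + h, z.2) - G z) * (X z.1 * eta z.2)) =
    - II (fun z => G z * ((X z.1 - X (z.1 - h)) * eta z.2)).
  have c1 := continuous_integrable_Omega (ltW d1) (continuous_mul2 (continuous_shift1 (h := h)) (continuous_prod cX ce)).
  have c2 := continuous_integrable_Omega (ltW d1) (continuous_mul2 cG (continuous_prod cX ce)).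
  have c3 := continuous_integrable_Omega (ltW d1) (continuous_mul2 cG (continuous_prod cXh ce)).
  transitivity (II (fun z => G (z.1 + h, z.2) * (X z.1 * eta z.2)) - II (fun z => G z * (X z.1 * eta z.2))).
    rewrite -RintegralB//; last exact: measurable_Omega.
    by apply: eq_Rintegral => z _; rewrite mulrBl.
  transitivity (- (II (fun z => G z * (X z.1 * eta z.2)) - II (fun z => G z * (X (z.1 - h) * eta z.2)))).
    rewrite opprB; congr (_ - _); apply: Rintegral_radial_shift => //; first exact: ltW.
    move=> y /andP[y0 yh]; split; apply: Xs => /andP[? ?]; lra.
  rewrite -RintegralB//; last exact: measurable_Omega.
  by congr (- _); apply: eq_Rintegral => z _; ring.
rewrite E1 -(Rintegral_G_continuous (fun z => (X z.1 - X (z.1 - h)) * eta z.2)).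
rewrite (weak_derive_radial (dX := fun r => X r - X (r - h)) wr tY te hY) opprK.
have t1 := angular_test_cst 1.
have cYN' : continuous (fun z : R * R => Y z.1 * (eta z.2 - me / (2 * pi))).
  apply: (continuous_prod (eta := fun p => eta p - me / (2 * pi)) cY).
  by move=> p; apply: cvgD; [exact: ce|exact: cvg_cst].
have cY1 : continuous (fun z : R * R => Y z.1 * 1).
  exact: (continuous_prod (eta := fun=> 1) cY (@cst_continuous _ _ _)).
have E2 : II (fun z => gr z * (Y z.1 * eta z.2)) =
    - II (fun z => grp z * (Y z.1 * N z.2)) + me / (2 * pi) * II (fun z => gr z * (Y z.1 * 1)).
  have := Rintegral_mulD d0 d1 1 (me / (2 * pi)) Lr cYN' cY1.
  rewrite (weak_derive_angular (deta := fun p => eta p - me / (2 * pi)) wrp tY tN hN) mul1r => <-.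
  by apply: eq_Rintegral => z _; ring.
rewrite E2.
have B1 := Rintegral_mul_narrow d0 d1 Lrp cY cN m0 h0 Yb iY Nb.
have B2 := Rintegral_mul_narrow (B := 1) d0 d1 Lr cY (@cst_continuous _ _ (1 : R)) m0 h0 Yb iY ltac:(by move=> x; rewrite normr1).
apply: (le_trans (ler_normD _ _)); rewrite normrN normrM.
have q0 : 0 <= me / (2 * pi) by rewrite divr_ge0// ltW.
rewrite (ger0_norm q0).
have := lerD B1 (ler_wpM2l q0 B2); rewrite -/Kr -/Krp => H; apply: (le_trans H).
rewrite -/m le_eqVlt; apply/orP; left; apply/eqP.
by move: (Num.sqrt h) (@pi_gt0 R) => sh; move: (@pi R) => p p0; field; rewrite gt_eqF.
Qed.

Lemma radial_holder (gr grp : R * R -> R) :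
  weak_derive delta (1, 0) g gr -> weak_derive delta (0, 1) gr grp ->
  in_L2 delta gr -> in_L2 delta grp ->
  exists K : R, forall h r phi : R, 0 < h -> h < 1 - delta -> delta <= r -> r + h <= 1 ->
    0 <= phi <= 2 * pi -> `|G (r + h, phi) - G (r, phi)| <= K * Num.sqrt h.
Proof.
move=> wr wrp Lr Lrp; have [K hK] := radial_holder_weak wr wrp Lr Lrp.
exists K => h r phi h0 h1 r1 r2 p02.
apply: (@variational_norm_le (fun z => G (z.1 + h, z.2) - G z) (1 - h)) => //; [lra|lra| |..|lra].
  by move=> z; apply: cvgB; [exact: continuous_shift1|exact: cG].
by move=> X eta e sX X0 e0 Xs te eta0 mX me; exact: (hK h X eta e).
Qed.

(** Stands in for a second angular derivative, which the inviscid flow is not known to have. *)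
Definition sdiff (h : R) (f : R -> R) (x : R) := f (x + h) + f (x - h) - 2 * f x.

Lemma angular_test_sdiff h eta : angular_test eta -> angular_test (sdiff h eta).
Proof.
move=> te; have := angular_test_lin 1 (- 2) (angular_test_lin 1 1
  (angular_test_shift h te) (angular_test_shift (- h) te)) te.
by congr angular_test; apply/funext => x; rewrite /sdiff; ring.
Qed.

Lemma is_derive_sdiff (h : R) (f df : R -> R) : (forall x : R, is_derive x 1 f (df x)) ->
  forall x : R, is_derive x 1 (sdiff h f) (sdiff h df x).
Proof.
move=> hf x; have h1 := is_derive_translate (k := h) (hf (x + h)).
have h2 := is_derive_translate (k := - h) (hf (x - h)).
have := is_derive_add (is_derive_add h1 h2) (is_derive_lin 0 (- 2) (hf x) (hf x)).
rewrite /sdiff; set k := (fun y => _); have -> : k = (fun y => f (y + h) + f (y - h) - 2 * f y).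
  by apply/funext => y; rewrite /k; ring.
by move/is_derive_to; apply; ring.
Qed.

(** The mean value theorem twice: [sdiff h f x] is an increment over a step [h] of
    [f (y + h) - f y], whose derivative is at most [M * h]. *)
Lemma sdiff_bound (h M : R) (f f1 f2 : R -> R) : 0 <= h ->
  (forall x : R, is_derive x 1 f (f1 x)) -> (forall x : R, is_derive x 1 f1 (f2 x)) ->
  (forall x, `|f2 x| <= M) -> forall x, `|sdiff h f x| <= M * h ^+ 2.
Proof.
move=> h0 hf hf1 hM x.
have d (y : R) : is_derive y 1 (fun y => f (y + h) - f y) (f1 (y + h) - f1 y).
  exact: is_derive_add (is_derive_translate (hf _)) (is_derive_opp (hf y)).
have b y : `|f1 (y + h) - f1 y| <= M * h.
  by have := lipschitz_bound hf1 hM (y + h) y; rewrite addrAC subrr add0r (ger0_norm h0).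
have := lipschitz_bound d b x (x - h).
have -> : x - (x - h) = h by ring.
rewrite (ger0_norm h0) subrK expr2 mulrA.
by congr (`|_| <= _); rewrite /sdiff; ring.
Qed.

(** Over a period the translations by [h] and by [- h] are adjoint to each other, so their symmetric
    combination is self-adjoint. *)
Lemma Rintegral_sdiff (X eta : R -> R) (h : R) : smooth X -> angular_test eta -> 0 <= h ->
  II (fun z => sdiff h (fun p => G (z.1, p)) z.2 * (X z.1 * eta z.2)) =
  II (fun z => G z * (X z.1 * sdiff h eta z.2)).
Proof.
move=> sX te h0; have cX := smooth_continuous sX; have ce := smooth_continuous te.1.
have [E1 E2] := Rintegral_angular_shift cX ce h0 te.2.
have mO := measurable_Omega delta.
have i F (cF : continuous F) := continuous_integrable_Omega (ltW d1) cF.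
have i1 := i _ (continuous_mul2 (continuous_shift2 (h := h)) (continuous_prod cX ce)).
have i2 := i _ (continuous_mul2 (continuous_shift2 (h := - h)) (continuous_prod cX ce)).
have i3 := i _ (continuous_mul2 cG (continuous_prod cX ce)).
have i4 := i _ (continuous_mul2 cG (continuous_prod cX (continuous_translate (c := h) ce))).
have i5 := i _ (continuous_mul2 cG (continuous_prod cX (continuous_translate (c := - h) ce))).
transitivity (II (fun z => G (z.1, z.2 + h) * (X z.1 * eta z.2)) +
  II (fun z => G (z.1, z.2 - h) * (X z.1 * eta z.2)) - 2 * II (fun z => G z * (X z.1 * eta z.2))).
  rewrite -RintegralZl// -RintegralD// -RintegralB//; last 2 first.
  - exact: (integrableD mO i1 i2).
  - exact: (integrableZl mO 2 i3).
  by apply: eq_Rintegral => -[r p] _; rewrite /sdiff /=; ring.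
rewrite E1 E2 -RintegralZl// -RintegralD// -RintegralB//; last 2 first.
- exact: (integrableD mO i5 i4).
- exact: (integrableZl mO 2 i3).
by apply: eq_Rintegral => -[r p] _; rewrite /sdiff /=; ring.
Qed.

(* The second difference falls on a triple periodic primitive [Q] of [eta] minus
   its mean, for which [sdiff h Q] is at most [h ^+ 2] times the mass of [eta];
   [g] receives three angular derivatives and, to bound the radial factor by the
   mass of [X] alone, one radial derivative. *)
Lemma angular_sdiff_weak (g1 g2 g3 g3r : R * R -> R) :
  weak_derive delta (0, 1) g g1 -> weak_derive delta (0, 1) g1 g2 ->
  weak_derive delta (0, 1) g2 g3 -> weak_derive delta (1, 0) g3 g3r ->
  in_L2 delta g3 -> in_L2 delta g3r ->
  exists K : R, forall (h : R) (X eta : R -> R) e, 0 < h -> smooth X -> (forall r, 0 <= X r) ->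
     0 < e -> (forall r, ~ (delta + e <= r <= 1 - e) -> X r = 0) ->
     angular_test eta -> (forall x, 0 <= eta x) ->
     0 < \int[leb]_(r in `[delta, 1]) X r -> 0 < \int[leb]_(phi in `[0, 2 * pi]) eta phi ->
  `|II (fun z => sdiff h (fun p => G (z.1, p)) z.2 * (X z.1 * eta z.2))| <=
  K * h ^+ 2 * (\int[leb]_(r in `[delta, 1]) X r * \int[leb]_(phi in `[0, 2 * pi]) eta phi).
Proof.
move=> w1 w2 w3 w3r L3 L3r; have d1' := d1.
(* The reference bump [X0], in the middle of the interval, is fixed before [X]; its mass [M] and its
   bound [C0] may therefore enter the constant. *)
have dm : 0 < (1 - delta) / 4 by rewrite divr_gt0// subr_gt0.
have [X0 [sX0 X00 X0c X0s]] := radial_bump ((1 + delta) / 2) dm.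
set e0 := (1 - delta) / 4 in dm X0s.
have X0supp r : ~ (delta + e0 <= r <= 1 - e0) -> X0 r = 0.
  move=> hr; apply: contra_notP hr => /eqP /X0s; rewrite ltr_norml /e0 => /andP[? ?].
  by apply/andP; split; lra.
have cX0 := smooth_continuous sX0.
have M0 : 0 < \int[leb]_(r in `[delta, 1]) X0 r.
  by apply: (Rintegral_itv_gt0 (c := (1 + delta) / 2)) => //; apply/andP; split; lra.
set M := \int[leb]_(r in `[delta, 1]) X0 r in M0.
have [||W0 [hW0 W0l W0r W0b]] := cumulative (A := delta) (B := 1) sX0 X00 X0supp _ (supp_nonempty X0supp M0); [lra|lra|].
rewrite -/M in W0r W0b; have sW0 := smooth_primitive hW0 sX0.
have [C0 C00 hC0] : exists2 C, 0 <= C & forall r, delta <= r <= 1 -> `|X0 r| <= C.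
  have [C C0 hC] := continuous_bounded_Omega delta (continuous_prod cX0 (@cst_continuous _ _ (1 : R))).
  exists C => // r hr; have := hC (r, 0); rewrite /= mulr1; apply.
  split => /=; rewrite in_itv //=.
  by rewrite lexx (ltW (@pi2_gt0 R)).
exists (II (fun z => `|g3r z|) + C0 / M * II (fun z => `|g3 z|)) => h X eta e h0 sX Xp ep Xs te eta0 m0 me0.
set m := \int[leb]_(r in `[delta, 1]) X r in m0 *; set me := \int[leb]_(phi in `[0, 2 * pi]) eta phi in me0 *.
have [||W [hW Wl Wr Wb]] := cumulative (A := delta) (B := 1) sX Xp Xs _ (supp_nonempty Xs m0); [lra|lra|].
rewrite -/m in Wr Wb; have sW := smooth_primitive hW sX.
have [N [tN iN hN Nb]] := angular_primitive_center te eta0 (erefl me).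
have [Q1 [tQ1 iQ1 hQ1]] := angular_primitive tN iN.
have [Q0 [tQ0 iQ0 hQ0]] := angular_primitive tQ1 iQ1.
have tX : radial_test delta X by split => //; exists e.
rewrite (Rintegral_sdiff sX te (ltW h0)) -(Rintegral_G_continuous (fun z => X z.1 * sdiff h eta z.2)).
(* The mean [me / (2 * pi)] cancels in a second difference. *)
have hDN (x : R) : is_derive x 1 (sdiff h N) (sdiff h eta x).
  by apply: is_derive_to (is_derive_sdiff h hN x) _; rewrite /sdiff; ring.
rewrite (weak_derive_angular w1 tX (angular_test_sdiff h tN) hDN).
rewrite (weak_derive_angular w2 tX (angular_test_sdiff h tQ1) (is_derive_sdiff h hQ1)) opprK.
rewrite (weak_derive_angular w3 tX (angular_test_sdiff h tQ0) (is_derive_sdiff h hQ0)).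
set D := sdiff h Q0; have tD : angular_test D by exact: angular_test_sdiff.
have Db := sdiff_bound (ltW h0) hQ0 hQ1 Nb; rewrite -/D in Db.
(* Beyond the support of [X] its primitive [W] is stuck at [m]. Subtracting the primitive of the
   multiple of [X0] with the same mass gives a compactly supported, hence admissible, radial
   test. *)
pose Y r := W r - m / M * W0 r.
have Mn0 : M != 0 by rewrite gt_eqF.
have hY (r : R) : is_derive r 1 Y (X r - m / M * X0 r).
  have := is_derive_lin 1 (- (m / M)) (hW r) (hW0 r).
  by rewrite mul1r mulNr; congr is_derive; apply/funext => y; rewrite /Y mul1r mulNr.
have sY : smooth Y.
  by apply: (smooth_add sW); apply: smooth_opp; apply: smooth_mul => //; exact: smooth_cst.
have tY : radial_test delta Y.
  split => //; exists (Num.min e e0); first by rewrite lt_min ep dm.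
  move=> r hr; rewrite /Y; have [e1 e2] : Num.min e e0 <= e /\ Num.min e e0 <= e0.
    by rewrite !ge_min !lexx orbT.
  case: (leP (delta + Num.min e e0) r) => [h1|/ltW h1]; last first.
    by rewrite Wl ?W0l ?mulr0 ?subrr//; lra.
  case: (leP r (1 - Num.min e e0)) => [h2|/ltW h2]; first by case: hr; rewrite h1 h2.
  by rewrite Wr ?W0r ?divfK ?subrr//; lra.
have q0 : 0 <= m / M by rewrite divr_ge0// ltW.
have Yb r : `|Y r| <= m.
  have /andP[a1 a2] := Wb r; have /andP[b1 b2] := W0b r.
  have c1 : 0 <= m / M * W0 r by rewrite mulr_ge0.
  have c2 : m / M * W0 r <= m by rewrite -[leRHS](divfK Mn0) ler_wpM2l.
  by rewrite /Y ler_norml; apply/andP; split; lra.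
have cD := smooth_continuous tD.1; have cX := smooth_continuous sX; have cY := smooth_continuous sY.
have cYX : continuous (fun r => X r - m / M * X0 r).
  move=> r; apply: cvgB; first exact: cX.
  by apply: cvgM; [exact: cvg_cst|exact: cX0].
have ED : II (fun z => g3 z * (X z.1 * D z.2)) =
    - II (fun z => g3r z * (Y z.1 * D z.2)) + m / M * II (fun z => g3 z * (X0 z.1 * D z.2)).
  have := Rintegral_mulD d0 d1 1 (m / M) L3 (continuous_prod cYX cD) (continuous_prod cX0 cD).
  rewrite (weak_derive_radial (dX := fun r => X r - m / M * X0 r) w3r tY tD hY) mul1r => <-.
  by apply: eq_Rintegral => z _; ring.
have me0' := ltW me0.
have B1 : `|II (fun z => g3r z * (Y z.1 * D z.2))| <= m * (me * h ^+ 2) * II (fun z => `|g3r z|).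
  apply: (Rintegral_mul_bound d0 d1 L3r (continuous_prod cY cD)) => z _.
  by rewrite normrM ler_pM.
have B2 : `|II (fun z => g3 z * (X0 z.1 * D z.2))| <= C0 * (me * h ^+ 2) * II (fun z => `|g3 z|).
  apply: (Rintegral_mul_bound d0 d1 L3 (continuous_prod cX0 cD)) => -[r p] [/= + _].
  by rewrite in_itv /= => hr; rewrite normrM ler_pM// hC0.
rewrite normrN ED; apply: (le_trans (ler_normD _ _)); rewrite normrN normrM (ger0_norm q0).
apply: (le_trans (lerD B1 (ler_wpM2l q0 B2))).
by rewrite le_eqVlt; apply/orP; left; apply/eqP; ring.
Qed.

Lemma angular_sdiff (g1 g2 g3 g3r : R * R -> R) :
  weak_derive delta (0, 1) g g1 -> weak_derive delta (0, 1) g1 g2 ->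
  weak_derive delta (0, 1) g2 g3 -> weak_derive delta (1, 0) g3 g3r ->
  in_L2 delta g3 -> in_L2 delta g3r ->
  exists K : R, forall h r phi : R, 0 < h -> delta <= r <= 1 ->
    0 <= phi <= 2 * pi -> `|sdiff h (fun p => G (r, p)) phi| <= K * h ^+ 2.
Proof.
move=> w1 w2 w3 w3r L3 L3r; have [K hK] := angular_sdiff_weak w1 w2 w3 w3r L3 L3r.
exists K => h r phi h0 hr hp.
apply: (@variational_norm_le (fun z => sdiff h (fun p => G (z.1, p)) z.2) 1) => //.
  have c1 := continuous_shift2 (h := h); have c2 := continuous_shift2 (h := - h).
  move=> z; apply: cvgB; first by apply: cvgD; [exact: c1|exact: c2].
  apply: cvgM; first exact: cvg_cst.
  have cG' : continuous (fun z : R * R => G (z.1, z.2)).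
    by have -> : (fun z : R * R => G (z.1, z.2)) = G by apply/funext; case.
  exact: cG'.
by move=> X eta e sX X0 e0 Xs te eta0 mX me; exact: (hK h X eta e).
Qed.

End sobolev.

(** * Maximum principles *)

Section calculus_at_max.
Context {R : realType}.
Implicit Types (f w : R -> R) (x t : R).

Lemma derivable_is_derive f x : derivable f x 1 -> is_derive x 1 f (derive1 f x).
Proof. by move=> h; apply: DeriveDef => //; rewrite derive1E. Qed.

Lemma is_derive_derive1 f x d : is_derive x 1 f d -> derive1 f x = d.
Proof. by move=> h; rewrite derive1E; exact: (@derive_val _ _ _ _ _ _ _ h). Qed.

Lemma is_derive_quotient f x d : is_derive x 1 f d ->
  (fun h : R => h^-1 * (f (x + h) - f x)) @ 0^' --> d.
Proof.
move=> h; have /cvg_ex[l' hl] := @ex_derive _ _ _ _ _ _ _ h.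
have -> : d = l' by rewrite -(@derive_val _ _ _ _ _ _ _ h); exact: cvg_lim hl.
apply: cvg_trans hl; apply: near_eq_cvg; near=> k.
by rewrite /= [X in f (X + x)]mulr1 (addrC k).
Unshelve. all: by end_near. Qed.

(** Only earlier times are compared: the maxima below are taken over [[0, t]] and may be attained at
    the final time, where the derivative need not vanish. *)
Lemma derive1_ge0_at_left_max f t a : a < t -> derivable f t 1 ->
  (forall u, a <= u -> u <= t -> f u <= f t) -> 0 <= derive1 f t.
Proof.
move=> at_ df hm; rewrite leNgt; apply/negP => L0.
have /cvgr_lt/(_ 0 L0) := is_derive_quotient (derivable_is_derive df).
rewrite /= near_withinE => /nbhs_ballP[e /= e0 he].
pose h := - (Num.min e (t - a) / 2).
have m0 : 0 < Num.min e (t - a) by rewrite lt_min e0 subr_gt0.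
have [me ma] : Num.min e (t - a) <= e /\ Num.min e (t - a) <= t - a.
  by rewrite !ge_min !lexx orbT.
have h0 : h < 0 by rewrite /h oppr_lt0 divr_gt0.
have hb : ball 0 e h.
  by rewrite /ball /= sub0r normrN ltr0_norm// /h; lra.
have := he h hb (ltr0_neq0 h0); rewrite ltNge => /negP; apply.
rewrite -mulrNN mulr_ge0//; first by rewrite -invrN invr_ge0 oppr_ge0 ltW.
by rewrite oppr_ge0 subr_le0; apply: hm; rewrite /h; lra.
Qed.

(** Put [W h] for the second difference minus [K * h^2]. If the second derivative at [x] exceeded
    [K], then [W] would have positive derivative for small [h > 0] and become positive. The case
    [K = 0] is the test at a maximum; general [K] transmits semiconcavity. *)
Lemma second_derivative_le w x K e : 0 < e ->
  (forall y, `|y - x| < e -> derivable w y 1) -> derivable (derive1 w) x 1 ->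
  (forall h, 0 < h -> h < e -> w (x + h) + w (x - h) - 2 * w x <= K * h ^+ 2) ->
  derive1 (derive1 w) x <= K.
Proof.
move=> e0 dw ddw hK; set L := derive1 (derive1 w) x; rewrite leNgt; apply/negP => KL.
have ML : (L + K) / 2 < L by lra.
have KM : K < (L + K) / 2 by lra.
have /cvgr_gt/(_ _ ML) := is_derive_quotient (derivable_is_derive ddw).
rewrite /= near_withinE => /nbhs_ballP[e1 /= e10 he].
set d := derive1 w in he.
pose b := Num.min e e1 / 2.
have m0 : 0 < Num.min e e1 by rewrite lt_min e0 e10.
have [me m1] : Num.min e e1 <= e /\ Num.min e e1 <= e1 by rewrite !ge_min !lexx orbT.
have b0 : 0 < b by rewrite divr_gt0.
have be : b < e by rewrite /b; lra.
have be1 : b < e1 by rewrite /b; lra.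
pose W h := w (x + h) + w (x - h) - 2 * w x - K * h ^+ 2.
have dW (h : R) : - e < h -> h < e -> is_derive h 1 W (d (x + h) - d (x - h) - 2 * K * h).
  move=> h1 h2.
  have hx1 : is_derive h 1 (fun h => x + h) (1 : R).
    by apply: is_derive_to (is_derive_add (is_derive_cst x h 1) (is_derive_id h 1)) _; rewrite add0r.
  have hx2 : is_derive h 1 (fun h => x - h) (-1 : R).
    by apply: is_derive_to (is_derive_add (is_derive_cst x h 1) (is_derive_opp (is_derive_id h 1))) _; rewrite add0r.
  have D1 : is_derive (x + h) 1 w (d (x + h)).
    by apply: derivable_is_derive; apply: dw; rewrite addrAC subrr add0r ltr_norml h1 h2.
  have D2 : is_derive (x - h) 1 w (d (x - h)).
    by apply: derivable_is_derive; apply: dw; rewrite addrAC subrr add0r normrN ltr_norml h1 h2.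
  have D3 : is_derive h 1 (fun h => K * h ^+ 2) (2 * K * h).
    apply: is_derive_to (is_derive_mul (is_derive_cst K h 1) (is_derive_mul (is_derive_id h 1) (is_derive_id h 1))) _.
    by rewrite /cst; ring.
  have := is_derive_add (is_derive_add (is_derive_add (is_derive_chain (g := fun h => x + h) D1 hx1)
    (is_derive_chain (g := fun h => x - h) D2 hx2)) (is_derive_cst (- (2 * w x)) h 1)) (is_derive_opp D3).
  by move/is_derive_to; apply; ring.
have cW : {within `[0, b], continuous W}.
  apply: derivable_within_continuous => y; rewrite in_itv /= => /andP[y0 yb].
  by apply: (@ex_derive _ _ _ _ _ _ _ (dW y _ _)); lra.
have [c] := MVT b0 (fun y (hy : y \in `]0, b[%R) => dW y
  ltac:(move: hy; rewrite in_itv /= => /andP[? ?]; lra)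
  ltac:(move: hy; rewrite in_itv /= => /andP[? ?]; lra)) cW.
rewrite in_itv /= => /andP[c0 cb] E.
have W0 : W 0 = 0 by rewrite /W addr0 subr0; ring.
have Wb : W b <= 0 by rewrite /W subr_le0; exact: hK.
have q1 : (L + K) / 2 < c^-1 * (d (x + c) - d x).
  apply: he; last by rewrite gt_eqF.
  by rewrite /ball /= sub0r normrN gtr0_norm//; exact: lt_trans be1.
have q2 : (L + K) / 2 < (- c)^-1 * (d (x - c) - d x).
  apply: (he (- c)); last by rewrite oppr_eq0 gt_eqF.
  by rewrite /ball /= sub0r opprK gtr0_norm//; exact: lt_trans be1.
rewrite -(ltr_pM2l c0) mulVKf ?gt_eqF// in q1.
rewrite -(ltr_pM2l c0) invrN mulNr mulrN mulVKf ?gt_eqF// in q2.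
have : 0 < W b - W 0 by rewrite E mulr_gt0 ?subr_gt0 ?subr0//; nra.
by rewrite W0 subr0 ltNge Wb.
Qed.

Lemma derive1_at_max0 f x e : 0 < e -> (forall y, `|y - x| < e -> derivable f y 1) ->
  (forall y, `|y - x| < e -> f y <= f x) -> derive1 f x = 0.
Proof.
move=> e0 df hm; apply: is_derive_derive1.
have I y : y \in `]x - e, x + e[%R -> `|y - x| < e.
  by rewrite in_itv /= ltr_norml => /andP[? ?]; apply/andP; split; lra.
apply: (@derive1_at_max _ f (x - e) (x + e)).
- lra.
- by move=> y /I; exact: df.
- by rewrite in_itv /=; apply/andP; split; lra.
- by move=> y /I; exact: hm.
Qed.

End calculus_at_max.

Section maximum_principles.
Context {R : realType}.
Implicit Types (t r phi : R).
Variables (T delta : R) (d0 : 0 < delta) (d1 : delta < 1).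

Definition layer (q r : R) : R :=
  expR (- (r - delta) / q ^+ 2) + expR (- (1 - r) / q ^+ 2).
(* [q] stands for [nu1 ^ (1/4)] and [n] for [nu2].  The layer covers the violated
   boundary condition, [q + (r - s) ^+ 2 / q ^+ 3] dominates [sqrt `|r - s|], and
   the exponents make [nu1] times the radial Laplacian of the barrier at most a
   constant times the barrier. *)
Definition barrier (q n s r : R) : R := layer q r + q + n + (r - s) ^+ 2 / q ^+ 3.
Definition barrier1 (q n s r : R) : R :=
  (expR (- (1 - r) / q ^+ 2) - expR (- (r - delta) / q ^+ 2)) / q ^+ 2 + 2 * (r - s) / q ^+ 3.
Definition barrier2 (q n s r : R) : R := layer q r / q ^+ 4 + 2 / q ^+ 3.

Lemma is_derive_exp_affine (c d x : R) : is_derive x 1 (fun y => expR (c * y + d)) (c * expR (c * x + d)).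
Proof.
by apply: is_derive_to (is_derive_chain (is_derive_expR _) (is_derive_affine c d x)) _; rewrite mulrC.
Qed.

Lemma is_derive_barrier q n s r : 0 < q -> is_derive r 1 (barrier q n s) (barrier1 q n s r).
Proof.
move=> q0; have qn0 : q != 0 by rewrite gt_eqF.
have e1 := is_derive_exp_affine (- q ^- 2) (delta * q ^- 2) r.
have e2 := is_derive_exp_affine (q ^- 2) (- q ^- 2) r.
have a := is_derive_affine 1 (- s) r.
have := is_derive_add (is_derive_add (is_derive_add e1 e2) (is_derive_cst (q + n) r 1))
  (is_derive_mul (is_derive_mul a a) (is_derive_cst (q ^- 3) r 1)).
set f := (fun y => _); have -> : f = barrier q n s.
  apply/funext => y; rewrite /f /barrier /layer /cst.
  have -> : - q ^- 2 * y + delta / q ^+ 2 = - (y - delta) / q ^+ 2 by ring.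
  have -> : q ^- 2 * y + - q ^- 2 = - (1 - y) / q ^+ 2 by ring.
  by rewrite !mul1r; ring.
move/is_derive_to; apply; rewrite /barrier1 /cst.
have -> : - q ^- 2 * r + delta / q ^+ 2 = - (r - delta) / q ^+ 2 by ring.
have -> : q ^- 2 * r + - q ^- 2 = - (1 - r) / q ^+ 2 by ring.
by ring.
Qed.

Lemma is_derive_barrier1 q n s r : 0 < q -> is_derive r 1 (barrier1 q n s) (barrier2 q n s r).
Proof.
move=> q0; have qn0 : q != 0 by rewrite gt_eqF.
have e1 := is_derive_exp_affine (- q ^- 2) (delta * q ^- 2) r.
have e2 := is_derive_exp_affine (q ^- 2) (- q ^- 2) r.
have := is_derive_add (is_derive_lin (q ^- 2) (- q ^- 2) e2 e1) (is_derive_affine (2 / q ^+ 3) (- 2 * s / q ^+ 3) r).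
set f := (fun y => _); have -> : f = barrier1 q n s.
  apply/funext => y; rewrite /f /barrier1 /cst.
  have -> : - q ^- 2 * y + delta / q ^+ 2 = - (y - delta) / q ^+ 2 by ring.
  have -> : q ^- 2 * y + - q ^- 2 = - (1 - y) / q ^+ 2 by ring.
  by ring.
move/is_derive_to; apply; rewrite /barrier2 /layer.
have -> : - q ^- 2 * r + delta / q ^+ 2 = - (r - delta) / q ^+ 2 by ring.
have -> : q ^- 2 * r + - q ^- 2 = - (1 - r) / q ^+ 2 by ring.
by field.
Qed.

Lemma layer_gt0 q r : 0 < layer q r. Proof. by rewrite addr_gt0// expR_gt0. Qed.

Lemma barrier_ge q n s r : 0 < q -> 0 <= n -> layer q r <= barrier q n s r /\ q <= barrier q n s r
  /\ n <= barrier q n s r /\ (r - s) ^+ 2 / q ^+ 3 <= barrier q n s r.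
Proof.
move=> q0 n0; have l := layer_gt0 q r; have p : 0 <= (r - s) ^+ 2 / q ^+ 3.
  by rewrite divr_ge0 ?sqr_ge0// exprn_ge0// ltW.
by rewrite /barrier; do !split; lra.
Qed.

(** The factor [q^4] turns the second derivative of the layer into the layer itself and that of the
    penalty into [2 * q], both controlled by the barrier. The first-order terms cost [delta^-1],
    using [q <= 1] and [r - s <= 1]. *)
Lemma barrier_supersolution q n s r : 0 < q -> q <= 1 -> 0 <= n ->
  delta <= r <= 1 -> delta <= s <= 1 ->
  q ^+ 4 * (barrier2 q n s r + r^-1 * barrier1 q n s r) <= (2 + 2 / delta) * barrier q n s r.
Proof.
have d0' := d0; move=> q0 q1 n0 /andP[r1 r2] /andP[s1 s2]; have qn0 : q != 0 by rewrite gt_eqF.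
have [l [bq _]] := barrier_ge s r q0 n0.
have r0 : 0 < r by exact: lt_le_trans r1.
have rn0 : r != 0 by rewrite gt_eqF.
set Eb := expR (- (1 - r) / q ^+ 2); set Ea := expR (- (r - delta) / q ^+ 2).
have Eb0 : 0 < Eb by exact: expR_gt0.
have Ea0 : 0 < Ea by exact: expR_gt0.
have lE : layer q r = Ea + Eb by [].
have -> : q ^+ 4 * (barrier2 q n s r + r^-1 * barrier1 q n s r) =
   layer q r + 2 * q + q ^+ 2 * r^-1 * (Eb - Ea) + 2 * q * (r^-1 * (r - s)).
  by rewrite /barrier2 /barrier1 -/Ea -/Eb; field; rewrite rn0.
have ri : r^-1 <= delta^-1 by rewrite lef_pV2.
have ri0 : 0 < r^-1 by rewrite invr_gt0.
have di0 : 0 < delta^-1 by rewrite invr_gt0.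
have t1 : q ^+ 2 * r^-1 * (Eb - Ea) <= delta^-1 * layer q r.
  have q2 : q ^+ 2 <= 1 by rewrite exprn_ile1// ltW.
  apply: (@le_trans _ _ (q ^+ 2 * r^-1 * layer q r)).
    by rewrite ler_wpM2l ?mulr_ge0 ?sqr_ge0 ?ltW//; lra.
  rewrite ler_wpM2r ?(ltW (layer_gt0 _ _))//.
  by rewrite -[leRHS]mul1r ler_pM// ?sqr_ge0// ltW.
have t2 : r^-1 * (r - s) <= delta^-1.
  apply: (@le_trans _ _ (r^-1 * 1)); last by rewrite mulr1.
  by rewrite ler_wpM2l ?ltW//; lra.
have t3 : 2 * q * (r^-1 * (r - s)) <= 2 * q * delta^-1 by rewrite ler_wpM2l// mulr_ge0// ltW.
have t4 : delta^-1 * (layer q r + q) <= delta^-1 * barrier q n s r.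
  rewrite ler_wpM2l ?(ltW di0)// /barrier; have : 0 <= (r - s) ^+ 2 / q ^+ 3.
    by rewrite divr_ge0 ?sqr_ge0// exprn_ge0// ltW.
  by lra.
have t5 : layer q r + q <= barrier q n s r.
  rewrite /barrier; have : 0 <= (r - s) ^+ 2 / q ^+ 3.
    by rewrite divr_ge0 ?sqr_ge0// exprn_ge0// ltW.
  by lra.
have t6 : 0 < delta^-1 * layer q r by rewrite mulr_gt0// layer_gt0.
have := layer_gt0 q r; nra.
Qed.

Lemma layer_boundary q : 0 < q -> 1 <= layer q delta /\ 1 <= layer q 1.
Proof.
move=> q0; rewrite /layer !subrr oppr0 !mul0r expR0; split.
  by rewrite lerDl expR_ge0.
by rewrite lerDr expR_ge0.
Qed.

(** The differential inequality is demanded only where [v] is positive and maximal in [phi]: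
    positivity controls the zero-order term of the angular equation, and maximality controls the
    angular derivatives of the axial one, so none has to appear here. *)
Lemma comparison (q n s A C : R) (v : R -> R -> R -> R) :
  0 < q -> q <= 1 -> 0 <= n -> delta <= s <= 1 -> 1 <= A -> 0 <= C ->
  {within cyl3 T delta, continuous (fun z => v z.1.1 z.1.2 z.2)} ->
  (forall t r, 0 <= t <= T -> delta <= r <= 1 -> periodic2pi (v t r)) ->
  (forall r phi, delta <= r <= 1 -> v 0 r phi <= A * barrier q n s r) ->
  (forall t phi, 0 <= t <= T -> v t delta phi <= A /\ v t 1 phi <= A) ->
  (forall t r phi, 0 < t < T -> delta < r < 1 -> derivable (fun t => v t r phi) t 1) ->
  (forall t phi, 0 < t < T -> twice_derivable `]delta, 1[ (fun r => v t r phi)) ->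
  (forall t r phi, 0 < t < T -> delta < r < 1 -> 0 < v t r phi ->
     (forall phi', v t r phi' <= v t r phi) ->
     derive1 (fun t => v t r phi) t - q ^+ 4 * (derive1 (derive1 (fun r => v t r phi)) r +
        r^-1 * derive1 (fun r => v t r phi) r) <= C * barrier q n s r) ->
  forall t r phi, 0 <= t < T -> delta <= r <= 1 ->
    v t r phi <= A * expR ((3 + 2 / delta + C) * t) * barrier q n s r.
Proof.
have d0' := d0; have d1' := d1; move=> q0 q1 n0 hs A1 C0 cv pv vi vb dt dr hC t r phi /andP[t0 tT] hr.
(* [2 + 2 / delta] pays for diffusion of the barrier, [C] for the source, and the last unit makes
   the final contradiction strict. *)
set k := 3 + 2 / delta + C.
have dd : 0 < 2 / delta by rewrite divr_gt0.
have k0 : 0 < k by rewrite /k; lra.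
have A0 : 0 < A by lra.
have b0 r' : 0 < barrier q n s r'.
  by have [l _] := barrier_ge s r' q0 n0; exact: lt_le_trans (layer_gt0 _ _) l.
pose G (z : R * R * R) := v z.1.1 z.1.2 z.2 - A * expR (k * z.1.1) * barrier q n s z.1.2.
(* The box stops at [t < T], so that a maximum at its last time still lies where the equation holds;
   by periodicity one period of [phi] is enough, which gives compactness. *)
pose K : set (R * R * R) := (`[0, t] `*` `[delta, 1]) `*` `[0, 2 * pi].
have KT : K `<=` cyl3 T delta.
  move=> [[t' r'] p'] [[/= + h2] _]; rewrite in_itv /= => /andP[h1 h1'].
  by split=> //; split => //=; rewrite in_itv /= h1 (le_trans h1')// ltW.
have cK : compact K by do !apply: compact_setX; exact: segment_compact.
have cb : continuous (barrier q n s) by move=> x; exact: is_derive_continuous (is_derive_barrier n s x q0).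
have cG : {within K, continuous G}.
  have c2 : continuous (fun z : R * R * R => A * expR (k * z.1.1) * barrier q n s z.1.2).
    move=> z; apply: cvgM.
      apply: cvgM; first exact: cvg_cst.
      apply: (continuous_comp (f := fun z : R * R * R => k * z.1.1) (g := @expR R)); last exact: continuous_expR.
      apply: cvgM; first exact: cvg_cst.
      by apply: (continuous_comp (f := fst) (g := fst)); exact: cvg_fst.
    apply: (continuous_comp (f := fun z : R * R * R => z.1.2) (g := barrier q n s)); last exact: cb.
    by apply: (continuous_comp (f := fst) (g := snd)); [exact: cvg_fst|exact: cvg_snd].
  move=> z; apply: cvgB; first exact: (continuous_subspaceW KT cv).
  exact: (continuous_subspaceT c2).
have [|[[t1 r1] p1]] := compact_EVT_max _ cK cG.
  exists (0, delta, 0); do !split; rewrite /= in_itv /= ?lexx ?t0 ?(ltW d1)//.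
  exact: ltW (@pi2_gt0 R).
rewrite inE => -[[/= + +] +]; rewrite !in_itv /= => /andP[t10 t1t] hr1 hp1 maxG.
have maxG' t' r' p' : 0 <= t' <= t -> delta <= r' <= 1 -> G (t', r', p') <= G (t1, r1, p1).
  move=> ht' hr'; have [p'' hp'' pp] := periodic_representative p'.
  have -> : G (t', r', p') = G (t', r', p'').
    rewrite /G /= (pp (v t' r'))//; apply: pv => //.
    by case/andP: ht' => -> h /=; rewrite (le_trans h)// ltW.
  by apply: maxG; rewrite inE; do !split; rewrite /= in_itv.
have t1T : 0 <= t1 <= T by rewrite t10 (le_trans t1t)// ltW.
suff : G (t1, r1, p1) <= 0.
  have := maxG' t r phi; rewrite t0 lexx => /(_ isT hr) h1 h2.
  by have := le_trans h1 h2; rewrite /G /= subr_le0.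
rewrite leNgt; apply/negP => G0.
have ek u : 0 <= u -> 1 <= expR (k * u) by move=> u0; rewrite -(expR0 R) ler_expR mulr_ge0// ltW.
have Gb : A * expR (k * t1) * barrier q n s r1 < v t1 r1 p1 by move: G0; rewrite /G /= subr_gt0.
have Ab : A * barrier q n s r1 <= A * expR (k * t1) * barrier q n s r1.
  by rewrite ler_wpM2r ?(ltW (b0 _))// ler_peMr ?ek// ltW.
have [lb1 lb2] := layer_boundary q0.
have t1p : 0 < t1.
  rewrite lt_neqAle t10 andbT; apply/eqP => E; move: Gb; rewrite -E mulr0 expR0 mulr1 ltNge.
  by rewrite vi.
have r1d : delta < r1.
  rewrite lt_neqAle (andP hr1).1 andbT; apply/eqP => E; move: (lt_le_trans (le_lt_trans Ab Gb) (le_refl _)).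
  rewrite -E ltNge (le_trans (vb t1 p1 t1T).1)// ler_peMr ?(ltW A0)//.
  by apply: le_trans lb1 _; have [] := barrier_ge s delta q0 n0.
have r11 : r1 < 1.
  rewrite lt_neqAle (andP hr1).2 andbT; apply/eqP => E; move: (lt_le_trans (le_lt_trans Ab Gb) (le_refl _)).
  rewrite E ltNge (le_trans (vb t1 p1 t1T).2)// ler_peMr ?(ltW A0)//.
  by apply: le_trans lb2 _; have [] := barrier_ge s 1 q0 n0.
have t1i : 0 < t1 < T by rewrite t1p (le_lt_trans t1t).
have r1i : delta < r1 < 1 by rewrite r1d r11.
set Ek := A * expR (k * t1).
have Ek0 : 0 < Ek by rewrite mulr_gt0// expR_gt0.
have EkA : A <= Ek by rewrite ler_peMr ?ek// ltW.
have vpos : 0 < v t1 r1 p1 by apply: lt_trans Gb; rewrite mulr_gt0.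
have vmax p' : v t1 r1 p' <= v t1 r1 p1.
  by have := maxG' t1 r1 p'; rewrite t10 t1t => /(_ isT hr1); rewrite /G /= lerD2r.
have Dt : k * Ek * barrier q n s r1 <= derive1 (fun t => v t r1 p1) t1.
  have dv := derivable_is_derive (dt t1 r1 p1 t1i r1i).
  have de : is_derive t1 1 (fun t => A * expR (k * t + 0) * barrier q n s r1) (k * Ek * barrier q n s r1).
    apply: is_derive_to (is_derive_mul (is_derive_mul (is_derive_cst A t1 1) (is_derive_exp_affine k 0 t1)) (is_derive_cst (barrier q n s r1) t1 1)) _.
    by rewrite /cst /Ek addr0; ring.
  have dG := is_derive_add dv (is_derive_opp de).
  have := @derive1_ge0_at_left_max _ _ t1 0 t1p (@ex_derive _ _ _ _ _ _ _ dG).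
  rewrite (is_derive_derive1 dG) subr_ge0; apply => u u0 ut.
  by have := maxG' u r1 p1; rewrite u0 (le_trans ut t1t) /G /= !addr0 => /(_ isT hr1).
pose e := Num.min (r1 - delta) (1 - r1).
have e0 : 0 < e by rewrite lt_min !subr_gt0 r1d r11.
have eI y : `|y - r1| < e -> delta < y < 1.
  rewrite lt_min !ltr_norml opprB => /andP[/andP[+ _] /andP[_ +]].
  by rewrite ltrD2r ltrBlDr subrK => -> ->.
pose w r := v t1 r p1 - Ek * barrier q n s r.
have wmax y : `|y - r1| < e -> w y <= w r1.
  by move=> /eI /andP[y1 y2]; have := maxG' t1 y p1; rewrite t10 t1t (ltW y1) (ltW y2) => /(_ isT isT).
have dw1 y : delta < y < 1 -> is_derive y 1 w (derive1 (fun r => v t1 r p1) y - Ek * barrier1 q n s y).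
  move=> hy; have [d1y _] := dr t1 p1 t1i y ltac:(by rewrite /= in_itv).
  have := is_derive_add (derivable_is_derive d1y) (is_derive_opp (is_derive_mul (is_derive_cst Ek y 1) (is_derive_barrier n s y q0))).
  by move/is_derive_to; apply; rewrite mul0r add0r.
have dw2 : is_derive r1 1 (derive1 w) (derive1 (derive1 (fun r => v t1 r p1)) r1 - Ek * barrier2 q n s r1).
  have [_ d2y] := dr t1 p1 t1i r1 ltac:(by rewrite /= in_itv).
  have := is_derive_add (derivable_is_derive d2y) (is_derive_opp (is_derive_mul (is_derive_cst Ek r1 1) (is_derive_barrier1 n s r1 q0))).
  rewrite mul0r add0r => H; apply: near_eq_is_derive H.
  near=> y; rewrite (is_derive_derive1 (dw1 y _))//.
  by apply/andP; split; near: y; [exact: lt_nbhsr|exact: lt_nbhsl].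
have wd y : `|y - r1| < e -> derivable w y 1.
  by move=> /eI hy; exact: (@ex_derive _ _ _ _ _ _ _ (dw1 y hy)).
have := derive1_at_max0 e0 wd wmax; rewrite (is_derive_derive1 (dw1 r1 r1i)) => /eqP; rewrite subr_eq0 => /eqP Dr.
have : derive1 (derive1 w) r1 <= 0.
  apply: (second_derivative_le e0 wd) => [|h h0 he]; first exact: (@ex_derive _ _ _ _ _ _ _ dw2).
  have a1 : w (r1 + h) <= w r1 by apply: wmax; rewrite addrAC subrr add0r gtr0_norm.
  have a2 : w (r1 - h) <= w r1 by apply: wmax; rewrite addrAC subrr add0r normrN gtr0_norm.
  by rewrite mul0r; lra.
rewrite (is_derive_derive1 dw2) subr_le0 => Drr.
have := hC t1 r1 p1 t1i r1i vpos vmax; rewrite Dr.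
apply/negP; rewrite -ltNge.
have q4 : 0 < q ^+ 4 by rewrite exprn_gt0.
have bs := barrier_supersolution q0 q1 n0 hr1 hs.
have h1 : q ^+ 4 * (derive1 (derive1 (fun r => v t1 r p1)) r1 + r1^-1 * (Ek * barrier1 q n s r1)) <=
   Ek * ((2 + 2 / delta) * barrier q n s r1).
  apply: (@le_trans _ _ (q ^+ 4 * (Ek * barrier2 q n s r1 + r1^-1 * (Ek * barrier1 q n s r1)))).
    by rewrite ler_wpM2l ?(ltW q4)// lerD2r.
  apply: le_trans (ler_wpM2l (ltW Ek0) bs).
  by rewrite le_eqVlt; apply/orP; left; apply/eqP; ring.
apply: lt_le_trans (lerB Dt h1).
(* The left side of the differential inequality is thus at least [(1 + C) * Ek * barrier], which
   exceeds [C * barrier] because [Ek >= A >= 1]. *)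
have -> : k * Ek * barrier q n s r1 - Ek * ((2 + 2 / delta) * barrier q n s r1) = (1 + C) * (Ek * barrier q n s r1).
  by rewrite /k; ring.
have Bb := b0 r1.
have : barrier q n s r1 <= Ek * barrier q n s r1 by rewrite ler_peMl ?(ltW Bb)//; lra.
have : 0 < Ek * barrier q n s r1 by rewrite mulr_gt0.
move=> p0 pE; have := ler_wpM2l C0 pE; rewrite mulrDl mul1r => h; apply: le_lt_trans h _.
by rewrite ltrDr.
Unshelve. all: by end_near. Qed.

End maximum_principles.

(** * Transport on a circle, and derivative bounds from semiconcavity *)

Section transport.
Context {R : realType}.
Implicit Types (t phi h : R).

(* Classical comparison for a one-dimensional transport equation on a circle;
   the speed does not matter because the angular derivative vanishes at a maximum. *)
Lemma transport_max (T M0 M1 : R) (D : R -> R -> R) :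
  {within `[0, T] `*` setT, continuous (fun z : R * R => D z.1 z.2)} ->
  (forall t, 0 <= t <= T -> periodic2pi (D t)) -> 0 <= M1 ->
  (forall phi, D 0 phi <= M0) ->
  (forall t phi, 0 < t < T -> derivable (fun t => D t phi) t 1) ->
  (forall t phi, 0 < t < T -> (forall phi', D t phi' <= D t phi) ->
     derive1 (fun t => D t phi) t < M1) ->
  forall t phi, 0 <= t < T -> D t phi <= M0 + M1 * t.
Proof.
move=> cD pD M10 hi dt hm t phi /andP[t0 tT].
pose G (z : R * R) := D z.1 z.2 - (M0 + M1 * z.1).
pose K : set (R * R) := `[0, t] `*` `[0, 2 * pi].
have KT : K `<=` `[0, T] `*` setT.
  move=> [t' p'] [/= h2 _]; move: h2; rewrite in_itv /= => /andP[h1 h1'].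
  by split => //=; rewrite in_itv /= h1 (le_trans h1')// ltW.
have cK : compact K by apply: compact_setX; exact: segment_compact.
have cG : {within K, continuous G}.
  have c2 : continuous (fun z : R * R => M0 + M1 * z.1).
    by move=> z; apply: cvgD; [exact: cvg_cst|apply: cvgM; [exact: cvg_cst|exact: cvg_fst]].
  move=> z; apply: cvgB; first exact: (continuous_subspaceW KT cD).
  exact: (continuous_subspaceT c2).
have [|[t1 p1]] := compact_EVT_max _ cK cG.
  exists (0, 0); do !split; rewrite /= in_itv /= ?lexx ?t0//.
  exact: ltW (@pi2_gt0 R).
rewrite inE => -[/= + +]; rewrite !in_itv /= => /andP[t10 t1t] hp1 maxG.
have maxG' t' p' : 0 <= t' <= t -> G (t', p') <= G (t1, p1).
  move=> ht'; have [p'' hp'' pp] := periodic_representative p'.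
  have -> : G (t', p') = G (t', p'').
    rewrite /G /= (pp (D t'))//; apply: pD => //.
    by case/andP: ht' => -> h /=; rewrite (le_trans h)// ltW.
  by apply: maxG; rewrite inE; do !split; rewrite /= in_itv.
suff : G (t1, p1) <= 0.
  have := maxG' t phi; rewrite t0 lexx => /(_ isT) h1 h2.
  by have := le_trans h1 h2; rewrite /G /= subr_le0.
rewrite leNgt; apply/negP => G0.
have t1p : 0 < t1.
  rewrite lt_neqAle t10 andbT; apply/eqP => E; move: G0; rewrite -E /G /= mulr0 addr0 subr_gt0.
  by rewrite ltNge hi.
have t1i : 0 < t1 < T by rewrite t1p (le_lt_trans t1t).
have vmax p' : D t1 p' <= D t1 p1.
  by have := maxG' t1 p'; rewrite t10 t1t => /(_ isT); rewrite /G /= lerD2r.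
have := hm t1 p1 t1i vmax; apply/negP; rewrite -leNgt.
have dv := derivable_is_derive (dt t1 p1 t1i).
have dG := is_derive_add dv (is_derive_opp (is_derive_affine M1 M0 t1)).
have := @derive1_ge0_at_left_max _ _ t1 0 t1p (@ex_derive _ _ _ _ _ _ _ dG).
rewrite (is_derive_derive1 dG) subr_ge0; apply => u u0 ut.
by have := maxG' u p1; rewrite u0 (le_trans ut t1t) /G /= ![M1 * _ + _]addrC => /(_ isT).
Qed.

(* Dyadic halving: from [v (x/2) >= v x / 2] a positive value of
   [v y = u (phi + y) - u phi - u' y - K y^2] would give a positive slope at 0. *)
Lemma semiconcave_le (u : R -> R) (K phi : R) : 0 <= K -> derivable u phi 1 ->
  (forall h x, 0 < h -> h <= 1 -> sdiff h u x <= K * h ^+ 2) ->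
  forall x, `|x| <= 1 -> u (phi + x) <= u phi + derive1 u phi * x + K * x ^+ 2.
Proof.
move=> K0 du hu x x1; set p := derive1 u phi.
have [->|x0] := eqVneq x 0; first by rewrite addr0 mulr0 expr0n/= mulr0 !addr0.
pose v y := u (phi + y) - u phi - p * y - K * y ^+ 2.
rewrite -subr_le0 !opprD !addrA -/(v x) leNgt; apply/negP => vx.
have half y : `|y| <= 1 -> y != 0 -> v y / 2 <= v (y / 2).
  move=> y1 y0; have ay0 : 0 < `|y| / 2 by rewrite divr_gt0// normr_gt0.
  have := hu (`|y| / 2) (phi + y / 2) ay0 ltac:(lra).
  (* Centred at [phi + y / 2] with half-step [|y| / 2], the second difference has end points [phi]
     and [phi + y], whatever the sign of [y]. *)
  have E : sdiff (`|y| / 2) u (phi + y / 2) = u (phi + y) + u phi - 2 * u (phi + y / 2).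
    rewrite /sdiff; case: (ger0P y) => _.
      by congr (u _ + u _ - _); lra.
    have -> : phi + y / 2 + - y / 2 = phi by lra.
    have -> : phi + y / 2 - - y / 2 = phi + y by lra.
    by ring.
  rewrite E exprMn real_normK ?num_real// => H.
  have s : 0 <= K * y ^+ 2 by rewrite mulr_ge0// sqr_ge0.
  rewrite /v exprMn.
  move: H s; have -> : 2^-1 ^+ 2 = 4^-1 :> R by field.
  rewrite !mulrA; move: (K * y ^+ 2) => k; lra.
have halves (j : nat) : v x / 2 ^+ j <= v (x / 2 ^+ j).
  elim: j => [|j ih]; first by rewrite expr0 !divr1.
  have p2 : 0 < 2 ^+ j :> R by rewrite exprn_gt0.
  have -> : x / 2 ^+ j.+1 = x / 2 ^+ j / 2 by rewrite exprS; field; rewrite gt_eqF.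
  have -> : v x / 2 ^+ j.+1 = v x / 2 ^+ j / 2 by rewrite exprS; field; rewrite gt_eqF.
  apply: le_trans (half _ _ _); first by rewrite ler_pM2r// invr_gt0.
    rewrite normrM normfV (gtr0_norm p2) ler_pdivrMr// mul1r (le_trans x1)//.
    by rewrite exprn_ege1// ler1n.
  by rewrite mulf_neq0// invr_neq0// gt_eqF.
have Q := is_derive_quotient (derivable_is_derive du); rewrite -/p in Q.
have /cvgrPdist_lt/(_ (v x / `|x|)) := Q; rewrite divr_gt0 ?normr_gt0// => /(_ isT).
rewrite near_withinE => /nbhs_ballP[e /= e0 he].
have [j hj] : exists j : nat, `|x| / 2 ^+ j < e.
  have : (fun j : nat => `|x| * (2^-1 : R) ^+ j) @ \oo --> `|x| * 0.
    by apply: cvgM; [exact: cvg_cst|apply: cvg_expr; rewrite gtr0_norm ?invr_gt0// invf_lt1// ltr1n].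
  rewrite mulr0 => /cvgr_lt/(_ e e0) [N _ hN]; exists N; rewrite -exprVn; apply: hN => /=.
  exact: leqnn.
set y := x / 2 ^+ j.
have p2 : 0 < 2 ^+ j :> R by rewrite exprn_gt0.
have y0 : y != 0 by rewrite mulf_neq0// invr_neq0// gt_eqF.
have ny : `|y| = `|x| / 2 ^+ j by rewrite normrM normfV (gtr0_norm p2).
have := he y ltac:(by rewrite /ball /= sub0r normrN ny) y0.
rewrite distrC => H.
have E : y^-1 * (u (phi + y) - u phi) - p = y^-1 * (v y + K * y ^+ 2) by rewrite /v; field.
move: H; rewrite E normrM normfV mulrC ltr_pdivrMr ?normr_gt0// ltNge => /negP; apply.
apply: le_trans (ler_norm _).
have -> : v x / `|x| * `|y| = v x / 2 ^+ j.
  by rewrite ny mulrA divfK// normr_eq0.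
by apply: (le_trans (halves j)); rewrite lerDl mulr_ge0// sqr_ge0.
Qed.

(** A semiconcave function lies below its tangent parabola; one unit step on either side shows that
    a steep tangent would contradict the bound [M]. *)
Lemma semiconcave_derive_bound (u : R -> R) (K M phi : R) : 0 <= K -> derivable u phi 1 ->
  (forall h x, 0 < h -> h <= 1 -> sdiff h u x <= K * h ^+ 2) -> (forall x, `|u x| <= M) ->
  `|derive1 u phi| <= 2 * M + K.
Proof.
move=> K0 du hu hM.
have h1 := semiconcave_le K0 du hu (x := 1) ltac:(by rewrite normr1).
have h2 := semiconcave_le K0 du hu (x := -1) ltac:(by rewrite normrN1).
have := hM phi; have := hM (phi + 1); have := hM (phi + -1).
rewrite !ler_norml => /andP[? ?] /andP[? ?] /andP[? ?].
move: h1 h2; rewrite mulr1 mulrN1 sqrrN expr1n mulr1 => ? ?.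
by apply/andP; split; lra.
Qed.

End transport.

(** * Regularity of the data *)

Section data_regularity.
Context {R : realType}.
Variables (T delta : R) (d0 : 0 < delta) (d1 : delta < 1).

Lemma within_continuous_comp {S U : topologicalType} (A : set U) (F : U -> R) (h : S -> U) :
  {within A, continuous F} -> continuous h -> (forall z, A (h z)) -> continuous (fun z => F (h z)).
Proof.
move=> /subspace_continuousP cF ch hA z; have := cF (h z) (hA z).
move=> c; apply: cvg_trans c; move=> V /= hV.
rewrite /within /= in hV.
have H : \forall y \near z, A (h y) -> V (F (h y)) := ch z _ hV.
change (\forall y \near z, V (F (h y))).
by apply: filterS H => y; apply; exact: hA.
Qed.

Lemma within_continuous_comp_in {S U : topologicalType} (B : set S) (A : set U) (F : U -> R) (h : S -> U) :
  {within A, continuous F} -> {within B, continuous h} -> (forall z, B z -> A (h z)) ->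
  {within B, continuous (fun z => F (h z))}.
Proof.
move=> /subspace_continuousP cF /subspace_continuousP ch hA; apply/subspace_continuousP => z Bz.
have := cF (h z) (hA z Bz) => c; apply: cvg_trans c => V /= hV.
rewrite /within /= in hV.
have H : \forall y \near z, B y -> A (h y) -> V (F (h y)) := ch z Bz _ hV.
change (\forall y \near z, B y -> V (F (h y))).
by apply: filterS H => y hy By; apply: (hy By); exact: hA.
Qed.

(** Projection onto [[delta, 1]]: composing with it extends functions continuous on the closed
    cylinder to the whole plane, where the integration lemmas want them. *)
Definition clamp (r : R) : R := Num.max delta (Num.min r 1).

Lemma clamp_in r : delta <= clamp r <= 1.
Proof. by rewrite /clamp le_max lexx ge_max ge_min lexx orbT (ltW d1). Qed.

Lemma clampK r : delta <= r <= 1 -> clamp r = r.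
Proof. by move=> /andP[r1 r2]; rewrite /clamp min_l// max_r. Qed.

Lemma continuous_clamp : continuous clamp.
Proof.
move=> x; apply: (@continuous_max R R (fun=> delta) (fun r => Num.min r 1)); first exact: cvg_cst.
by apply: (@continuous_min R R id (fun=> 1)); [exact: cvg_id|exact: cvg_cst].
Qed.

Lemma in_Hm_L2 k (g : R * R -> R) : in_Hm delta k g -> in_L2 delta g.
Proof. by case: k => [|k] []. Qed.

Lemma in_HmS k (g : R * R -> R) : in_Hm delta k.+1 g -> exists gr gphi : R * R -> R,
  [/\ weak_derive delta (1, 0) g gr, weak_derive delta (0, 1) g gphi,
      in_Hm delta k gr & in_Hm delta k gphi].
Proof. by case. Qed.

(** The Hoelder bound uses [g_r] and [g_(r phi)]; the second differences use three angular
    derivatives and then a radial one. Taking [s] in the open interval makes [|r - s| < 1 - delta],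
    as [radial_holder] requires. *)
Lemma sobolev_regularity m (g G : R * R -> R) : (4 < m)%N -> in_Hm delta m g ->
  continuous G -> (forall r, periodic2pi (fun phi => G (r, phi))) ->
  (forall z, Omega delta z -> g z = G z) ->
  exists K : R, [/\ 0 <= K,
    forall r s phi, delta <= r <= 1 -> delta < s < 1 ->
      `|G (r, phi) - G (s, phi)| <= K * Num.sqrt `|r - s| &
    forall h r phi, 0 < h -> delta <= r <= 1 -> `|sdiff h (fun p => G (r, p)) phi| <= K * h ^+ 2].
Proof.
case: m => [//|[//|[//|[//|m]]]] _.
move=> /in_HmS [gr [g1 [wr w1 Hr H1]]] cG pG gG.
have [_ [grp [_ wrp _ Hrp]]] := in_HmS Hr.
have [_ [g2 [_ w2 _ H2]]] := in_HmS H1.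
have [_ [g3 [_ w3 _ H3]]] := in_HmS H2.
have [g3r [_ [w3r _ H3r _]]] := in_HmS H3.
have [K1 h1] := radial_holder d0 d1 cG gG wr wrp (in_Hm_L2 Hr) (in_Hm_L2 Hrp).
have [K2 h2] := angular_sdiff d0 d1 cG pG gG w1 w2 w3 w3r (in_Hm_L2 H3) (in_Hm_L2 H3r).
exists (`|K1| + `|K2|); split; first by rewrite addr_ge0.
  move=> r s phi /andP[r1 r2] /andP[s1 s2].
  have [p hp pp] := periodic_representative phi.
  rewrite (pp (fun phi => G (r, phi)))// (pp (fun phi => G (s, phi)))//.
  have K1K h : K1 * Num.sqrt h <= (`|K1| + `|K2|) * Num.sqrt h.
    by rewrite ler_wpM2r ?sqrtr_ge0// (le_trans (ler_norm _))// lerDl.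
  apply: le_trans (K1K _).
  have [rs|sr|->] := ltgtP r s; last by rewrite !subrr normr0 sqrtr0 mulr0.
    have := h1 (s - r) r p; rewrite subr_gt0 rs (addrC r) subrK distrC => H.
    have -> : `|r - s| = s - r by rewrite distrC gtr0_norm// subr_gt0.
    by apply: H => //; lra.
  have := h1 (r - s) s p; rewrite subr_gt0 sr (addrC s) subrK => H.
  have -> : `|r - s| = r - s by rewrite gtr0_norm// subr_gt0.
  by apply: H => //; lra.
move=> h r phi h0 hr; have [p hp pp] := periodic_representative phi.
rewrite (pp (sdiff h (fun p => G (r, p)))); last first.
  by move=> x; rewrite /sdiff -!addrA ![2 * pi + _]addrC !addrA !pG.
apply: (le_trans (h2 h r p h0 hr hp)).
by rewrite ler_wpM2r ?sqr_ge0// (le_trans (ler_norm _))// lerDr.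
Qed.

Lemma within_slice_continuous (f : R * R * R -> R) (a : R * R * R) (v : R * R * R) (u w : R) :
  {within cyl3 T delta, continuous f} ->
  (forall x, u <= x <= w -> cyl3 T delta (a.1.1 + x * v.1.1, a.1.2 + x * v.1.2, a.2 + x * v.2)) ->
  {within `[u, w], continuous (fun x => f (a.1.1 + x * v.1.1, a.1.2 + x * v.1.2, a.2 + x * v.2))}.
Proof.
move=> cf hv; apply: (@within_continuous_comp_in R (R * R * R)%type `[u, w]%classic (cyl3 T delta) f
  (fun x => (a.1.1 + x * v.1.1, a.1.2 + x * v.1.2, a.2 + x * v.2)) cf) => [|x /=].
  have c (b d : R) : continuous (fun x : R => b + x * d).
    by move=> x; apply: cvgD; [exact: cvg_cst|apply: cvgM; [exact: cvg_id|exact: cvg_cst]].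
  apply: continuous_subspaceT => x.
  apply: (@continuous_pair R (R * R)%type R (fun x => (a.1.1 + x * v.1.1, a.1.2 + x * v.1.2)) (fun x => a.2 + x * v.2)); last exact: c.
  by apply: (@continuous_pair R R R (fun x => a.1.1 + x * v.1.1) (fun x => a.1.2 + x * v.1.2)); exact: c.
by rewrite in_itv /=; exact: hv.
Qed.

Lemma is_derive_in_line (A : set (R * R * R)) (f : R * R * R -> R) (a v : R * R * R) (x l e : R) : 0 < e ->
  (forall h, `|h| < e -> A (a.1.1 + (x + h) * v.1.1, a.1.2 + (x + h) * v.1.2, a.2 + (x + h) * v.2)) ->
  is_derive_in A f v (a.1.1 + x * v.1.1, a.1.2 + x * v.1.2, a.2 + x * v.2) l ->
  is_derive x 1 (fun x => f (a.1.1 + x * v.1.1, a.1.2 + x * v.1.2, a.2 + x * v.2)) l.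
Proof.
have Fh (h : R) : h *: v + (a.1.1 + x * v.1.1, a.1.2 + x * v.1.2, a.2 + x * v.2) =
    (a.1.1 + (x + h) * v.1.1, a.1.2 + (x + h) * v.1.2, a.2 + (x + h) * v.2).
  case: v => -[v1 v2] v3 /=.
  have sc (p1 p2 p3 : R) : h *: (v1, v2, v3) + (p1, p2, p3) = (h * v1 + p1, h * v2 + p2, h * v3 + p3) by [].
  by rewrite sc; congr (_, _, _); ring.
move=> e0 hA hd; set F := (fun x => _).
have H : (fun h : R => h^-1 *: ((F \o shift x) (h *: 1) - F x)) @ 0^' --> l.
  have H0 : (fun h : R => h^-1 * (f (h *: v + (a.1.1 + x * v.1.1, a.1.2 + x * v.1.2, a.2 + x * v.2)) -
     f (a.1.1 + x * v.1.1, a.1.2 + x * v.1.2, a.2 + x * v.2))) @ 0^' --> l.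
    apply: cvg_trans hd => V; rewrite /within /= => hV.
    have near0 : \forall h \near (0 : R)^', A (h *: v + (a.1.1 + x * v.1.1, a.1.2 + x * v.1.2, a.2 + x * v.2)).
      near=> h; rewrite Fh; apply: hA; near: h; exact: dnbhs0_lt.
    by move: near0 hV; apply: filterS2 => h Ah; apply.
  apply: cvg_trans H0; apply: near_eq_cvg; near=> h.
  by rewrite Fh /= [h *: 1]mulr1 /F (addrC h).
by apply: DeriveDef; [apply/cvg_ex; exists l|exact: cvg_lim H].
Unshelve. all: by end_near. Qed.

Lemma continuous_bounded_cyl (f : R * R * R -> R) (u w : R) : u <= w ->
  {within cyl3 T delta, continuous f} ->
  exists2 M : R, 0 <= M & forall t r phi, 0 <= t <= T -> delta <= r <= 1 -> u <= phi <= w ->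
    `|f (t, r, phi)| <= M.
Proof.
move=> uw cf; pose K : set (R * R * R) := (`[0, T] `*` `[delta, 1]) `*` `[u, w].
have cK : compact K by do !apply: compact_setX; exact: segment_compact.
have KT : K `<=` cyl3 T delta by move=> [[t r] p] [/= h _]; split.
have : compact (f @` K) by apply: continuous_compact => //; exact: continuous_subspaceW KT cf.
move/compact_bounded => [M [Mr hM]]; exists (`|M| + 1); first by rewrite addr_ge0.
move=> t r phi ht hr hp; apply: hM; first by rewrite (le_lt_trans (ler_norm _))// ltrDl.
by exists (t, r, phi) => //; do !split; rewrite /= in_itv.
Qed.

Lemma smooth_radial_lipschitz (f : R * R * R -> R) : smooth_on (cyl3 T delta) f ->
  exists2 L : R, 0 <= L & forall t r s phi, 0 <= t <= T -> delta <= r <= 1 -> delta <= s <= 1 ->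
    0 <= phi <= 2 * pi -> `|f (t, r, phi) - f (t, s, phi)| <= L * `|r - s|.
Proof.
move=> /(_ 1%N) [cf /(_ (0, 1, 0)) [g hg [cg _]]].
have [L L0 hL] := continuous_bounded_cyl (ltW (@pi2_gt0 R)) cg.
exists L => // t r s phi ht hr hs hp.
wlog sr : r s hr hs / s <= r => [H|].
  by case/orP: (le_total s r) => ?; [|rewrite distrC (distrC r)]; exact: H.
rewrite (ger0_norm (x := r - s)) ?subr_ge0//.
have inC x : s <= x <= r -> cyl3 T delta (t + x * 0, 0 + x * 1, phi + x * 0).
  move=> /andP[x1 x2]; rewrite !mulr0 !addr0 add0r mulr1; split => //; split; rewrite /= in_itv//=.
  by rewrite (le_trans (andP hs).1 x1) (le_trans x2 (andP hr).2).
have E : (fun x => f (t, x, phi)) = (fun x => f (t + x * 0, 0 + x * 1, phi + x * 0)).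
  by apply/funext => x; rewrite !mulr0 !addr0 add0r mulr1.
apply: (MVT_bound (f := fun x => f (t, x, phi)) (df := fun x => g (t, x, phi)) sr).
- move=> x /andP[x1 x2]; rewrite E.
  pose e := Num.min (x - s) (r - x).
  apply: (@is_derive_in_line (cyl3 T delta) f (t, 0, phi) (0, 1, 0) x _ e) => /=.
  + by rewrite lt_min !subr_gt0 x1 x2.
  + move=> h; rewrite lt_min !ltr_norml opprB => /andP[/andP[h1 _] /andP[_ h2]].
    apply: inC; apply/andP; split; first by rewrite -lerBlDl ltW.
    by rewrite -lerBrDl ltW.
  + have := hg (t, x, phi) ltac:(by have := inC x; rewrite !mulr0 !addr0 add0r mulr1; apply; rewrite !ltW).
    by rewrite !mulr0 !addr0 add0r mulr1.
- rewrite E; exact: (within_slice_continuous (a := (t, 0, phi)) (v := (0, 1, 0)) cf inC).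
- move=> x /andP[x1 x2]; apply: hL => //.
  by rewrite (le_trans (andP hs).1 (ltW x1)) (le_trans (ltW x2) (andP hr).2).
Qed.

Lemma smooth_angular_sdiff (f : R * R * R -> R) : smooth_on (cyl3 T delta) f ->
  (forall t r, 0 <= t <= T -> delta <= r <= 1 -> periodic2pi (fun phi => f (t, r, phi))) ->
  exists2 L : R, 0 <= L & forall t r h phi, 0 <= t <= T -> delta <= r <= 1 -> 0 <= h ->
    `|sdiff h (fun phi => f (t, r, phi)) phi| <= L * h ^+ 2.
Proof.
move=> /(_ 2%N) [cf /(_ (0, 0, 1)) [g hg [cg /(_ (0, 0, 1)) [g2 hg2 [cg2 _]]]]] pf.
have [L L0 hL] := continuous_bounded_cyl (ltW (@pi2_gt0 R)) cg2.
have line k k' : (forall z, cyl3 T delta z -> is_derive_in (cyl3 T delta) k (0, 0, 1) z (k' z)) ->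
    forall t r phi : R, 0 <= t <= T -> delta <= r <= 1 -> is_derive phi 1 (fun phi => k (t, r, phi)) (k' (t, r, phi)).
  move=> hk t r phi ht hr.
  have -> : (fun x => k (t, r, x)) = (fun x => k (t + x * 0, r + x * 0, 0 + x * 1)).
    by apply/funext => x; rewrite !mulr0 !addr0 add0r mulr1.
  have inC x : cyl3 T delta (t + x * 0, r + x * 0, 0 + x * 1).
    by rewrite !mulr0 !addr0; do !split; rewrite /= in_itv.
  apply: (@is_derive_in_line (cyl3 T delta) k (t, r, 0) (0, 0, 1) phi _ 1) => //=.
  by have := hk _ (inC phi); rewrite !mulr0 !addr0 add0r mulr1.
(* Derivatives inherit periodicity, so a bound over one period, obtained by compactness, is a bound
   for all [phi]. *)
have per k k' : (forall z, cyl3 T delta z -> is_derive_in (cyl3 T delta) k (0, 0, 1) z (k' z)) ->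
    (forall t r, 0 <= t <= T -> delta <= r <= 1 -> periodic2pi (fun phi => k (t, r, phi))) ->
    forall t r, 0 <= t <= T -> delta <= r <= 1 -> periodic2pi (fun phi => k' (t, r, phi)).
  move=> hk pk t r ht hr phi.
  have h1 := is_derive_translate (k := 2 * pi) (line k k' hk t r (phi + 2 * pi) ht hr).
  have h2 := line k k' hk t r phi ht hr.
  have E : (fun y => k (t, r, y + 2 * pi)) = (fun y => k (t, r, y)).
    by apply/funext => y; exact: (pk t r ht hr y).
  by rewrite E in h1; rewrite -(is_derive_derive1 h1) -(is_derive_derive1 h2).
have p2 := per _ _ hg2 (per _ _ hg pf).
exists L => // t r h phi ht hr h0.
apply: (sdiff_bound h0 (f1 := fun phi => g (t, r, phi)) (f2 := fun phi => g2 (t, r, phi))).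
- by move=> x; exact: line.
- by move=> x; exact: line.
- move=> x; have [y hy pp] := periodic_representative x.
  by rewrite (pp (fun phi => g2 (t, r, phi))); [exact: hL|exact: p2].
Qed.

End data_regularity.

(** * Stability at a frozen radius *)

Section stability.
Context {R : realType}.
Variables (T delta : R) (T0 : 0 < T) (d0 : 0 < delta) (d1 : delta < 1).
Variables (a : R -> R) (b : R -> R -> R) (f1 : R -> R -> R) (f2 : R -> R -> R -> R)
  (uphi0 : R -> R -> R) (ux0 : R -> R -> R -> R).
Hypothesis hu0 : euler_solution T delta a b f1 f2 uphi0 ux0.

Record data_bounds (M H K : R) : Prop := {
  db_M0 : 0 <= M ; db_H0 : 0 <= H ; db_K0 : 0 < K ;
  db_uphi : forall t r, 0 <= t <= T -> delta <= r <= 1 -> `|uphi0 t r| <= M ;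
  db_ux : forall t r phi, 0 <= t <= T -> delta <= r <= 1 -> `|ux0 t r phi| <= M ;
  db_a : forall r s, delta <= r <= 1 -> delta < s < 1 -> `|a r - a s| <= H * Num.sqrt `|r - s| ;
  db_b : forall r s phi, delta <= r <= 1 -> delta < s < 1 ->
    `|b r phi - b s phi| <= H * Num.sqrt `|r - s| ;
  db_f1 : forall t r s, 0 <= t <= T -> delta <= r <= 1 -> delta < s < 1 ->
    `|f1 t r - f1 t s| <= H * Num.sqrt `|r - s| ;
  db_f2 : forall t r s phi, 0 <= t <= T -> delta <= r <= 1 -> delta < s < 1 ->
    `|f2 t r phi - f2 t s phi| <= H * Num.sqrt `|r - s| ;
  db_b2 : forall h s phi, 0 < h -> h <= 1 -> delta < s < 1 -> `|sdiff h (b s) phi| <= K * h ^+ 2 ;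
  db_f22 : forall t h s phi, 0 <= t <= T -> 0 < h -> h <= 1 -> delta < s < 1 ->
    `|sdiff h (f2 t s) phi| <= K * h ^+ 2 }.

(** With [z] the square root, [(r - s)^2 = z^4]: either [z <= q], or [z <= z^4 / q^3]. *)
Lemma sqrt_le_barrier q n s r : 0 < q -> 0 <= n -> Num.sqrt `|r - s| <= barrier delta q n s r.
Proof.
move=> q0 n0; have [_ [b1 [_ b2]]] := barrier_ge delta s r q0 n0.
set z := Num.sqrt `|r - s|; have z0 : 0 <= z by exact: sqrtr_ge0.
have zz : z ^+ 4 = (r - s) ^+ 2.
  by rewrite (exprM z 2 2) sqr_sqrtr// real_normK ?num_real.
have [zq|qz] := leP z q; first exact: le_trans b1.
apply: le_trans b2; rewrite -zz ler_pdivlMr ?exprn_gt0// [z ^+ 4]exprS.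
by rewrite ler_wpM2l// lerXn2r// ?nnegrE// ltW.
Qed.

Lemma dist_le_sqrt (r s : R) : delta <= r <= 1 -> delta <= s <= 1 -> `|r - s| <= Num.sqrt `|r - s|.
Proof.
have d0' := d0; move=> /andP[r1 r2] /andP[s1 s2].
rewrite -{1}(sqr_sqrtr (normr_ge0 (r - s))) expr2 ler_piMr ?sqrtr_ge0//.
by rewrite -sqrtr1 ler_wsqrtr// ler_norml; apply/andP; split; lra.
Qed.

Lemma continuous_insert_radius : forall s : R, continuous (fun z : R * R => ((z.1, s), z.2)).
Proof.
move=> s z; apply: (@continuous_pair (R * R)%type (R * R)%type R (fun z => (z.1, s)) snd); last exact: cvg_snd.
by apply: (@continuous_pair (R * R)%type R R fst (fun=> s)); [exact: cvg_fst|exact: cvg_cst].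
Qed.

Lemma sdiff_scale (sg h : R) (f : R -> R) x : sdiff h (fun y => sg * f y) x = sg * sdiff h f x.
Proof. by rewrite /sdiff; ring. Qed.

(* Second angular differences of the inviscid flow solve the same transport equation. *)
Lemma euler_semiconcave M H K sg s : data_bounds M H K -> `|sg| = 1 -> delta < s < 1 ->
  forall t h phi, 0 <= t < T -> 0 < h -> h <= 1 ->
    sdiff h (fun phi => sg * ux0 t s phi) phi <= (K + 2 * K * T) * h ^+ 2.
Proof.
move=> db sg1 hs t h phi ht h0 h1.
have K0 := db_K0 db; have hs' : delta <= s <= 1 by case/andP: hs => *; rewrite !ltW.
pose D (t phi : R) := sdiff h (fun phi => sg * ux0 t s phi) phi.
have absle (x y : R) : `|x| <= y -> sg * x <= y.
  by move=> xy; apply: le_trans (ler_norm _) _; rewrite normrM sg1 mul1r.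
have h2 : 0 < h ^+ 2 by rewrite exprn_gt0.
have pu t' : 0 <= t' <= T -> periodic2pi (ux0 t' s) by move=> ht'; exact: (euler_x_periodic hu0 ht' hs').
have cu : {within `[0, T] `*` setT, continuous (fun z : R * R => ux0 z.1 s z.2)}.
  apply: (@within_continuous_comp_in R (R * R)%type (R * R * R)%type (`[0, T] `*` setT) (cyl3 T delta)
    (fun z => ux0 z.1.1 z.1.2 z.2) (fun z => ((z.1, s), z.2)) (euler_x_cont hu0)).
    by apply: continuous_subspaceT; exact: continuous_insert_radius.
  by move=> z [/= z1 _]; do !split => //=; rewrite in_itv.
have cush (c : R) : {within `[0, T] `*` setT, continuous (fun z : R * R => ux0 z.1 s (z.2 + c))}.
  apply: (@within_continuous_comp_in R (R * R)%type (R * R)%type (`[0, T] `*` setT) (`[0, T] `*` setT)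
    (fun z => ux0 z.1 s z.2) (fun z => (z.1, z.2 + c)) cu).
    apply: continuous_subspaceT => z.
    apply: (@continuous_pair (R * R)%type R R fst (fun z => z.2 + c)); first exact: cvg_fst.
    by apply: cvgD; [exact: cvg_snd|exact: cvg_cst].
  by move=> z [/= z1 _]; split.
have cD : {within `[0, T] `*` setT, continuous (fun z : R * R => D z.1 z.2)}.
  have -> : (fun z : R * R => D z.1 z.2) = (fun z : R * R =>
      sg * (1 * ux0 z.1 s (z.2 + h) + 1 * ux0 z.1 s (z.2 + - h)) + - (2 * sg) * ux0 z.1 s z.2).
    by apply/funext => z; rewrite /D /sdiff; ring.
  exact: within_lin (within_lin (cush h) (cush (- h))) cu.
have pD t' : 0 <= t' <= T -> periodic2pi (D t').
  move=> ht' x; have p y : ux0 t' s (y + 2 * pi) = ux0 t' s y := pu t' ht' y.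
  by rewrite /D /sdiff ![x + 2 * pi + _]addrAC !p.
have dux t' x : 0 < t' < T -> is_derive t' 1 (fun t => ux0 t s x)
    (f2 t' s x - uphi0 t' s / s * derive1 (ux0 t' s) x).
  move=> ht'; have := derivable_is_derive (euler_x_dt hu0 (phi := x) ht' hs).
  by move/is_derive_to; apply; rewrite -(euler_x_eq hu0 x ht' hs) addrK.
have dDt t' x : 0 < t' < T -> is_derive t' 1 (fun t => D t x)
    (sg * sdiff h (f2 t' s) x - uphi0 t' s / s * (sg * sdiff h (derive1 (ux0 t' s)) x)).
  move=> ht'; have := is_derive_lin sg (- (2 * sg)) (is_derive_lin 1 1 (dux t' (x + h) ht') (dux t' (x - h) ht')) (dux t' x ht').
  set k := (fun y => _); have -> : k = (fun t => D t x).
    by apply/funext => y; rewrite /k /D /sdiff; ring.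
  by move/is_derive_to; apply; rewrite /sdiff; ring.
have dDp t' (x : R) : 0 < t' < T -> is_derive x 1 (D t') (sg * sdiff h (derive1 (ux0 t' s)) x).
  move=> ht'; have du (y : R) : is_derive y 1 (ux0 t' s) (derive1 (ux0 t' s) y).
    exact: derivable_is_derive (euler_x_dphi hu0 (phi := y) ht' hs).
  have := is_derive_lin sg 0 (is_derive_sdiff h du x) (is_derive_sdiff h du x).
  set k := (fun y => _); have -> : k = D t'.
    by apply/funext => y; rewrite /k /D /sdiff; ring.
  by move/is_derive_to; apply; ring.
(* The second difference of the forcing is at most [K * h^2]; doubling this, with [K > 0], yields
   the strict inequality asked for by [transport_max] and is the origin of [2 * K * T]. *)
have := @transport_max _ T (K * h ^+ 2) (2 * (K * h ^+ 2)) D cD pD.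
have Kh : 0 < K * h ^+ 2 by rewrite mulr_gt0.
move=> /(_ _ _ _ _ t phi ht) L.
apply: (@le_trans _ _ (K * h ^+ 2 + 2 * (K * h ^+ 2) * t)).
  apply: L; first by rewrite mulr_ge0// ltW.
  - move=> x; rewrite /D sdiff_scale; apply: absle.
    have -> : ux0 0 s = b s by apply/funext => y; exact: (euler_x_init hu0 y hs').
    exact: (db_b2 db).
  - by move=> t' x ht'; exact: (@ex_derive _ _ _ _ _ _ _ (dDt t' x ht')).
  - move=> t' x ht' mx; rewrite (is_derive_derive1 (dDt t' x ht')).
    have dd y : derivable (D t') y 1 by exact: (@ex_derive _ _ _ _ _ _ _ (dDp t' y ht')).
    have := @derive1_at_max0 _ (D t') x 1 ltr01 (fun y _ => dd y) (fun y _ => mx y).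
    rewrite (is_derive_derive1 (dDp t' x ht')) => ->; rewrite mulr0 subr0.
    have ht'' : 0 <= t' <= T by case/andP: ht' => *; rewrite !ltW.
    apply: (@le_lt_trans _ _ (K * h ^+ 2)); last by rewrite mulr_natl mulr2n ltrDl.
    by apply: absle; exact: (db_f22 db).
have -> : (K + 2 * K * T) * h ^+ 2 = K * h ^+ 2 + 2 * (K * h ^+ 2) * T by ring.
rewrite lerD2l; apply: ler_wpM2l; [by rewrite mulr_ge0// ltW|exact: ltW (andP ht).2].
Qed.

Lemma euler_derive_bound M H K s t phi : data_bounds M H K -> delta < s < 1 -> 0 < t < T ->
  `|derive1 (ux0 t s) phi| <= 2 * M + (K + 2 * K * T).
Proof.
move=> db hs ht; have K0 := db_K0 db.
have hs' : delta <= s <= 1 by case/andP: hs => *; rewrite !ltW.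
have ht' : 0 <= t < T by case/andP: ht => /ltW -> ->.
have ht2 : 0 <= t <= T by case/andP: ht => *; rewrite !ltW.
apply: semiconcave_derive_bound.
- by rewrite addr_ge0 ?mulr_ge0// ltW.
- exact: (euler_x_dphi hu0 (phi := phi) ht hs).
- move=> h x h0 h1; have := euler_semiconcave db (normr1 R) hs x ht' h0 h1.
  by rewrite sdiff_scale mul1r.
- by move=> x; exact: (db_ux db).
Qed.

Lemma twice_derivable_scale (D : set R) (g : R -> R) (sg c : R) : open D -> twice_derivable D g ->
  forall r, D r -> [/\ derivable (fun r => sg * (g r - c)) r 1,
    derivable (derive1 (fun r => sg * (g r - c))) r 1,
    derive1 (fun r => sg * (g r - c)) r = sg * derive1 g r &
    derive1 (derive1 (fun r => sg * (g r - c))) r = sg * derive1 (derive1 g) r].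
Proof.
move=> oD hg; set v := fun r => _.
have h1 r : D r -> is_derive r 1 v (sg * derive1 g r).
  move=> Dr; have [dg _] := hg r Dr.
  have := is_derive_add (is_derive_mul (is_derive_cst sg r 1) (derivable_is_derive dg)) (is_derive_cst (- (sg * c)) r 1).
  set k := (fun y => _); have -> : k = v by apply/funext => y; rewrite /k /v /cst; ring.
  by move/is_derive_to; apply; rewrite /cst; ring.
move=> r Dr; have [_ dg] := hg r Dr.
have h2 : is_derive r 1 (derive1 v) (sg * derive1 (derive1 g) r).
  have H : is_derive r 1 (fun y => sg * derive1 g y) (sg * derive1 (derive1 g) r).
    have := is_derive_mul (is_derive_cst sg r 1) (derivable_is_derive dg).
    by move/is_derive_to; apply; rewrite /cst; ring.
  apply: near_eq_is_derive H; have := open_nbhs_nbhs (conj oD Dr).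
  by apply: filterS => y Dy; rewrite (is_derive_derive1 (h1 y Dy)).
split; first exact: (@ex_derive _ _ _ _ _ _ _ (h1 r Dr)).
- exact: (@ex_derive _ _ _ _ _ _ _ h2).
- exact: is_derive_derive1 (h1 r Dr).
- exact: is_derive_derive1 h2.
Qed.

Lemma radial_laplacian (g : R -> R) (r : R) : r != 0 -> derivable (derive1 g) r 1 ->
  r^-1 * derive1 (fun s => s * derive1 g s) r = derive1 (derive1 g) r + r^-1 * derive1 g r.
Proof.
move=> r0 dg; have := is_derive_mul (is_derive_id r 1) (derivable_is_derive dg).
by move/is_derive_derive1 => ->; field.
Qed.

Lemma invr_sqr_le (x : R) : delta <= x -> x ^- 2 <= delta ^- 2.
Proof.
move=> dx; have x0 : 0 < x by exact: lt_le_trans dx.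
by rewrite lef_pV2 ?posrE ?exprn_gt0// lerXn2r// nnegrE ltW.
Qed.

(** Where the signed difference is positive, the zero-order term [nu2 * u / r^2] can push it up only
    by the size of the inviscid flow; no a priori bound on the viscous flow is required. *)
Lemma signed_lower_bound (sg M x y : R) : `|sg| = 1 -> `|y| <= M -> 0 < sg * (x - y) -> - (sg * x) <= M.
Proof.
move=> sg1 yM; rewrite mulrBr subr_gt0 => xy.
have : `|sg * y| <= M by rewrite normrM sg1 mul1r.
by rewrite ler_norml => /andP[h _]; lra.
Qed.

(** At a maximum of [sg * (u - w)] the second differences of [sg * u] lie below those of [sg * w],
    so [u] inherits the semiconcavity of [w] at that point. *)
Lemma second_derivative_at_max (sg K x : R) (u w : R -> R) : twice_derivable setT u ->
  (forall y, sg * (u y - w y) <= sg * (u x - w x)) ->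
  (forall h, 0 < h -> h <= 1 -> sdiff h (fun y => sg * w y) x <= K * h ^+ 2) ->
  sg * derive1 (derive1 u) x <= K.
Proof.
move=> du umax hw; have k y := twice_derivable_scale sg 0 (@openT R) du (r := y) I.
have [_ k2 _ <-] := k x; apply: (second_derivative_le ltr01 _ k2) => [y _|h h0 h1].
  by have [] := k y.
have := umax (x + h); have := umax (x - h); have := hw h h0 (ltW h1).
by rewrite /sdiff !subr0 !mulrBr; lra.
Qed.

Lemma open_interior : open (`]delta, 1[%classic : set R).
Proof. exact: itv_open. Qed.

Variables (nu1 nu2 q : R) (uphi : R -> R -> R) (ux : R -> R -> R -> R).
Hypotheses (q0 : 0 < q) (q1 : q <= 1) (qnu : q ^+ 4 = nu1) (n0 : 0 < nu2).
Hypothesis hv : viscous_solution T delta nu1 nu2 a b f1 f2 uphi ux.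

(** [1 + H + M] meets the three demands on [A] in [comparison]: at least 1, the initial Hoelder
    constant, and the mismatch at the walls. In the rate, [H] comes from the forcing and
    [M / delta^2] from the zero-order term. *)
Lemma phi_stability M H K s t r : data_bounds M H K -> delta < s < 1 ->
  0 <= t < T -> delta <= r <= 1 ->
  `|uphi t r - uphi0 t s| <=
    (1 + H + M) * expR ((3 + 2 / delta + (H + M / delta ^+ 2)) * T) * barrier delta q nu2 s r.
Proof.
move=> db hs ht hr; have M0 := db_M0 db; have H0 := db_H0 db.
have hs' : delta <= s <= 1 by case/andP: hs => *; rewrite !ltW.
have d2 : 0 < delta ^- 2 by rewrite invr_gt0 exprn_gt0.
have dd : 0 < 2 / delta by rewrite divr_gt0.
have Md : 0 <= M / delta ^+ 2 by rewrite mulr_ge0// ltW.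
have sb r' := sqrt_le_barrier s r' q0 (ltW n0).
have b0 r' : 0 <= barrier delta q nu2 s r' by apply: le_trans (sb r'); exact: sqrtr_ge0.
suff main sg : `|sg| = 1 -> sg * (uphi t r - uphi0 t s) <=
    (1 + H + M) * expR ((3 + 2 / delta + (H + M / delta ^+ 2)) * T) * barrier delta q nu2 s r.
  rewrite ler_norml lerNl -mulN1r -{2}[uphi t r - _]mul1r.
  by rewrite !main// ?normrN1// normr1.
move=> sg1.
have sgle (x y : R) : `|x| <= y -> sg * x <= y.
  by move=> xy; apply: le_trans (ler_norm _) _; rewrite normrM sg1 mul1r.
(* The idle variable [phi] lets the angular component go through the same comparison as the axial
   one. *)
pose v (t r phi : R) := sg * (uphi t r - uphi0 t s).
apply: (@le_trans _ _ ((1 + H + M) * expR ((3 + 2 / delta + (H + M / delta ^+ 2)) * t) * barrier delta q nu2 s r)); last first.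
  rewrite ler_wpM2r// ler_wpM2l ?addr_ge0// ler_expR ler_wpM2l ?(ltW (andP ht).2)//.
  by rewrite !addr_ge0// ltW.
apply: (comparison d0 d1 (v := v) q0 q1 (ltW n0) hs' _ _ _ _ _ _ _ _ _ 0 ht hr).
- by rewrite -addrA lerDl addr_ge0.
- by rewrite addr_ge0.
- have c1 : {within cyl3 T delta, continuous (fun z : R * R * R => uphi z.1.1 z.1.2)}.
    apply: (@within_continuous_comp_in R (R * R * R)%type (R * R)%type (cyl3 T delta) (cyl2 T delta) (fun z => uphi z.1 z.2) fst (visc_phi_cont hv)).
      by apply: continuous_subspaceT => z; exact: cvg_fst.
    by move=> z [].
  have c2 : {within cyl3 T delta, continuous (fun z : R * R * R => uphi0 z.1.1 s)}.
    apply: (@within_continuous_comp_in R (R * R * R)%type (R * R)%type (cyl3 T delta) (cyl2 T delta) (fun z => uphi0 z.1 z.2) (fun z => (z.1.1, s)) (euler_phi_cont hu0)).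
      apply: continuous_subspaceT => z.
      apply: (@continuous_pair (R * R * R)%type R R (fun z => z.1.1) (fun=> s)); last exact: cvg_cst.
      by apply: (continuous_comp (f := fst) (g := fst)); exact: cvg_fst.
    by move=> z [[/= z1 _] _]; split => //=; rewrite in_itv.
  have -> : (fun z : R * R * R => v z.1.1 z.1.2 z.2) = (fun z : R * R * R => sg * uphi z.1.1 z.1.2 + - sg * uphi0 z.1.1 s).
    by apply/funext => z; rewrite /v; ring.
  exact: within_lin c1 c2.
- by [].
- move=> r' phi hr'; rewrite /v (visc_phi_init hv hr') (euler_phi_init hu0 hs').
  apply: le_trans (sgle _ _ (db_a db hr' hs)) _.
  by apply: ler_pM => //; lra.
- move=> t' phi ht'; rewrite /v; have [-> ->] := visc_phi_bdry hv ht'.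
  by split; apply: sgle; rewrite sub0r normrN (le_trans (db_uphi db ht' hs'))//; lra.
- move=> t' r' phi ht' hr'.
  have := is_derive_add (derivable_is_derive (visc_phi_dt hv ht' hr')) (is_derive_opp (derivable_is_derive (euler_phi_dt hu0 ht' hs))).
  by move/(is_derive_mul (is_derive_cst sg t' 1)) => h; exact: (@ex_derive _ _ _ _ _ _ _ h).
- move=> t' phi ht' r' hr'.
  have [k1 k2 _ _] := twice_derivable_scale sg (uphi0 t' s) open_interior (visc_phi_dr hv ht') hr'.
  exact: (conj k1 k2).
- move=> t' r' phi ht' hr' vpos _.
  have r'0 : 0 < r' by case/andP: hr' => h _; exact: lt_trans h.
  have [h1 h2 h3 h4] := twice_derivable_scale sg (uphi0 t' s) open_interior (visc_phi_dr hv ht') (r := r') ltac:(by rewrite /= in_itv).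
  rewrite /v h3 h4.
  have dt := is_derive_mul (is_derive_cst sg t' 1) (is_derive_add (derivable_is_derive (visc_phi_dt hv ht' hr')) (is_derive_opp (derivable_is_derive (euler_phi_dt hu0 ht' hs)))).
  rewrite (is_derive_derive1 dt) (euler_phi_eq hu0 ht' hs) mul0r add0r /cst.
  have [_ ddr] : derivable (uphi t') r' 1 /\ derivable (derive1 (uphi t')) r' 1.
    by apply: (visc_phi_dr hv ht'); rewrite /= in_itv.
  have := visc_phi_eq hv ht' hr'; rewrite (radial_laplacian _ ddr) ?gt_eqF// => E.
  have -> : derive1 (uphi^~ r') t' = f1 t' r' + nu1 * (derive1 (derive1 (uphi t')) r' + r'^-1 * derive1 (uphi t') r') - nu2 * (r' ^- 2 * uphi t' r').
    by rewrite -E; ring.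
  rewrite qnu; set L1 := derive1 (derive1 _) _; set L2 := derive1 _ _.
  have -> : sg * (f1 t' r' + nu1 * (L1 + r'^-1 * L2) - nu2 * (r' ^- 2 * uphi t' r') - f1 t' s)
     - nu1 * (sg * L1 + r'^-1 * (sg * L2)) = sg * (f1 t' r' - f1 t' s) + nu2 * (r' ^- 2 * (- (sg * uphi t' r'))) by ring.
  have ht2 : 0 <= t' <= T by case/andP: ht' => *; rewrite !ltW.
  have hr2 : delta <= r' <= 1 by case/andP: hr' => *; rewrite !ltW.
  rewrite mulrDl; apply: lerD.
    apply: le_trans (sgle _ _ (db_f1 db ht2 hr2 hs)) _; exact: ler_wpM2l.
  have [_ [_ [nb _]]] := barrier_ge delta s r' q0 (ltW n0).
  rewrite [leRHS]mulrC; apply: le_trans (ler_wpM2r Md nb).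
  rewrite ler_wpM2l ?(ltW n0)// mulrC.
  have uM : - (sg * uphi t' r') <= M.
    exact: (signed_lower_bound sg1 (db_uphi db ht2 hs') vpos).
  apply: (@le_trans _ _ (M * r' ^- 2)); first by rewrite ler_wpM2r// invr_ge0 exprn_ge0// ltW.
  by apply: ler_wpM2l => //; exact: invr_sqr_le (andP hr2).1.
Qed.

(** In the rate, [H] comes from the forcing, [2 * M + K2] bounds the inviscid angular derivative,
    the factor beside it bounds the difference of angular speeds in units of the barrier, and
    [K2 / delta^2] bounds angular diffusion, from above only. *)
Lemma x_stability M H K K2 C2 s t r phi : data_bounds M H K -> K2 = K + 2 * K * T -> delta < s < 1 -> 0 <= C2 ->
  (forall t r, 0 <= t < T -> delta <= r <= 1 ->
    `|uphi t r - uphi0 t s| <= C2 * barrier delta q nu2 s r) ->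
  0 <= t < T -> delta <= r <= 1 ->
  `|ux t r phi - ux0 t s phi| <=
    (1 + H + M) * expR ((3 + 2 / delta + (H + (2 * M + K2) * (C2 / delta + M / delta ^+ 2) + K2 / delta ^+ 2)) * T)
     * barrier delta q nu2 s r.
Proof.
move=> db EK hs C20 hC2 ht hr; have M0 := db_M0 db; have H0 := db_H0 db; have K0 := db_K0 db.
have hs' : delta <= s <= 1 by case/andP: hs => *; rewrite !ltW.
have d2 : 0 < delta ^- 2 by rewrite invr_gt0 exprn_gt0.
have dd : 0 < 2 / delta by rewrite divr_gt0.
have Md : 0 <= M / delta ^+ 2 by rewrite mulr_ge0// ltW.
have Cd : 0 <= C2 / delta by rewrite divr_ge0// ltW.
have K20 : 0 <= K2 by rewrite EK addr_ge0 ?mulr_ge0// ltW.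
have Kd : 0 <= K2 / delta ^+ 2 by rewrite mulr_ge0// ltW.
have sb r' := sqrt_le_barrier s r' q0 (ltW n0).
have b0 r' : 0 <= barrier delta q nu2 s r' by apply: le_trans (sb r'); exact: sqrtr_ge0.
set C := H + _ + _.
have PC : 0 <= (2 * M + K2) * (C2 / delta + M / delta ^+ 2) by rewrite mulr_ge0// addr_ge0// mulr_ge0.
have C0 : 0 <= C by rewrite /C !addr_ge0.
suff main sg : `|sg| = 1 -> sg * (ux t r phi - ux0 t s phi) <=
    (1 + H + M) * expR ((3 + 2 / delta + C) * T) * barrier delta q nu2 s r.
  rewrite ler_norml lerNl -mulN1r -{2}[ux t r phi - _]mul1r.
  by rewrite !main// ?normrN1// normr1.
move=> sg1.
have sgle (x y : R) : `|x| <= y -> sg * x <= y.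
  by move=> xy; apply: le_trans (ler_norm _) _; rewrite normrM sg1 mul1r.
pose v (t r phi : R) := sg * (ux t r phi - ux0 t s phi).
apply: (@le_trans _ _ ((1 + H + M) * expR ((3 + 2 / delta + C) * t) * barrier delta q nu2 s r)); last first.
  rewrite ler_wpM2r// ler_wpM2l ?addr_ge0// ler_expR ler_wpM2l ?(ltW (andP ht).2)//.
  by rewrite !addr_ge0// ltW.
apply: (comparison d0 d1 (v := v) q0 q1 (ltW n0) hs' _ _ _ _ _ _ _ _ _ phi ht hr).
- by rewrite -addrA lerDl addr_ge0.
- by [].
- have c2 : {within cyl3 T delta, continuous (fun z : R * R * R => ux0 z.1.1 s z.2)}.
    apply: (@within_continuous_comp_in R (R * R * R)%type (R * R * R)%type (cyl3 T delta) (cyl3 T delta) (fun z => ux0 z.1.1 z.1.2 z.2) (fun z => ((z.1.1, s), z.2)) (euler_x_cont hu0)).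
      apply: continuous_subspaceT => z.
      apply: (@continuous_pair (R * R * R)%type (R * R)%type R (fun z => (z.1.1, s)) snd); last exact: cvg_snd.
      apply: (@continuous_pair (R * R * R)%type R R (fun z => z.1.1) (fun=> s)); last exact: cvg_cst.
      by apply: (continuous_comp (f := fst) (g := fst)); exact: cvg_fst.
    by move=> z [[/= z1 _] _]; do !split => //=; rewrite in_itv.
  have -> : (fun z : R * R * R => v z.1.1 z.1.2 z.2) = (fun z : R * R * R => sg * ux z.1.1 z.1.2 z.2 + - sg * ux0 z.1.1 s z.2).
    by apply/funext => z; rewrite /v; ring.
  exact: within_lin (visc_x_cont hv) c2.
- by move=> t' r' ht' hr' x; rewrite /v (visc_x_periodic hv ht' hr') (euler_x_periodic hu0 ht' hs').
- move=> r' phi' hr'; rewrite /v (visc_x_init hv phi' hr') (euler_x_init hu0 phi' hs').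
  apply: le_trans (sgle _ _ (db_b db phi' hr' hs)) _.
  by apply: ler_pM => //; lra.
- move=> t' phi' ht'; rewrite /v; have [-> ->] := visc_x_bdry hv phi' ht'.
  by split; apply: sgle; rewrite sub0r normrN (le_trans (db_ux db phi' ht' hs'))//; lra.
- move=> t' r' phi' ht' hr'.
  have := is_derive_add (derivable_is_derive (visc_x_dt hv (phi := phi') ht' hr')) (is_derive_opp (derivable_is_derive (euler_x_dt hu0 (phi := phi') ht' hs))).
  by move/(is_derive_mul (is_derive_cst sg t' 1)) => h; exact: (@ex_derive _ _ _ _ _ _ _ h).
- move=> t' phi' ht' r' hr'.
  have [k1 k2 _ _] := twice_derivable_scale sg (ux0 t' s phi') open_interior (visc_x_dr hv phi' ht') hr'.
  exact: (conj k1 k2).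
- move=> t' r' phi' ht' hr' vpos vmax.
  have r'0 : 0 < r' by case/andP: hr' => h _; exact: lt_trans h.
  have s0 : 0 < s by case/andP: hs => h _; exact: lt_trans h.
  have ht1 : 0 <= t' < T by case/andP: ht' => /ltW -> ->.
  have ht2 : 0 <= t' <= T by case/andP: ht' => *; rewrite !ltW.
  have hr2 : delta <= r' <= 1 by case/andP: hr' => *; rewrite !ltW.
  have Ir' : `]delta, 1[%classic r' by rewrite /= in_itv.
  have [h1 h2 h3 h4] := twice_derivable_scale sg (ux0 t' s phi') open_interior (visc_x_dr hv phi' ht') Ir'.
  rewrite /v h3 h4.
  have dt := is_derive_mul (is_derive_cst sg t' 1) (is_derive_add (derivable_is_derive (visc_x_dt hv (phi := phi') ht' hr')) (is_derive_opp (derivable_is_derive (euler_x_dt hu0 (phi := phi') ht' hs)))).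
  rewrite (is_derive_derive1 dt) mul0r add0r /cst.
  have [_ ddr] := visc_x_dr hv phi' ht' Ir'.
  have := visc_x_eq hv phi' ht' hr'; rewrite (radial_laplacian _ ddr) ?gt_eqF// => E.
  have E0 := euler_x_eq hu0 phi' ht' hs.
  have [dpp dpp2] := visc_x_dphi hv ht' hr' (s := phi') I.
  have dv (y : R) : is_derive y 1 (v t' r') (sg * (derive1 (ux t' r') y - derive1 (ux0 t' s) y)).
    have [dy _] := visc_x_dphi hv ht' hr' (s := y) I.
    have := is_derive_mul (is_derive_cst sg y 1) (is_derive_add (derivable_is_derive dy) (is_derive_opp (derivable_is_derive (euler_x_dphi hu0 (phi := y) ht' hs)))).
    by move/is_derive_to; apply; rewrite /cst mul0r add0r.
  have sgn0 : sg != 0 by rewrite -normr_gt0 sg1.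
  have Ep : derive1 (ux t' r') phi' = derive1 (ux0 t' s) phi'.
    have := @derive1_at_max0 _ (v t' r') phi' 1 ltr01 (fun y _ => @ex_derive _ _ _ _ _ _ _ (dv y)) (fun y _ => vmax y).
    by rewrite (is_derive_derive1 (dv phi')) => /eqP; rewrite mulf_eq0 (negbTE sgn0)/= subr_eq0 => /eqP.
  rewrite Ep in E; set p := derive1 (ux0 t' s) phi' in E E0.
  have pP : `|p| <= 2 * M + K2 by rewrite EK; exact: (euler_derive_bound phi' db hs ht').
  have sKK : sg * derive1 (derive1 (ux t' r')) phi' <= K2.
    apply: second_derivative_at_max (visc_x_dphi hv ht' hr') vmax _ => h h0 hh1.
    by rewrite EK; exact: (euler_semiconcave db sg1 hs phi' ht1 h0 hh1).
  set L1 := derive1 (derive1 (fun r => ux t' r phi')) _ in E *; set L2 := derive1 (fun r => ux t' r phi') _ in E *.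
  set Dpp := derive1 (derive1 (ux t' r')) phi' in E sKK.
  rewrite qnu; set ut := derive1 _ t' in E *; set u0t := derive1 _ t' in E0 *.
  (* Both transport terms now carry the same derivative [p]; the speeds [uphi0 / s] and [uphi / r']
     differ by a difference of velocities and a difference of radii. *)
  have -> : sg * (ut - u0t) - nu1 * (sg * L1 + r'^-1 * (sg * L2)) =
      sg * (f2 t' r' phi' - f2 t' s phi') + sg * (p * ((uphi0 t' s - uphi t' r') / r' + uphi0 t' s * (s^-1 - r'^-1)))
       + nu2 * (r' ^- 2 * (sg * Dpp)).
    by rewrite -E -E0; ring.
  have [_ [_ [nb _]]] := barrier_ge delta s r' q0 (ltW n0).
  have ri : r'^-1 <= delta^-1 by rewrite lef_pV2 ?posrE//; case/andP: hr2.
  have si : s^-1 <= delta^-1 by rewrite lef_pV2 ?posrE//; case/andP: hs'.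
  have ri0 : 0 < r'^-1 by rewrite invr_gt0.
  have si0 : 0 < s^-1 by rewrite invr_gt0.
  rewrite /C 2!(mulrDl _ _ (barrier delta q nu2 s r')); apply: lerD; first apply: lerD.
  - apply: le_trans (sgle _ _ (db_f2 db phi' ht2 hr2 hs)) _; exact: ler_wpM2l.
  - rewrite -mulrA; apply: sgle; rewrite normrM; apply: ler_pM => //.
    rewrite (mulrDl _ _ (barrier delta q nu2 s r')); apply: le_trans (ler_normD _ _) _; apply: lerD.
      rewrite normrM distrC (gtr0_norm ri0) mulrAC; apply: ler_pM => //; [exact: ltW|exact: hC2].
    rewrite normrM -mulrA; apply: ler_pM => //; first exact: (db_uphi db).
    (* The difference of radii is linear in [r' - s], and on an interval of length below 1 this is
       at most the square root that the barrier dominates. *)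
    have -> : s^-1 - r'^-1 = (r' - s) * (r'^-1 * s^-1) by field; rewrite !gt_eqF.
    rewrite normrM (gtr0_norm (mulr_gt0 ri0 si0)) mulrC; apply: ler_pM => //.
    + by rewrite mulr_ge0// ltW.
    + by rewrite -exprVn expr2; apply: ler_pM => //; exact: ltW.
    + apply: le_trans (sb r').
      exact: dist_le_sqrt.
  - rewrite [leRHS]mulrC; apply: le_trans (ler_wpM2r Kd nb).
    rewrite ler_wpM2l ?(ltW n0)// [leRHS]mulrC.
    apply: (@le_trans _ _ (r' ^- 2 * K2)); first by rewrite ler_wpM2l// invr_ge0 exprn_ge0// ltW.
    by apply: ler_wpM2r => //; exact: invr_sqr_le (andP hr2).1.
Qed.

End stability.

(** * Quantitative bounds extracted from the hypotheses on the data *)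

Section data_bounds_exist.
Context {R : realType}.
Variables (T delta : R) (T0 : 0 < T) (d0 : 0 < delta) (d1 : delta < 1).
Variables (a : R -> R) (b : R -> R -> R) (f1 : R -> R -> R) (f2 : R -> R -> R -> R)
  (uphi0 : R -> R -> R) (ux0 : R -> R -> R -> R).
Hypothesis hu0 : euler_solution T delta a b f1 f2 uphi0 ux0.

Lemma within_bounded_cyl2 (u : R -> R -> R) : {within cyl2 T delta, continuous (fun z => u z.1 z.2)} ->
  exists2 M : R, 0 <= M & forall t r, 0 <= t <= T -> delta <= r <= 1 -> `|u t r| <= M.
Proof.
move=> cu; have cK : compact (cyl2 T delta) by apply: compact_setX; exact: segment_compact.
have := continuous_compact cu cK => /compact_bounded [M [Mr hM]].
exists (`|M| + 1) => [|t r ht hr]; first by rewrite addr_ge0.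
apply: (hM (`|M| + 1)); first by rewrite (le_lt_trans (ler_norm _))// ltrDl.
by exists (t, r) => //; split; rewrite /= in_itv.
Qed.

Lemma data_bounds_exists (m : nat) : (4 < m)%N ->
  in_Hm delta m (fun z => a z.1 * cos z.2) -> in_Hm delta m (fun z => b z.1 z.2) ->
  smooth_on (cyl3 T delta) (fun z => f1 z.1.1 z.1.2 * cos z.2) ->
  smooth_on (cyl3 T delta) (fun z => f2 z.1.1 z.1.2 z.2) ->
  (forall t r, 0 <= t <= T -> delta <= r <= 1 -> periodic2pi (f2 t r)) ->
  exists M H K, data_bounds T delta a b f1 f2 uphi0 ux0 M H K.
Proof.
move=> hm ha hb hf1 hf2 pf2.
have t0 : 0 <= (0 : R) <= T by rewrite lexx ltW.
have pi0 := ltW (@pi2_gt0 R).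
have [M1 M10 hM1] := within_bounded_cyl2 (euler_phi_cont hu0).
have [M2 M20 hM2] := continuous_bounded_cyl pi0 (euler_x_cont hu0).
have clampcont : continuous (fun z : R * R => clamp delta z.1).
  by move=> z; apply: (continuous_comp (f := fst) (g := clamp delta)); [exact: cvg_fst|exact: continuous_clamp].
(* The inviscid flow at time 0, composed with [clamp], is the continuous extension of the data that
   duality needs; [a] is reached through its Cartesian component [a cos phi]. *)
have [H1 [H10 hH1 _]] : exists K : R, [/\ 0 <= K,
    forall r s phi, delta <= r <= 1 -> delta < s < 1 ->
      `|uphi0 0 (clamp delta r) * cos phi - uphi0 0 (clamp delta s) * cos phi| <= K * Num.sqrt `|r - s| &
    forall h r phi, 0 < h -> delta <= r <= 1 ->
      `|sdiff h (fun p => uphi0 0 (clamp delta r) * cos p) phi| <= K * h ^+ 2].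
  apply: (sobolev_regularity d0 d1 (G := fun z => uphi0 0 (clamp delta z.1) * cos z.2) hm ha).
  - move=> z; apply: cvgM.
      apply: (@within_continuous_comp R (R * R)%type (R * R)%type (cyl2 T delta) (fun z => uphi0 z.1 z.2) (fun z => (0, clamp delta z.1)) (euler_phi_cont hu0)).
        by move=> {}z; apply: (@continuous_pair (R * R)%type R R (fun=> 0) (fun z => clamp delta z.1)); [exact: cvg_cst|exact: clampcont].
      by move=> {}z; split; rewrite /= in_itv //=; exact: clamp_in.
    by apply: (continuous_comp (f := snd) (g := @cos R)); [exact: cvg_snd|exact: continuous_cos].
  - by move=> r phi /=; rewrite mulrDl mul1r -mulr2n cosD2pi.
  - move=> [r phi] [/= hr _]; have hr' : delta <= r <= 1 by move: hr; rewrite in_itv.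
    by rewrite clampK// (euler_phi_init hu0).
have [H2 [H20 hH2 hK2]] : exists K : R, [/\ 0 <= K,
    forall r s phi, delta <= r <= 1 -> delta < s < 1 ->
      `|ux0 0 (clamp delta r) phi - ux0 0 (clamp delta s) phi| <= K * Num.sqrt `|r - s| &
    forall h r phi, 0 < h -> delta <= r <= 1 ->
      `|sdiff h (fun p => ux0 0 (clamp delta r) p) phi| <= K * h ^+ 2].
  apply: (sobolev_regularity d0 d1 (G := fun z => ux0 0 (clamp delta z.1) z.2) hm hb).
  - apply: (@within_continuous_comp R (R * R)%type (R * R * R)%type (cyl3 T delta) (fun z => ux0 z.1.1 z.1.2 z.2) (fun z => ((0, clamp delta z.1), z.2)) (euler_x_cont hu0)).
      move=> z; apply: (@continuous_pair (R * R)%type (R * R)%type R (fun z => (0, clamp delta z.1)) snd); last exact: cvg_snd.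
      by apply: (@continuous_pair (R * R)%type R R (fun=> 0) (fun z => clamp delta z.1)); [exact: cvg_cst|exact: clampcont].
    by move=> z; do !split; rewrite /= in_itv //=; exact: clamp_in.
  - by move=> r; exact: (euler_x_periodic hu0 t0 (clamp_in d1 r)).
  - move=> [r phi] [/= hr _]; have hr' : delta <= r <= 1 by move: hr; rewrite in_itv.
    by rewrite clampK// (euler_x_init hu0).
have [L1 L10 hL1] := smooth_radial_lipschitz hf1.
have [L2 L20 hL2] := smooth_radial_lipschitz hf2.
have [L3 L30 hL3] := smooth_angular_sdiff hf2 pf2.
have ww s : delta < s < 1 -> delta <= s <= 1 by case/andP => *; rewrite !ltW.
have up (x y z : R) : x <= y -> 0 <= z -> x * z <= y * z by move=> *; exact: ler_wpM2r.
pose H := H1 + H2 + L1 + L2.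
(* The [+ 1] secures [0 < K], on which the strict inequality in the transport comparison rests. *)
exists (M1 + M2), H, (H2 + L3 + 1); split.
- by rewrite addr_ge0.
- by rewrite !addr_ge0.
- by rewrite ltr_wpDl// addr_ge0.
- by move=> t r ht hr; rewrite (le_trans (hM1 t r ht hr))// lerDl.
- move=> t r phi ht hr; have [p hp pp] := periodic_representative phi.
  rewrite (pp (ux0 t r)); last exact: (euler_x_periodic hu0 ht hr).
  by rewrite (le_trans (hM2 t r p ht hr hp))// lerDr.
(* At [phi = 0] the cosine equals 1, which recovers [a] from its Cartesian component; likewise [f1]
   below. *)
- move=> r s hr hs; have := hH1 r s 0 hr hs.
  rewrite (clampK hr) (clampK (ww _ hs)) (euler_phi_init hu0 hr) (euler_phi_init hu0 (ww _ hs)) cos0 !mulr1 => /le_trans; apply.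
  by apply: up; [rewrite /H -!addrA lerDl !addr_ge0|exact: sqrtr_ge0].
- move=> r s phi hr hs; have := hH2 r s phi hr hs.
  rewrite (clampK hr) (clampK (ww _ hs)) (euler_x_init hu0 phi hr) (euler_x_init hu0 phi (ww _ hs)) => /le_trans; apply.
  by apply: up; [rewrite /H; lra|exact: sqrtr_ge0].
- move=> t r s ht hr hs; have := hL1 t r s 0 ht hr (ww _ hs).
  rewrite /= cos0 !mulr1 lexx pi0 => /(_ isT) /le_trans; apply.
  by apply: ler_pM => //; [rewrite /H; lra|exact: (dist_le_sqrt d0 hr (ww _ hs))].
- move=> t r s phi ht hr hs; have [p hp pp] := periodic_representative phi.
  rewrite (pp (f2 t r)); last exact: pf2.
  rewrite (pp (f2 t s)); last by apply: pf2 => //; exact: ww.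
  apply: le_trans (hL2 t r s p ht hr (ww _ hs) hp) _.
  by apply: ler_pM => //; [rewrite /H; lra|exact: (dist_le_sqrt d0 hr (ww _ hs))].
- move=> h s phi h0 _ hs; have := hK2 h s phi h0 (ww _ hs).
  rewrite (clampK (ww _ hs)).
  have -> : (fun p => ux0 0 s p) = b s by apply/funext => p; exact: (euler_x_init hu0 p (ww _ hs)).
  by move/le_trans; apply; apply: up; [lra|exact: sqr_ge0].
- move=> t h s phi ht h0 _ hs; have := hL3 t s h phi ht (ww _ hs) (ltW h0).
  by move/le_trans; apply; apply: up; [lra|exact: sqr_ge0].
Qed.

End data_bounds_exist.

(** * From pointwise bounds to the energy norm *)

Section energy_norm.
Context {R : realType}.
Variables (T delta : R) (d0 : 0 < delta) (d1 : delta < 1).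
Local Notation leb := (@lebesgue_measure R).
Local Notation II F := (\int[@dr_dphi R]_(z in Omega delta) F z).

Lemma layer_le2 q r : 0 < q -> delta <= r <= 1 -> layer delta q r <= 2.
Proof.
move=> q0 /andP[r1 r2]; have q2 : 0 <= q ^- 2 by rewrite invr_ge0 exprn_ge0// ltW.
have e x : 0 <= x -> expR (- x / q ^+ 2) <= 1.
  by move=> x0; rewrite -(expR0 R) ler_expR mulNr oppr_le0 mulr_ge0.
have h1 := e (r - delta); have h2 := e (1 - r).
by rewrite /layer -[2]/(1 + 1); apply: lerD; [apply: h1|apply: h2]; rewrite subr_ge0.
Qed.

Lemma continuous_layer q : 0 < q -> continuous (layer delta q).
Proof.
move=> q0; pose c := q ^- 2.
have -> : layer delta q = (fun r => expR (- c * r + c * delta) + expR (c * r + - c)).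
  by apply/funext => r; rewrite /layer; congr (expR _ + expR _); rewrite /c; ring.
by move=> r; apply: cvgD; apply: is_derive_continuous (is_derive_exp_affine _ _ _).
Qed.

Lemma integral_layer q : 0 < q -> \int[leb]_(r in `[delta, 1]) layer delta q r <= 2 * q ^+ 2.
Proof.
move=> q0; have qn0 : q != 0 by rewrite gt_eqF.
pose c := q ^- 2.
pose P r := - q ^+ 2 * expR (- c * r + c * delta) + q ^+ 2 * expR (c * r + - c).
have dP (r : R) : is_derive r 1 P (layer delta q r).
  have := is_derive_lin (- q ^+ 2) (q ^+ 2) (is_derive_exp_affine (- c) (c * delta) r) (is_derive_exp_affine c (- c) r).
  move/is_derive_to; apply; rewrite /layer.
  have -> : - c * r + c * delta = - (r - delta) / q ^+ 2 by rewrite /c; ring.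
  have -> : c * r + - c = - (1 - r) / q ^+ 2 by rewrite /c; ring.
  by rewrite /c; field.
rewrite (Rintegral_FTC (ltW d1) (continuous_layer q0) dP) /P.
have -> : - c * delta + c * delta = 0 by ring.
have -> : c * 1 + - c = 0 by ring.
rewrite expR0; have q2 : 0 <= q ^+ 2 by exact: sqr_ge0.
have := mulr_ge0 q2 (expR_ge0 (- c * 1 + c * delta)).
have := mulr_ge0 q2 (expR_ge0 (c * delta - c)).
by lra.
Qed.

(* On Omega the squared layer is at most twice the layer, whose integral is O(q^2). *)
Lemma L2norm_le (g G : R * R -> R) (C q n : R) : 0 <= C -> 0 < q -> 0 <= n ->
  continuous G -> (forall z, Omega delta z -> g z = G z) ->
  (forall z, Omega delta z -> G z ^+ 2 <= 2 * (C * (layer delta q z.1 + q + n)) ^+ 2) ->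
  (L2norm delta g <= (C * (1 + 60 * pi) * (q + n))%:E)%E.
Proof.
move=> C0 q0 n0 cG gG hG; have q2 := sqr_ge0 q; have n2 := sqr_ge0 n.
have qn0 : 0 <= q + n by rewrite addr_ge0// ltW.
pose F (z : R * R) := G z ^+ 2 * z.1.
have cF : continuous F.
  by apply: continuous_mul2; [apply: continuous_mul2|move=> z; exact: cvg_fst].
pose X (r : R) := 2 * layer delta q r + (q ^+ 2 + n ^+ 2).
have cX : continuous X.
  move=> r; apply: cvgD; last exact: cvg_cst.
  by apply: cvgM; [exact: cvg_cst|exact: continuous_layer].
(* The factor 6 is [2 * 3]: the 2 of the hypothesis, and [(l + q + n)^2 <= 3 * (l^2 + q^2 + n^2)],
   where moreover [l^2 <= 2 * l]. *)
pose B (z : R * R) := (6 * C ^+ 2) * X z.1 * 1.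
have cB : continuous B.
  move=> z; apply: cvgM; last exact: cvg_cst.
  apply: cvgM; first exact: cvg_cst.
  by apply: (continuous_comp (f := fst) (g := X)); [exact: cvg_fst|exact: cX].
have E : (\int[@dr_dphi R]_(z in Omega delta) (g z ^+ 2 * z.1)%:E)%E = (II F)%:E.
  rewrite /Rintegral fineK; last first.
    apply: integrable_fin_num; first exact: measurable_Omega.
    exact: continuous_integrable_Omega (ltW d1) cF.
  by apply: eq_integral => z; rewrite inE => Oz; rewrite /F gG.
have FB : II F <= II B.
  apply: le_Rintegral; first exact: measurable_Omega.
  - exact: continuous_integrable_Omega (ltW d1) cF.
  - exact: continuous_integrable_Omega (ltW d1) cB.
  move=> z Oz; have [/= hr _] := Oz.
  have hr' : delta <= z.1 <= 1 by move: hr; rewrite in_itv.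
  have l2 := layer_le2 q0 hr'; have l0 := layer_gt0 delta q z.1.
  have ll : layer delta q z.1 ^+ 2 <= 2 * layer delta q z.1 by rewrite expr2 ler_wpM2r// ltW.
  have /andP[r1 r2] := hr'; have r0 : 0 <= z.1 by rewrite (le_trans (ltW d0)).
  apply: (@le_trans _ _ (2 * (C * (layer delta q z.1 + q + n)) ^+ 2 * 1)).
    by apply: ler_pM => //; [exact: sqr_ge0|exact: hG].
  rewrite mulr1 /B mulr1 exprMn mulrCA -[6 * C ^+ 2 * _]mulrA [leRHS]mulrCA.
  apply: ler_wpM2l; first exact: sqr_ge0.
  have := sqr_ge0 (layer delta q z.1 - q); have := sqr_ge0 (layer delta q z.1 - n); have := sqr_ge0 (q - n).
  by move: ll; rewrite /X; set l := layer _ _ _; rewrite !expr2; lra.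
have IB : II B <= (C * (1 + 60 * pi) * (q + n)) ^+ 2.
  have cc : continuous (fun r => 6 * C ^+ 2 * X r).
    by move=> r; apply: cvgM; [exact: cvg_cst|exact: cX].
  have -> : II B = \int[leb]_(r in `[delta, 1]) (6 * C ^+ 2 * X r) * \int[leb]_(phi in `[0, 2 * pi]) (fun=> 1) phi.
    by apply: (Rintegral_prod d1 cc) => z; exact: cvg_cst.
  have iX : leb.-integrable `[delta, 1] (EFin \o X) by exact: continuous_integrable_itv.
  have il : leb.-integrable `[delta, 1] (EFin \o layer delta q).
    by apply: continuous_integrable_itv; exact: continuous_layer.
  have cint (a b c : R) : a <= b -> \int[leb]_(r in `[a, b]) (cst c) r = c * (b - a).
    move=> ab; have cc' : continuous (cst c : R -> R) by move=> x; exact: cvg_cst.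
    by rewrite (Rintegral_FTC ab cc' (fun x => is_derive_affine c 0 x)); ring.
  rewrite (cint 0 (2 * pi) 1) ?(ltW (@pi2_gt0 R))// mul1r subr0.
  rewrite RintegralZl//.
  have -> : \int[leb]_(r in `[delta, 1]) X r = 2 * \int[leb]_(r in `[delta, 1]) layer delta q r + (q ^+ 2 + n ^+ 2) * (1 - delta).
    rewrite /X RintegralD//; first by rewrite RintegralZl// (cint delta 1 _ (ltW d1)).
    - by apply: (continuous_integrable_itv (f := fun r => 2 * layer delta q r)) => r; apply: cvgM; [exact: cvg_cst|exact: continuous_layer].
    - by apply: (continuous_integrable_itv (f := fun=> _)) => r; exact: cvg_cst.
  have il2 := integral_layer q0.
  have pi0 : 0 < @pi R by exact: pi_gt0.
  set J := \int[leb]_(r in `[delta, 1]) layer delta q r in il2 *.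
  have : 2 * J + (q ^+ 2 + n ^+ 2) * (1 - delta) <= 5 * (q + n) ^+ 2.
    have : (q ^+ 2 + n ^+ 2) * (1 - delta) <= q ^+ 2 + n ^+ 2.
      have dd := d0; rewrite ler_piMr ?addr_ge0//; lra.
    have : 0 <= q * n by rewrite mulr_ge0// ltW.
    by rewrite sqrrD; move: il2 n2; rewrite -mulr_natl; lra.
  move=> h; apply: (@le_trans _ _ (6 * C ^+ 2 * (5 * (q + n) ^+ 2) * (2 * pi))).
    apply: ler_wpM2r; first exact: ltW (@pi2_gt0 R).
    by apply: ler_wpM2l => //; rewrite mulr_ge0// sqr_ge0.
  (* [60 * pi] collects 6, the 5 of the radial integral and the angular length [2 * pi]; bounding it
     by [(1 + 60 * pi)^2] avoids a square root in the constant. *)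
  rewrite !exprMn; have -> : 6 * C ^+ 2 * (5 * (q + n) ^+ 2) * (2 * pi) = C ^+ 2 * (60 * pi) * (q + n) ^+ 2 by ring.
  apply: ler_wpM2r; first exact: sqr_ge0.
  apply: ler_wpM2l; first exact: sqr_ge0.
  by rewrite sqrrD; have := sqr_ge0 (60 * @pi R); rewrite expr1n mul1r -mulr_natl; lra.
have IF0 : 0 <= II F.
  apply: Rintegral_ge0 => z [/= + _]; rewrite in_itv /= => /andP[r1 _].
  by rewrite mulr_ge0 ?sqr_ge0// (le_trans (ltW d0)).
rewrite /L2norm E poweR_EFin lee_fin powR12_sqrt//.
have c0 : 0 <= C * (1 + 60 * pi) * (q + n).
  by rewrite !mulr_ge0// addr_ge0// mulr_ge0// ltW// pi_gt0.
by rewrite -[leRHS]ger0_norm// -sqrtr_sqr ler_wsqrtr// (le_trans FB).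
Qed.

(** The comparison reaches every [t < T]; the remaining time [T] is a null set for the essential
    supremum. *)
Lemma LooL2norm_le (vphi : R -> R -> R) (vx : R -> R -> R -> R) (c : R) :
  (forall t, 0 <= t < T ->
    (L2norm delta (fun z => Num.sqrt (vphi t z.1 ^+ 2 + vx t z.1 z.2 ^+ 2)) <= c%:E)%E) ->
  (LooL2norm T delta vphi vx <= c%:E)%E.
Proof.
move=> h; apply/ess_supP; exists (~` `[0, T[%classic); split.
- by apply: measurableC; exact: measurable_itv.
- rewrite /= /mrestr; apply/eqP; rewrite -measure_le0.
  have : ~` `[0, T[%classic `&` `[0, T]%classic `<=` [set T].
    move=> x [/= nx]; rewrite !in_itv /= in nx *; move=> /andP[x0 xT].
    by apply/eqP; rewrite eq_le xT leNgt; apply/negP => xT'; apply: nx; rewrite x0.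
  move/(le_measure leb); rewrite !inE => /(_ _ _)/le_trans; apply.
  + by apply: measurableI; [apply: measurableC|]; exact: measurable_itv.
  + exact: measurable_set1.
  + have E : (leb [set T] <= 0)%E by rewrite lebesgue_measure_set1.
    exact: E.
- move=> t /= nh; rewrite in_itv /= => ht; apply: nh; exact: h.
Qed.

End energy_norm.

(** * Unfreezing the radius *)

Section pointwise.
Context {R : realType}.
Variables (T delta : R) (T0 : 0 < T) (d0 : 0 < delta) (d1 : delta < 1).
Variables (a : R -> R) (b : R -> R -> R) (f1 : R -> R -> R) (f2 : R -> R -> R -> R)
  (uphi0 : R -> R -> R) (ux0 : R -> R -> R -> R).
Hypothesis hu0 : euler_solution T delta a b f1 f2 uphi0 ux0.

Lemma pointwise_stability (M H K : R) : data_bounds T delta a b f1 f2 uphi0 ux0 M H K ->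
  exists2 C : R, 0 <= C & forall (nu1 nu2 q : R) uphi ux, 0 < q -> q <= 1 -> q ^+ 4 = nu1 -> 0 < nu2 ->
    viscous_solution T delta nu1 nu2 a b f1 f2 uphi ux ->
    forall t r phi, 0 <= t < T -> delta <= r <= 1 ->
      `|uphi t r - uphi0 t r| <= C * (layer delta q r + q + nu2) /\
      `|ux t r phi - ux0 t r phi| <= C * (layer delta q r + q + nu2).
Proof.
move=> db; have M0 := db_M0 db; have H0 := db_H0 db; have K0 := db_K0 db.
pose C2 := (1 + H + M) * expR ((3 + 2 / delta + (H + M / delta ^+ 2)) * T).
pose K2 := K + 2 * K * T.
pose C3 := (1 + H + M) * expR ((3 + 2 / delta + (H + (2 * M + K2) * (C2 / delta + M / delta ^+ 2) + K2 / delta ^+ 2)) * T).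
have C20 : 0 <= C2 by rewrite mulr_ge0 ?addr_ge0 ?expR_ge0.
have C30 : 0 <= C3 by rewrite mulr_ge0 ?addr_ge0 ?expR_ge0.
exists (M + C2 + C3); first by rewrite !addr_ge0.
move=> nu1 nu2 q uphi ux q0 q1 qnu n0 hv t r phi ht hr.
have l0 := layer_gt0 delta q r.
have ht' : 0 <= t <= T by case/andP: ht => -> /ltW.
have B0 : 0 <= layer delta q r + q + nu2 by lra.
have le1 x : x <= M + C2 + C3 -> x * (layer delta q r + q + nu2) <= (M + C2 + C3) * (layer delta q r + q + nu2).
  by move=> h; exact: ler_wpM2r.
(* At the walls, where no radius can be frozen, the viscous flow vanishes and the layer is at least
   1, so the size of the inviscid flow is already admissible. *)
have Bdry : r = delta \/ r = 1 -> M <= (M + C2 + C3) * (layer delta q r + q + nu2).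
  move=> hb; apply: (@le_trans _ _ (M * (layer delta q r + q + nu2))); last by apply: le1; lra.
  rewrite ler_peMr// -addrA; have [l1 l2] := layer_boundary delta q0.
  have qn : 0 <= q + nu2 by rewrite ltW// addr_gt0.
  by apply: ler_wpDr => //; case: hb => ->.
have [rd|rd] := eqVneq r delta.
  have [e1 _] := visc_phi_bdry hv ht'; have [e2 _] := visc_x_bdry hv phi ht'.
  have := Bdry (or_introl rd); rewrite rd in hr *; rewrite e1 e2 !sub0r !normrN => h.
  by split; apply: le_trans h; [exact: (db_uphi db)|exact: (db_ux db)].
have [r1|r1] := eqVneq r 1.
  have [_ e1] := visc_phi_bdry hv ht'; have [_ e2] := visc_x_bdry hv phi ht'.
  have := Bdry (or_intror r1); rewrite r1 in hr *; rewrite e1 e2 !sub0r !normrN => h.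
  by split; apply: le_trans h; [exact: (db_uphi db)|exact: (db_ux db)].
have hr' : delta < r < 1 by case/andP: hr => rd' r1'; rewrite !lt_neqAle r1 rd' r1' eq_sym rd.
have bE : barrier delta q nu2 r r = layer delta q r + q + nu2.
  by rewrite /barrier subrr expr0n mul0r addr0.
split.
  apply: le_trans (phi_stability d0 d1 hu0 q0 q1 qnu n0 hv db hr' ht hr) _.
  by rewrite bE; apply: le1; rewrite -/C2; lra.
(* Frozen at [s = r], the angular estimate is still needed at every radius [r'], since the axial
   maximum may occur anywhere. *)
have hphi t' r' : 0 <= t' < T -> delta <= r' <= 1 -> `|uphi t' r' - uphi0 t' r| <= C2 * barrier delta q nu2 r r'.
  by move=> h1 h2; exact: (phi_stability d0 d1 hu0 q0 q1 qnu n0 hv db hr' h1 h2).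
apply: le_trans (x_stability T0 d0 d1 hu0 q0 q1 qnu n0 hv phi db (erefl K2) hr' C20 hphi ht hr) _.
by rewrite bE; apply: le1; rewrite -/C3; lra.
Qed.

End pointwise.

Theorem corollary3p1 (R : realType) (T delta : R) (m : nat)
    (a : R -> R) (b : R -> R -> R)
    (f1 : R -> R -> R) (f2 : R -> R -> R -> R)
    (uphi0 : R -> R -> R) (ux0 : R -> R -> R -> R)
    (hT : 0 < T) (hdelta : 0 < delta < 1) (hm : (4 < m)%N)
    (ha_sin : in_Hm delta m (fun z => - a z.1 * sin z.2))
    (ha_cos : in_Hm delta m (fun z => a z.1 * cos z.2))
    (hb : in_Hm delta m (fun z => b z.1 z.2))
    (hb_per : forall r, delta <= r <= 1 -> periodic2pi (b r))
    (hF_sin : smooth_on (cyl3 T delta) (fun z => - f1 z.1.1 z.1.2 * sin z.2))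
    (hF_cos : smooth_on (cyl3 T delta) (fun z => f1 z.1.1 z.1.2 * cos z.2))
    (hf2 : smooth_on (cyl3 T delta) (fun z => f2 z.1.1 z.1.2 z.2))
    (hf2_per : forall t r, 0 <= t <= T -> delta <= r <= 1 ->
       periodic2pi (f2 t r))
    (ha_bdry : forall rho, rho = delta \/ rho = 1 -> a rho = 0)
    (hb_bdry : forall rho phi, rho = delta \/ rho = 1 -> b rho phi = 0)
    (hu0 : euler_solution T delta a b f1 f2 uphi0 ux0) :
  exists c : R, forall nu1 nu2 : R, 0 < nu1 <= 1 -> 0 < nu2 <= 1 ->
    (forall rho, rho = delta \/ rho = 1 ->
       compatible_at delta nu1 nu2 a b f1 f2 rho) ->
    forall (uphi : R -> R -> R) (ux : R -> R -> R -> R),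
    viscous_solution T delta nu1 nu2 a b f1 f2 uphi ux ->
    (LooL2norm T delta (fun t r => (uphi t r - uphi0 t r)%R)
       (fun t r phi => (ux t r phi - ux0 t r phi)%R)
     <= (c * (nu1 `^ (4^-1) + nu2))%:E)%E.
Proof.
have [d0 d1] := andP hdelta.
have [M [H [K db]]] := data_bounds_exists hT d0 d1 hu0 hm ha_cos hb hF_cos hf2 hf2_per.
have [C C0 hC] := pointwise_stability hT d0 d1 hu0 db.
exists (C * (1 + 60 * pi)) => nu1 nu2 /andP[n10 n11] /andP[n20 n21] _ uphi ux hv.
set q := nu1 `^ (4^-1).
have q0 : 0 < q by exact: powR_gt0.
have q1 : q <= 1.
  have <- : 1 `^ (4^-1) = 1 :> R by rewrite powR1.
  by apply: ge0_ler_powR; rewrite ?nnegrE ?invr_ge0// ltW.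
have qnu : q ^+ 4 = nu1.
  by rewrite -powR_mulrn ?ltW// -powRrM mulVf ?powRr1// ltW.
apply: LooL2norm_le => t ht.
have ht' : 0 <= t <= T by case/andP: ht => -> /ltW.
(* Clamping makes the squared error continuous on the whole plane without changing it on [Omega]. *)
pose E (z : R * R) := (uphi t (clamp delta z.1) - uphi0 t (clamp delta z.1)) ^+ 2
  + (ux t (clamp delta z.1) z.2 - ux0 t (clamp delta z.1) z.2) ^+ 2.
pose G (z : R * R) := Num.sqrt (E z).
have Gsqr z : G z ^+ 2 = E z by rewrite sqr_sqrtr// addr_ge0// sqr_ge0.
apply: (L2norm_le d0 d1 (G := G) C0 q0 (ltW n20)).
- have cc : continuous (fun z : R * R => clamp delta z.1).
    by move=> z; apply: (continuous_comp (f := fst) (g := clamp delta)); [exact: cvg_fst|exact: continuous_clamp].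
  have c2 (u : R -> R -> R) : {within cyl2 T delta, continuous (fun z => u z.1 z.2)} ->
      continuous (fun z : R * R => u t (clamp delta z.1)).
    move=> cu; apply: (@within_continuous_comp R (R * R)%type (R * R)%type (cyl2 T delta) (fun z => u z.1 z.2) (fun z => (t, clamp delta z.1)) cu).
      by move=> z; apply: (@continuous_pair (R * R)%type R R (fun=> t) (fun z => clamp delta z.1)); [exact: cvg_cst|exact: cc].
    by move=> z; split; rewrite /= in_itv //=; exact: clamp_in.
  have c3 (u : R -> R -> R -> R) : {within cyl3 T delta, continuous (fun z => u z.1.1 z.1.2 z.2)} ->
      continuous (fun z : R * R => u t (clamp delta z.1) z.2).
    move=> cu; apply: (@within_continuous_comp R (R * R)%type (R * R * R)%type (cyl3 T delta) (fun z => u z.1.1 z.1.2 z.2) (fun z => ((t, clamp delta z.1), z.2)) cu).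
      move=> z; apply: (@continuous_pair (R * R)%type (R * R)%type R (fun z => (t, clamp delta z.1)) snd); last exact: cvg_snd.
      by apply: (@continuous_pair (R * R)%type R R (fun=> t) (fun z => clamp delta z.1)); [exact: cvg_cst|exact: cc].
    by move=> z; do !split; rewrite /= in_itv //=; exact: clamp_in.
  have cb (u v : R * R -> R) : continuous u -> continuous v -> continuous (fun z => (u z - v z) ^+ 2).
    by move=> cu cv; apply: continuous_mul2 => z; apply: cvgB; [exact: cu|exact: cv|exact: cu|exact: cv].
  move=> z; apply: (@continuous_comp (R * R)%type R R E (@Num.sqrt R)); last exact: sqrt_continuous.
  apply: cvgD; [apply: cb|apply: cb].
  + exact: c2 (visc_phi_cont hv).
  + exact: c2 (euler_phi_cont hu0).
  + exact: c3 (visc_x_cont hv).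
  + exact: c3 (euler_x_cont hu0).
- move=> [r phi] [/= hr _]; have hr' : delta <= r <= 1 by move: hr; rewrite in_itv.
  by rewrite /G /E /= clampK.
- move=> [r phi] [/= hr _]; have hr' : delta <= r <= 1 by move: hr; rewrite in_itv.
  rewrite Gsqr /E /= clampK//; have [h1 h2] := hC nu1 nu2 q uphi ux q0 q1 qnu n20 hv t r phi ht hr'.
  set B := C * _ in h1 h2 *; have B0 : 0 <= B by exact: le_trans h1.
  have sq (x : R) : `|x| <= B -> x ^+ 2 <= B ^+ 2.
    by move=> h; rewrite -(real_normK (num_real x)) lerXn2r// nnegrE.
  by rewrite mulr_natl mulr2n; apply: lerD; apply: sq.
Qed.
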